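(* Let $f:\mathbb{R}^d\to\mathbb{R}$ be bounded below by $f^*\in\mathbb{R}$ and twice continuously differentiable with $L_H$-Lipschitz continuous Hessian $\nabla^2 f$ ($L_H>0$). Let $\epsilon>0$. Apply R-ARC (defined in the context) to $f$ for $N$ iterations, with $\mathcal{S}$ the distribution of scaled Gaussian matrices in $\mathbb{R}^{l\times d}$, and suppose that $\nabla^2 f(x_k)$ has rank at most $r\le d$ for all $k$. Choose the sketch dimension $l=4C_l(\log 16+r+1)$ (understood to be an integer), where $C_l$ is the absolute constant described in the context, and assume that the algorithm parameter $c$ satisfies $\frac18<\frac{c}{(c+1)^2}$. Put $\epsilon_S^{(2)}=\frac12$, $$S_{\max}=1+\frac{\sqrt d+\sqrt{2\log 16}}{\sqrt{4C_l(\log 16+r+1)}},\qquad \alpha_{low}=\frac{2(1-\theta)}{L_H},\qquad \tau_\alpha=\left\lceil \log_{\gamma_1}\Big(\min\Big\{\frac{\alpha_{low}}{\alpha_0},\frac1{\gamma_2}\Big\}\Big)\right\rceil,$$ $$h(\epsilon,\alpha)=\frac{\theta}{3\alpha_{\max}}\Big(\frac{\epsilon}{2}\Big)^{3/2}\min\left\{\frac{2^{3/2}}{L_H^{3/2}},\ \left(\frac{\sqrt{1-\epsilon_S^{(2)}}}{\frac1\alpha S_{\max}+\kappa_T}\right)^{3/2}\right\}.$$ Then for any $\delta_1\in(0,1)$ such that $$g(\delta_1):=\left[\tfrac78(1-\delta_1)-1+\tfrac{c}{(c+1)^2}\right]^{-1}>0,$$ if $N\in\mathbb{N}$ satisfies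 $$N\ \ge\ g(\delta_1)\left[\frac{f(x_0)-f^*}{h(\epsilon,\alpha_0\gamma_1^{c+\tau_\alpha})}+\frac{\tau_\alpha}{1+c}\right],$$ then $$\mathbb{P}\left(\min_{k\le N}\|\nabla f(x_{k+1})\|_2\le\epsilon\right)\ \ge\ 1-e^{-\frac{7\delta_1^2}{16}N}.$$
   Context: Scaled Gaussian matrix: $S\in\mathbb{R}^{l\times d}$ with independent $N(0,1/l)$ entries. Constant $C_l$: an absolute constant $C_l>0$ such that for every $\varepsilon\in(0,1)$, all $l,d,r$, every fixed matrix $M\in\mathbb{R}^{d\times(d+1)}$ of rank at most $r+1$, and a scaled Gaussian matrix $S\in\mathbb{R}^{l\times d}$, with probability at least $1-e^{-l\varepsilon^2/C_l+r+1}$ one has $\|SMz\|_2^2\ge(1-\varepsilon)\|Mz\|_2^2$ simultaneously for all $z\in\mathbb{R}^{d+1}$ (such a constant exists). R-ARC algorithm (for minimizing a $C^2$ function $f:\mathbb{R}^d\to\mathbb{R}$, with sketch dimension $l$ and a distribution $\mathcal{S}$ on $\mathbb{R}^{l\times d}$). Parameters: $\gamma_1\in(0,1)$, a positive integer $c$, $\gamma_2=\gamma_1^{-c}$, $\theta\in(0,1)$, $\kappa_T,\kappa_S\ge0$, $\alpha_{\max}>0$, a positive integer $p$, $\alpha_0=\alpha_{\max}\gamma_1^p$, and a deterministic starting point $x_0\in\mathbb{R}^d$. At each iteration $k=0,1,2,\dots$: 1. Draw $S_k\sim\mathcal{S}$ independently of the past. Let $\hat q_k(\hat s)=f(x_k)+\langle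 S_k\nabla f(x_k),\hat s\rangle+\frac12\langle\hat s,S_k\nabla^2f(x_k)S_k^T\hat s\rangle$ and $\hat m_k(\hat s)=\hat q_k(\hat s)+\frac1{3\alpha_k}\|S_k^T\hat s\|_2^3$ for $\hat s\in\mathbb{R}^l$. Compute some $\hat s_k\in\mathbb{R}^l$ (depending measurably on the information available) with (i) $\hat m_k(\hat s_k)\le\hat m_k(0)$ and (ii) $\|\nabla\hat m_k(\hat s_k)\|_2\le\kappa_T\|S_k^T\hat s_k\|_2^2$. (The algorithm may additionally require (iii) $\nabla^2\hat m_k(\hat s_k)\succeq-\kappa_S\|S_k^T\hat s_k\|_2 I$; this is not needed for first-order results.) Set $s_k=S_k^T\hat s_k$. 2. If $f(x_k)-f(x_k+s_k)\ge\theta[\hat q_k(0)-\hat q_k(\hat s_k)]$, the iteration is successful: $x_{k+1}=x_k+s_k$ and $\alpha_{k+1}=\min\{\alpha_{\max},\gamma_2\alpha_k\}$. Otherwise it is unsuccessful: $x_{k+1}=x_k$ and $\alpha_{k+1}=\gamma_1\alpha_k$. *)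

(* Defs.v *)
From HB Require Import structures.
From mathcomp Require Import all_boot all_order all_algebra.
From mathcomp Require Import all_classical all_reals all_analysis.

Set Implicit Arguments.
Unset Strict Implicit.
Unset Printing Implicit Defensive.

Import Order.TTheory GRing.Theory Num.Theory.
Import numFieldNormedType.Exports.

Local Open Scope classical_set_scope.
Local Open Scope ring_scope.

(* The library norm on matrices is the sup norm, so the Euclidean norm and its
   induced operator norm are defined here. *)

Section euclidean.
Context {R : realType}.

Definition dot n (u v : 'cV[R]_n) : R := \sum_i u i 0 * v i 0.

Definition norm2 n (u : 'cV[R]_n) : R := Num.sqrt (dot u u).

Definition opnorm2 m n (A : 'M[R]_(m, n)) : R :=
  sup [set norm2 (A *m v) | v in [set v : 'cV[R]_n | norm2 v <= 1]].

Definition grad n (f : 'cV[R]_n -> R) (x : 'cV[R]_n) : 'cV[R]_n :=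
  \col_i 'D_(delta_mx i 0) f x.

Definition hess n (f : 'cV[R]_n -> R) (x : 'cV[R]_n) : 'M[R]_n :=
  \matrix_(i, j) 'D_(delta_mx j 0) (fun y => grad f y i 0) x.

Definition twice_continuously_differentiable n (f : 'cV[R]_n -> R) : Prop :=
  [/\ forall x, differentiable f x,
      forall x, differentiable (grad f) x &
      continuous (hess f)].

Definition lipschitz_hessian n (L : R) (f : 'cV[R]_n -> R) : Prop :=
  forall x y, opnorm2 (hess f x - hess f y) <= L * norm2 (x - y).

End euclidean.

Section random_matrices.
Context {R : realType} {disp : measure_display} {T : measurableType disp}.
Implicit Types (P : probability T R) (F G : set (set T)).

Definition entry m n (X : T -> 'M[R]_(m, n)) (i : 'I_m) (j : 'I_n) : T -> R :=
  fun w => X w i j.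

Definition mx_measurable_wrt F m n (X : T -> 'M[R]_(m, n)) : Prop :=
  forall i j (B : set R), measurable B -> F (entry X i j @^-1` B).

Definition sigma_mx m n (X : T -> 'M[R]_(m, n)) : set (set T) :=
  <<s [set A | exists i j, exists2 B : set R,
                 measurable B & A = entry X i j @^-1` B] >>.

Definition independent_families P F G : Prop :=
  forall A B, F A -> G B -> P (A `&` B) = (P A * P B)%E.

Definition independent_entries P m n (X : T -> 'M[R]_(m, n)) : Prop :=
  forall B : 'I_m -> 'I_n -> set R, (forall i j, measurable (B i j)) ->
    P [set w | forall i j, B i j (X w i j)] =
    (\prod_i \prod_j P (entry X i j @^-1` B i j))%E.

(* The second parameter of normal_prob is the standard deviation. *)
Definition scaled_gaussian P l d (S : T -> 'M[R]_(l, d)) : Prop :=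
  [/\ forall i j, measurable_fun setT (entry S i j),
      forall i j (B : set R), measurable B ->
        pushforward P (entry S i j) B = normal_prob 0 (Num.sqrt l%:R^-1) B &
      independent_entries P S].

Definition is_filtration (F : nat -> set (set T)) : Prop :=
  [/\ forall k, sigma_algebra setT (F k),
      forall k, F k `<=` measurable &
      forall k, F k `<=` F k.+1].

End random_matrices.

Definition embedding_constant (R : realType) (Cl : R) : Prop :=
  0 < Cl /\
  forall (eps : R) (l d r : nat) (M : 'M[R]_(d, d.+1)),
    0 < eps < 1 -> (\rank M <= r.+1)%N ->
    forall (disp : measure_display) (T : measurableType disp)
      (P : probability T R) (S : T -> 'M[R]_(l, d)),
    scaled_gaussian P S ->
    ((1 - expR (- (l%:R * eps ^+ 2 / Cl) + r%:R + 1))%:E <=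
     P [set w | forall z : 'cV[R]_(d.+1),
          ((1 - eps) * norm2 (M *m z) ^+ 2 <= norm2 (S w *m M *m z) ^+ 2)%R])%E.

Record rarc_params (R : realType) := RarcParams {
  gamma1 : R;
  cexp : nat;
  theta : R;
  kappaT : R;
  alpha_max : R;
  pexp : nat;
  gamma1_itv : 0 < gamma1 < 1;
  cexp_gt0 : (0 < cexp)%N;
  theta_itv : 0 < theta < 1;
  kappaT_ge0 : 0 <= kappaT;
  alpha_max_gt0 : 0 < alpha_max;
  pexp_gt0 : (0 < pexp)%N }.

Section rarc.
Context {R : realType}.
Implicit Types pr : rarc_params R.

Definition gamma2 pr : R := gamma1 pr ^- cexp pr.

Definition alpha0 pr : R := alpha_max pr * gamma1 pr ^+ pexp pr.

Definition qhat l d (f : 'cV[R]_d -> R) (x : 'cV[R]_d) (S : 'M[R]_(l, d))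
    (s : 'cV[R]_l) : R :=
  f x + dot (S *m grad f x) s + 2^-1 * dot s (S *m hess f x *m S^T *m s).

Definition mhat l d (f : 'cV[R]_d -> R) (x : 'cV[R]_d) (S : 'M[R]_(l, d))
    (alpha : R) (s : 'cV[R]_l) : R :=
  qhat f x S s + (3 * alpha)^-1 * norm2 (S^T *m s) ^+ 3.

Definition successful pr l d (f : 'cV[R]_d -> R) (x : 'cV[R]_d)
    (S : 'M[R]_(l, d)) (s : 'cV[R]_l) : bool :=
  theta pr * (qhat f x S 0 - qhat f x S s) <= f x - f (x + S^T *m s).

(* Iterations 0, ..., n - 1, producing x_0, ..., x_n.  [F k] is the information
   available just before [S k] is drawn; it may be larger than the sigma-algebra
   generated by [S 0], ..., [S k.-1], so the step computation may itself be
   randomized.  The optional second-order condition on the step is not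
   required. *)
Record rarc_run pr disp (T : measurableType disp) (P : probability T R)
    l d (f : 'cV[R]_d -> R) (x0 : 'cV[R]_d) (n : nat)
    (F : nat -> set (set T)) (S : nat -> T -> 'M[R]_(l, d))
    (shat : nat -> T -> 'cV[R]_l) (x : nat -> T -> 'cV[R]_d)
    (alpha : nat -> T -> R) : Prop := RarcRun {
  run_filtration : is_filtration F;
  run_x_init : forall w, x 0%N w = x0;
  run_alpha_init : forall w, alpha 0%N w = alpha0 pr;
  run_sketch_indep : forall k, (k < n)%N ->
    independent_families P (F k) (sigma_mx (S k));
  run_sketch_adapted : forall k, (k < n)%N -> mx_measurable_wrt (F k.+1) (S k);
  run_step_adapted : forall k, (k < n)%N ->
    mx_measurable_wrt (F k.+1) (shat k);
  run_model_decrease : forall k w, (k < n)%N ->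
    mhat f (x k w) (S k w) (alpha k w) (shat k w) <=
    mhat f (x k w) (S k w) (alpha k w) 0;
  run_model_grad : forall k w, (k < n)%N ->
    norm2 (grad (mhat f (x k w) (S k w) (alpha k w)) (shat k w)) <=
    kappaT pr * norm2 ((S k w)^T *m shat k w) ^+ 2;
  run_update : forall k w, (k < n)%N ->
    if successful pr f (x k w) (S k w) (shat k w) then
      x k.+1 w = x k w + (S k w)^T *m shat k w /\
      alpha k.+1 w = Num.min (alpha_max pr) (gamma2 pr * alpha k w)
    else
      x k.+1 w = x k w /\ alpha k.+1 w = gamma1 pr * alpha k w }.

Definition S_max (Cl : R) (d r : nat) : R :=
  1 + (Num.sqrt d%:R + Num.sqrt (2 * ln 16)) /
      Num.sqrt (4 * Cl * (ln 16 + r%:R + 1)).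

Definition alpha_low pr (LH : R) : R := 2 * (1 - theta pr) / LH.

Definition tau_alpha pr (LH : R) : int :=
  Num.ceil (ln (Num.min (alpha_low pr LH / alpha0 pr) (gamma2 pr)^-1) /
            ln (gamma1 pr)).

Definition hbound pr (LH epsS Smax eps alpha : R) : R :=
  theta pr / (3 * alpha_max pr) * (eps / 2) `^ (3 / 2) *
  Num.min (2 `^ (3 / 2) / LH `^ (3 / 2))
          ((Num.sqrt (1 - epsS) / (alpha^-1 * Smax + kappaT pr)) `^ (3 / 2)).

Definition gfactor pr (delta1 : R) : R :=
  (7 / 8 * (1 - delta1) - 1 + (cexp pr)%:R / ((cexp pr)%:R + 1) ^+ 2)^-1.

End rarc.

(* Main.v *)
Require Import Defs.
From HB Require Import structures.
From mathcomp Require Import all_boot all_order all_algebra.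
From mathcomp Require Import all_classical all_reals all_analysis.
From mathcomp Require Import measurable_realfun ring lra zify.

Set Implicit Arguments.
Unset Strict Implicit.
Unset Printing Implicit Defensive.

Import Order.TTheory GRing.Theory Num.Theory.
Import numFieldNormedType.Exports.

Local Open Scope classical_set_scope.
Local Open Scope ring_scope.

(* Call iteration k true when S_k embeds the range of [grad f(x_k) | hess f(x_k)]
   with distortion 1/2 and has operator norm at most S_max.  Conditionally on the
   past each of the two properties fails with probability at most 1/16: the first
   by the definition of C_l, the second by Gordon's bound
   P(||S|| > 1 + (sqrt d + t) / sqrt l) <= exp(-t^2/2) at t = sqrt(2 log 16).
   Hence the number of true iterations among N is at most (7/8)(1 - delta1)N with
   probability at most exp(-7 delta1^2 N / 16) (Chernoff).

   Along a fixed path, alpha_k = alpha_0 gamma_1^(a_k) with integers a_k.  An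
   iteration with alpha_k <= alpha_low is successful, so a_k never exceeds
   tau_alpha; an unsuccessful iteration raises a_k by 1 and a successful one lowers
   it by at most c, so at least (N - tau_alpha) / (1 + c) iterations are
   successful.  A true and successful iteration ending at a point with gradient
   larger than epsilon decreases f by at least h, and f never increases, so too
   many true iterations would push f below f^*.

   Gordon's bound follows from a Slepian comparison of the bilinear process
   u^T G v, plus an independent Gaussian, with the linear process g.u + h.v.  The
   comparison is proved for the smooth orthant indicator
   exp(- sum_i exp(beta x_i)) by Lindeberg's replacement method, for finitely many
   unit vectors; continuity and a countable dense grid do the rest. *)

(** * Gaussian integrals *)

(** The step s_k is computed after S_k is drawn, so an embedding of one prescribed vector would be
    useless. The vector to be controlled, grad f(x_k) + hess f(x_k) s_k, always lies in the range of
    [grad f(x_k) | hess f(x_k)], a matrix known before S_k and of rank at most r + 1. The embedding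
    holds on that whole range at once, which is why r + 1 enters the sketch dimension. Slepian's
    inequality requires equal variances. With unit vectors the bilinear process has variance s^2 and
    the linear one 2 s^2; the extra independent Gaussian fills the gap. It is removed through
    exponential moments: at the rate t / s it contributes exactly the factor exp(t^2/2), which can
    be divided out. Comparing moments at this rate yields the deviation bound in one stroke, with no
    separate estimate of the mean and of the fluctuation around it. Covariances are encoded by lists
    of vectors, and the small steps of Lindeberg's method come from the 2-stability of the normal
    law. Events quantified over all vectors are reduced to countable grids, which makes them
    measurable. *)

Section normal_integrals.
Context {R : realType}.
Notation mu := (@lebesgue_measure R).

Lemma ge0_integral_normal_prob (m s : R) (f : R -> \bar R) :
  measurable_fun [set: R] f -> (forall x, 0 <= f x)%E ->
  (\int[normal_prob m s]_x f x = \int[mu]_x (f x * (normal_pdf m s x)%:E))%E.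
Proof.
move=> mf f0.
have dom := normal_prob_dominates m s.
rewrite -(Radon_Nikodym_SigmaFinite.change_of_variables dom f0)//.
apply: ae_eq_integral => //.
- apply: emeasurable_funM => //; apply: (measurable_int mu).
  exact: Radon_Nikodym_SigmaFinite.f_integrable.
- apply: emeasurable_funM => //=; apply/measurableT_comp => //=.
  exact: measurable_normal_pdf.
- apply: ae_eqe_mul2l => /=.
  apply: integral_ae_eq => //=.
  + exact: Radon_Nikodym_SigmaFinite.f_integrable.
  + by apply/measurableT_comp => //; exact: measurable_normal_pdf.
  + by move=> E _ mE; rewrite -Radon_Nikodym_SigmaFinite.f_integral.
Qed.

Lemma ge0_integral_affine (a b : R) (G : R -> R) : 0 < a -> continuous G ->
  (forall x, 0 <= G x) ->
  (\int[mu]_x (G x)%:E = \int[mu]_x (G (a * x + b) * a)%:E)%E.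
Proof.
move=> a0 cG G0.
pose F (x : R) : R := a * x + b.
have dF (x : R) : is_derive x (1 : R) F a.
  by rewrite /F; apply: is_derive_eq; rewrite addr0 scaler1.
have F'E : F^`()%classic = cst a.
  by apply/funext => x; rewrite derive1E; exact: derive_val.
rewrite (@increasing_ge0_integration_by_substitutionT _ F G)//.
- by rewrite F'E.
- by move=> x y xy; rewrite /F ltrD2r ltr_pM2l.
- by rewrite F'E => ?; exact: cvg_cst.
- by rewrite F'E; exact: is_cvg_cst.
- by rewrite F'E; exact: is_cvg_cst.
- apply: (cvg_comp (fun x => a * x) (fun y => y + b)); last exact: cvg_addrr_Ny.
  exact: gt0_cvgMrNy.
- apply: (cvg_comp (fun x => a * x) (fun y => y + b)); last exact: cvg_addrr.
  exact: gt0_cvgMry.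
Qed.

Lemma ge0_integral_opp (G : R -> R) : continuous G -> (forall x, 0 <= G x) ->
  (\int[mu]_x (G x)%:E = \int[mu]_x (G (- x))%:E)%E.
Proof.
move=> cG G0.
have split (H : R -> R) : continuous H -> (forall x, 0 <= H x) ->
   (\int[mu]_x (H x)%:E = \int[mu]_(x in `]-oo, 0%R]) (H x)%:E +
     \int[mu]_(x in `[0%R, +oo[) (H x)%:E)%E.
  move=> cH H0.
  rewrite -(setUv `]-oo, 0%R]) ge0_integral_setU//=; last 4 first.
  - by apply: measurableC.
  - apply/measurable_EFinP/measurable_funTS; exact: continuous_measurable_fun.
  - by move=> x _; rewrite lee_fin.
  - exact/disj_setPCl.
  congr (_ + _)%E; rewrite setCitvl/=.
  by rewrite integral_itv_obnd_cbnd//; apply/measurable_EFinP/measurable_funTS; exact: continuous_measurable_fun.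
have cN : continuous (fun x => G (- x)).
  by move=> x; apply: (cvg_comp (-%R) G); [exact: opp_continuous|exact: cG].
rewrite split// [RHS]split// addeC; congr (_ + _)%E.
  rewrite -{2}[0]oppr0 ge0_integration_by_substitutionNy.
  - by apply: eq_integral => x _ /=; rewrite opprK.
  - exact: continuous_subspaceT.
  - by [].
rewrite -{1}[0]oppr0 ge0_integration_by_substitutionNy//.
exact: continuous_subspaceT.
Qed.

Lemma normal_pdf_gt0E (m s x : R) : s != 0 ->
  normal_pdf m s x = normal_peak s * expR (- (x - m) ^+ 2 / (s ^+ 2 *+ 2)).
Proof. by move=> s0; rewrite normal_pdfE. Qed.

(** Completing the square turns the integrand into a constant times the normal density with mean la
    s^2. *)
Lemma integral_normal_expZ (s la : R) : s != 0 ->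
  (\int[normal_prob 0 s]_z (expR (la * z))%:E =
   (expR (la ^+ 2 * s ^+ 2 / 2))%:E)%E.
Proof.
move=> s0; rewrite ge0_integral_normal_prob; last 2 first.
- by apply/measurable_EFinP; apply: measurableT_comp => //; exact: mulrl_measurable.
- by move=> x; rewrite lee_fin expR_ge0.
under eq_integral => x _.
  rewrite -EFinM (_ : expR (la * x) * normal_pdf 0 s x = expR (la ^+ 2 * s ^+ 2 / 2) *
    normal_pdf (la * s ^+ 2) s x); last first.
    rewrite !normal_pdf_gt0E// mulrCA [RHS]mulrCA -!expRD; congr (_ * expR _).
    by field.
  rewrite EFinM; over.
rewrite integralZl//; last exact: integrable_normal_pdf.
by rewrite integral_normal_pdf mule1.
Qed.

(** The factor exp(c z^2) only changes the variance: the integrand is q^-1 times the centred density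
    of standard deviation s / q, where q^2 = 1 - 2 c s^2. *)
Lemma integral_normal_expsqr (s c : R) : 0 < s -> 2 * c * s ^+ 2 < 1 ->
  (\int[normal_prob 0 s]_z (expR (c * z ^+ 2))%:E =
   ((Num.sqrt (1 - 2 * c * s ^+ 2))^-1)%:E)%E.
Proof.
move=> s0 cs; set q := Num.sqrt _.
have q0 : 0 < q by rewrite sqrtr_gt0 subr_gt0.
have q2 : q ^+ 2 = 1 - 2 * c * s ^+ 2 by rewrite sqr_sqrtr// subr_ge0 ltW.
have sN0 : s != 0 by rewrite gt_eqF.
have qN0 : q != 0 by rewrite gt_eqF.
have sqN0 : s / q != 0 by rewrite mulf_neq0// invr_eq0.
rewrite ge0_integral_normal_prob; last 2 first.
- apply/measurable_EFinP; apply: measurableT_comp => //.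
  by apply: measurable_funM => //; exact: measurable_funX.
- by move=> x; rewrite lee_fin expR_ge0.
under eq_integral => x _.
  rewrite -EFinM (_ : expR (c * x ^+ 2) * normal_pdf 0 s x = q^-1 * normal_pdf 0 (s / q) x); last first.
    rewrite !normal_pdf_gt0E// mulrCA -expRD mulrA; congr (_ * expR _).
      rewrite /normal_peak.
      have -> : (s / q) ^+ 2 * pi *+ 2 = (s ^+ 2 * pi *+ 2) * (q^-1) ^+ 2.
        ring.
      rewrite sqrtrM; last by rewrite mulrn_wge0// mulr_ge0 ?pi_ge0// sqr_ge0.
      rewrite sqrtr_sqr gtr0_norm ?invr_gt0// invfM invrK.
      by rewrite mulrCA mulVf// mulr1.
    have -> : (s / q) ^+ 2 *+ 2 = 2 * s ^+ 2 / q ^+ 2 by field.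
    have -> : - (x - 0) ^+ 2 / (2 * s ^+ 2 / q ^+ 2) = - x ^+ 2 * q ^+ 2 / (2 * s ^+ 2) by field; rewrite sN0.
    by rewrite q2; field.
  rewrite EFinM; over.
rewrite integralZl//; last exact: integrable_normal_pdf.
by rewrite integral_normal_pdf mule1.
Qed.

(** |z|^3 <= 1 + z^4 is dominated by a multiple of exp(c z^2), with c chosen so that 2 c s^2 = 1/2.
    The third moment controls the remainder in Lindeberg's method. *)
Lemma integrable_normal_normX3 (s : R) : 0 < s ->
  (normal_prob 0 s).-integrable setT (fun z => (`|z| ^+ 3)%:E).
Proof.
move=> s0.
have s0' : s != 0 by rewrite gt_eqF.
pose c := (4 * s ^+ 2)^-1.
have c0 : 0 < c by rewrite invr_gt0 mulr_gt0// exprn_gt0.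
have cs : 2 * c * s ^+ 2 < 1.
  have -> : 2 * c * s ^+ 2 = 2^-1 by rewrite /c; field.
  by lra.
apply: (@le_integrable _ _ _ (normal_prob 0 s) setT measurableT _
  (fun z : R => ((1 + 2 / c ^+ 2) * expR (c * z ^+ 2))%:E)) => //.
- by apply/measurable_EFinP; apply: measurable_funX; exact: normr_measurable.
- move=> z _ /=; rewrite lee_fin normrX normr_id [leRHS]ger0_norm; last first.
    by rewrite mulr_ge0 ?expR_ge0// addr_ge0// divr_ge0// exprn_ge0// ltW.
  have e2 : (c * z ^+ 2) ^+ 2 / 2 <= expR (c * z ^+ 2).
    have := @expR_ge1Dxn R (c * z ^+ 2) 1.
    rewrite mulr_ge0 ?sqr_ge0 ?(ltW c0)// => /(_ isT).
    have -> : 2`!%:R = 2 :> R by [].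
    by move=> H; apply: le_trans H; rewrite lerDr.
  have e1 : 1 <= expR (c * z ^+ 2).
    by rewrite -[leLHS]expR0 ler_expR mulr_ge0 ?sqr_ge0// ltW.
  apply: (@le_trans _ _ (1 + (z ^+ 2) ^+ 2)).
    rewrite -(real_normK (num_real z)); have := normr_ge0 z.
    by move: `|z| => y y0; nra.
  rewrite mulrDl mul1r lerD// mulrAC ler_pdivlMr ?exprn_gt0//.
  by rewrite -exprMn (mulrC (z ^+ 2)); lra.
- apply/integrableP; split.
    apply/measurable_EFinP; apply: measurable_funM => //.
    apply: measurableT_comp => //.
    by apply: measurable_funM => //; exact: measurable_funX.
  under eq_integral => z _.
    rewrite gee0_abs; last by rewrite lee_fin mulr_ge0 ?expR_ge0// addr_ge0// divr_ge0// exprn_ge0// ltW.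
    rewrite EFinM; over.
  rewrite ge0_integralZl//; last 2 first.
  + apply/measurable_EFinP; apply: measurableT_comp => //.
    by apply: measurable_funM => //; exact: measurable_funX.
  + by rewrite lee_fin addr_ge0// divr_ge0// exprn_ge0// ltW.
  by rewrite integral_normal_expsqr// -EFinM ltry.
Qed.

Lemma ge0_integral_normal_opp (s : R) (G : R -> R) : s != 0 ->
  continuous G -> (forall x, 0 <= G x) ->
  (\int[normal_prob 0 s]_z (G z)%:E = \int[normal_prob 0 s]_z (G (- z))%:E)%E.
Proof.
move=> s0 cG G0.
have cN : continuous (fun x => G (- x)).
  by move=> x; apply: (cvg_comp (-%R) G); [exact: opp_continuous|exact: cG].
have mG : measurable_fun setT (fun x => (G x)%:E).
  by apply/measurable_EFinP; exact: continuous_measurable_fun.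
have mN : measurable_fun setT (fun x : R => (G (- x))%:E).
  by apply/measurable_EFinP; exact: continuous_measurable_fun.
rewrite (ge0_integral_normal_prob _ _ mG); last by move=> x; rewrite lee_fin.
rewrite (ge0_integral_normal_prob _ _ mN); last by move=> x; rewrite lee_fin.
under eq_integral do rewrite -EFinM.
rewrite ge0_integral_opp.
- apply: eq_integral => x _; rewrite -EFinM; congr (_ * _)%:E.
  by rewrite !normal_pdf_gt0E// !subr0 sqrrN.
- by move=> x; apply: cvgM; [exact: cG|exact: continuous_normal_pdf].
- by move=> x; rewrite mulr_ge0// normal_pdf_ge0.
Qed.

(** By symmetry the positive and negative parts have the same integral, so their difference has real
    part 0 whether or not that integral is finite. *)
Lemma Rintegral_normal_id (s : R) : s != 0 ->
  \int[normal_prob 0 s]_z z = 0.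
Proof.
move=> s0; rewrite /Rintegral integralE.
have -> : (\int[normal_prob 0 s]_z ((EFin \o id)^\- z) =
   \int[normal_prob 0 s]_z ((EFin \o id)^\+ z))%E.
  transitivity (\int[normal_prob 0 s]_z (Num.max (- z) 0)%:E)%E.
    by apply: eq_integral => z _; rewrite funenegE/= EFin_max.
  rewrite (@ge0_integral_normal_opp s (fun z => Num.max (- z) 0))//.
  - by apply: eq_integral => z _; rewrite funeposE/= opprK EFin_max.
  - move=> x; apply: (@continuous_max _ _ (-%R) (cst 0)).
      exact: opp_continuous.
    exact: cvg_cst.
  - by move=> x; rewrite le_max lexx orbT.
set I := (\int[_]_x _)%E; case: I => [r| |] //=; by rewrite subrr.
Qed.

(** Stability of the normal law: the normalized sum of two independent copies has the same law.
    Substitute w = (z + y) / sqrt 2, exchange the integrals and integrate z out. *)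
Lemma ge0_integral_normal_stable (s : R) (h : R -> R) : s != 0 ->
  continuous h -> (forall x, 0 <= h x) ->
  (\int[normal_prob 0 s]_z \int[normal_prob 0 s]_y
     (h ((z + y) / Num.sqrt 2))%:E = \int[normal_prob 0 s]_z (h z)%:E)%E.
Proof.
move=> s0 ch h0.
pose p := normal_pdf 0 s; pose q : R := Num.sqrt 2.
have q0 : 0 < q by rewrite sqrtr_gt0.
have q2 : q ^+ 2 = 2 by rewrite sqr_sqrtr.
have cp : continuous p by exact: continuous_normal_pdf.
have p0 x : 0 <= p x by exact: normal_pdf_ge0.
have mp : measurable_fun setT p by exact: measurable_normal_pdf.
have mh : measurable_fun setT h by exact: continuous_measurable_fun.
have inner z : (\int[normal_prob 0 s]_y (h ((z + y) / q))%:E =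
    \int[mu]_w (h w * p (q * w + - z) * q)%:E)%E.
  rewrite ge0_integral_normal_prob; last 2 first.
  - apply/measurable_EFinP; apply: measurableT_comp => //.
    by apply: measurable_funM => //; exact: measurable_funD.
  - by move=> x; rewrite lee_fin.
  under eq_integral do rewrite -EFinM.
  rewrite (@ge0_integral_affine q (- z) (fun y => h ((z + y) / q) * p y))//.
  - apply: eq_integral => w _; congr (h _ * _ * _)%:E.
    by rewrite addrC subrK mulrC mulKf// gt_eqF.
  - move=> x; apply: cvgM; last exact: cp.
    apply: (cvg_comp (fun y => (z + y) / q) h); last exact: ch.
    by apply: cvgMl; apply: cvgD; [exact: cvg_cst|exact: cvg_id].
  - by move=> x; rewrite mulr_ge0.
under eq_integral do rewrite inner.
have m2 : measurable_fun setT (fun zw : R * R =>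
    (p zw.1 * (h zw.2 * p (q * zw.2 + - zw.1) * q))%:E).
  apply/measurable_EFinP; apply: measurable_funM.
    exact: measurableT_comp.
  apply: measurable_funM => //; apply: measurable_funM.
    exact: measurableT_comp.
  apply: measurableT_comp => //; apply: measurable_funB => //.
  by apply: measurable_funM.
have m1 z : measurable_fun setT (fun w => (h w * p (q * w + - z) * q)%:E).
  apply/measurable_EFinP; apply: measurable_funM => //; apply: measurable_funM => //.
  by apply: measurableT_comp => //; apply: measurable_funD => //; apply: measurable_funM.
have mI : measurable_fun [set: R]
    (fun z => (\int[mu]_w (h w * p (q * w + - z) * q)%:E)%E).
  under eq_fun do rewrite -inner.
  have := @measurable_fun_fubini_tonelli_F _ _ _ _ R (normal_prob 0 s)
    (fun zy : R * R => (h ((zy.1 + zy.2) / q))%:E).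
  apply.
  + apply/measurable_EFinP; apply: measurableT_comp => //.
    by apply: measurable_funM => //; exact: measurable_funD.
  + by move=> x; rewrite lee_fin.
rewrite (ge0_integral_normal_prob _ _ mI); last first.
  by move=> x; apply: integral_ge0 => w _; rewrite lee_fin !mulr_ge0// ltW.
transitivity (\int[mu]_z \int[mu]_w (p z * (h w * p (q * w + - z) * q))%:E)%E.
  apply: eq_integral => z _; under [RHS]eq_integral do rewrite EFinM.
  rewrite ge0_integralZl//; first by rewrite muleC.
  - exact: m1.
  - by move=> x _; rewrite lee_fin !mulr_ge0// ltW.
  - by rewrite lee_fin.
rewrite (@fubini_tonelli _ _ _ _ _ mu mu (fun zw : R * R =>
    (p zw.1 * (h zw.2 * p (q * zw.2 + - zw.1) * q))%:E))//; last first.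
  by move=> x; rewrite lee_fin !mulr_ge0// ltW.
rewrite ge0_integral_normal_prob//; last exact/measurable_EFinP.
apply: eq_integral => w _ /=.
transitivity (\int[mu]_z ((h w * p w)%:E * (p (q * z + - w) * q)%:E))%E.
  apply: eq_integral => z _; rewrite -EFinM; congr EFin.
  (* Invariance of the planar Gaussian density: with q^2 = 2, both z^2 + (q w - z)^2 and w^2 + (q z
     - w)^2 equal 2 z^2 + 2 w^2 - 2 q z w. *)
  have pp : p z * p (q * w + - z) = p w * p (q * z + - w).
    rewrite /p !normal_pdf_gt0E// !subr0 mulrACA [RHS]mulrACA -!expRD.
    congr (_ * expR _); rewrite -!mulrDl; congr (_ / _).
    rewrite -[z ^+ 2]mulr1; nra.
  transitivity (h w * q * (p z * p (q * w + - z))); first by ring.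
  by rewrite pp; ring.
rewrite ge0_integralZl//; last 3 first.
- apply/measurable_EFinP; apply: measurable_funM => //.
  by apply: measurableT_comp => //; apply: measurable_funD => //; apply: measurable_funM.
- by move=> x _; rewrite lee_fin !mulr_ge0// ltW.
- by rewrite lee_fin mulr_ge0.
rewrite -(@ge0_integral_affine q (- w) p)// -EFinM.
by rewrite integral_normal_pdf mule1.
Qed.

End normal_integrals.

(** * Countable grids of matrices and entrywise measurability *)

Section matrix_rounding.
Context {R : realType}.

Lemma cvg_mx (T : Type) (F : set_system T) (FF : Filter F) m n
    (u : T -> 'M[R]_(m, n)) (M : 'M[R]_(m, n)) :
  (forall i j, u k i j @[k --> F] --> M i j) -> u @ F --> M.
Proof.
move=> H; apply/cvg_ballP => e e0.
have H2 : \forall k \near F, forall i j, ball (M i j) e (u k i j).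
  by apply: filter_forall => i; apply: filter_forall => j; have /cvg_ballP := H i j; apply.
by apply: filterS H2 => k Hk; rewrite /ball/=; split => // i j; exact: Hk.
Qed.

Definition grid_mx m n (k : nat) (q : 'M[int]_(m, n)) : 'M[R]_(m, n) :=
  \matrix_(i, j) ((q i j)%:~R / k.+1%:R).

Definition round_mx m n (k : nat) (A : 'M[R]_(m, n)) : 'M[int]_(m, n) :=
  \matrix_(i, j) Num.floor (A i j * k.+1%:R).

Lemma grid_round_mx_cvg m n (A : 'M[R]_(m, n)) :
  grid_mx k (round_mx k A) @[k --> \oo] --> A.
Proof.
apply: cvg_mx => i j; apply/cvgrPdist_le => e e0.
near=> k.
rewrite !mxE.
have k0 : (0 : R) < k.+1%:R by rewrite ltr0n.
have /andP[h1 h2] := floor_itv (A i j * k.+1%:R).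
set f := Num.floor _ in h1 h2 *.
have -> : A i j - f%:~R / k.+1%:R = (A i j * k.+1%:R - f%:~R) / k.+1%:R.
  by rewrite mulrBl mulfK// gt_eqF.
have h3 : A i j * k.+1%:R - f%:~R <= 1.
  by rewrite lerBlDl; move: h2; rewrite intrD => /ltW.
rewrite ger0_norm; last by rewrite divr_ge0 ?subr_ge0// ltW.
rewrite ler_pdivrMr//; apply: (le_trans h3).
rewrite -ler_pdivrMl// mulr1.
apply: (@le_trans _ _ k%:R); last by rewrite ler_nat.
by near: k; exact: nbhs_infty_ger.
Unshelve. all: by end_near. Qed.

Lemma grid_mx_dense_le m n (g h : 'M[R]_(m, n) -> R) :
  continuous g -> continuous h ->
  (forall k q, g (grid_mx k q) <= h (grid_mx k q)) -> forall A, g A <= h A.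
Proof.
move=> cg ch gh A.
have C (f : 'M[R]_(m, n) -> R) : continuous f ->
    f (grid_mx k (round_mx k A)) @[k --> \oo] --> f A.
  by move=> cf; apply: continuous_cvg; [exact: cf|exact: grid_round_mx_cvg].
rewrite -(cvg_lim (@Rhausdorff R) (C _ cg)) -(cvg_lim (@Rhausdorff R) (C _ ch)).
apply: ler_lim.
- by apply/cvg_ex; exists (g A); exact: C.
- by apply/cvg_ex; exists (h A); exact: C.
- by apply: nearW => k; exact: gh.
Qed.

(** The function is the pointwise limit of its values at the rounded matrices, and each rounding
    takes countably many values, on events that are finite intersections of conditions on single
    entries. *)
Lemma measurable_continuous_mx d (T : measurableType d) m n
    (X : T -> 'M[R]_(m, n)) (g : 'M[R]_(m, n) -> R) :
  (forall i j, measurable_fun setT (entry X i j)) -> continuous g ->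
  measurable_fun setT (fun w => g (X w)).
Proof.
move=> mX cg.
apply: (@measurable_fun_cvg _ _ _ setT
  (fun k w => g (grid_mx k (round_mx k (X w))))).
- move=> k _ B mB; rewrite setTI.
  rewrite (_ : _ @^-1` B = \bigcup_q (if pselect (B (g (grid_mx k q))) then
      [set w | round_mx k (X w) = q] else set0)); last first.
    apply/seteqP; split => [w /= Bw|w [q _] /=].
      by exists (round_mx k (X w)) => //; case: pselect.
    by case: (pselect (B (g (grid_mx k q)))) => // Bq /= ->.
  apply: countable_bigcupT_measurable => [|q]; first exact: countableP.
  case: (pselect (B (g (grid_mx k q)))) => /= _; last exact: measurable0.
  rewrite (_ : [set _ | _] = \bigcap_(ij in [set: 'I_m * 'I_n])
      (fun w => Num.floor (X w ij.1 ij.2 * k.+1%:R)) @^-1` [set q ij.1 ij.2]).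
    apply: fin_bigcap_measurable => // -[i j] _ /=.
    rewrite (_ : _ @^-1` _ =
      (fun w => entry X i j w * k.+1%:R) @^-1`
        [set` `[(q i j)%:~R, (q i j + 1)%:~R[ ]).
      rewrite -[X in measurable X]setTI.
      exact: (measurable_funM (mX i j) (measurable_cst _)).
    apply/seteqP; split => w /=.
      by move=> <-; rewrite in_itv/= floor_itv.
    by rewrite in_itv/= => /floor_def.
  apply/seteqP; split => [w /= <- [i j] _ /=|w /= H]; first by rewrite mxE.
  by apply/matrixP => i j; rewrite mxE; exact: (H (i, j)).
- by move=> w _; apply: continuous_cvg; [exact: cg|exact: grid_round_mx_cvg].
Qed.

End matrix_rounding.

(** * Comparison of Gaussian vectors *)

Section gaussian_operator.
Context {R : realType} {V : normedModType R}.
Variable s : R.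
Hypothesis s_neq0 : s != 0.
Implicit Types (F G : V -> R) (a b x y : V) (L : seq V).

(** Bounded and Lipschitz with a common constant: a class stable under Gaussian averaging that
    contains [gumbel] and its second derivatives along lines. *)
Definition blip F := exists B : R, forall x y,
  `|F x| <= B /\ `|F x - F y| <= B * `|x - y|.

(** A heat-semigroup step in the single direction a. Composing such steps along a list produces the
    covariance s^2 times the sum of a a^T, so no square root of a covariance matrix is ever
    taken. *)
Definition gop a F x : R := \int[normal_prob 0 s]_z F (x + z *: a).

(* [gops L F x] is the expectation of [F] at [x] plus a random combination of the
   vectors of [L] with independent N(0, s^2) coefficients. *)
Definition gops L F := foldr gop F L.

Lemma blip_continuous F : blip F -> continuous F.
Proof.
move=> [B FB] x; apply/cvgrPdist_le => e e0.
have B0 : 0 <= B by apply: le_trans (FB x x).1.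
have K0 : 0 < B + 1 by rewrite ltr_wpDl.
apply: filterS (nbhsx_ballx x _ (divr_gt0 e0 K0)) => y; rewrite -ball_normE /= => /ltW xy.
apply: (le_trans (FB x y).2).
apply: (@le_trans _ _ ((B + 1) * `|x - y|)); first by rewrite ler_wpM2r// lerDl.
by rewrite -ler_pdivlMl// mulrC.
Qed.

Lemma blip_continuous_line F x a : blip F -> continuous (fun z : R => F (x + z *: a)).
Proof.
move=> bF z; apply: (cvg_comp (fun z : R => x + z *: a) F); last exact: blip_continuous.
by apply: cvgD; [exact: cvg_cst|apply: cvgZr_tmp; exact: cvg_id].
Qed.

Lemma bounded_continuous_normal_integrable (h : R -> R) (B : R) :
  continuous h -> (forall z, `|h z| <= B) ->
  (normal_prob 0 s).-integrable setT (EFin \o h).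
Proof.
move=> ch hB.
apply: (@le_integrable _ _ _ (normal_prob 0 s) setT measurableT _ (cst B%:E)).
- by apply/measurable_EFinP; exact: continuous_measurable_fun.
- by move=> z _ /=; rewrite lee_fin (le_trans (hB z))// ler_norm.
- exact: finite_measure_integrable_cst.
Qed.

Lemma blip_integrable F x a : blip F ->
  (normal_prob 0 s).-integrable setT (fun z => (F (x + z *: a))%:E).
Proof.
move=> bF; have [B FB] := bF.
apply: (bounded_continuous_normal_integrable (B := B)).
  exact: blip_continuous_line.
by move=> z; have [] := FB (x + z *: a) x.
Qed.

Lemma gopE F a x : blip F ->
  (gop a F x)%:E = (\int[normal_prob 0 s]_z (F (x + z *: a))%:E)%E.
Proof.
by move=> bF; rewrite /gop fineK//; apply: integrable_fin_num => //; exact: blip_integrable.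
Qed.

Lemma gop_cst (c : R) a x : gop a (cst c) x = c.
Proof.
by rewrite /gop Rintegral_cst// -[X in _ * X]/(fine (normal_prob 0 s setT)) probability_setT mulr1.
Qed.

Lemma gop_le F G a x : blip F -> blip G -> (forall y, F y <= G y) ->
  gop a F x <= gop a G x.
Proof. by move=> bF bG FG; apply: le_Rintegral => //; exact: blip_integrable. Qed.

Lemma blip_cst (c : R) : blip (cst c).
Proof.
by exists `|c| => x y; rewrite subrr normr0; split => //; rewrite mulr_ge0.
Qed.

Lemma blipD F G : blip F -> blip G -> blip (F \+ G).
Proof.
move=> [B FB] [C GC]; exists (B + C) => x y /=; split.
  by rewrite (le_trans (ler_normD _ _))// lerD//; [exact: (FB x x).1|exact: (GC x x).1].
by rewrite opprD addrACA mulrDl (le_trans (ler_normD _ _))// lerD//; [exact: (FB x y).2|exact: (GC x y).2].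
Qed.

Lemma blipZ F (k : R) : blip F -> blip (fun x => k * F x).
Proof.
move=> [B FB]; exists (`|k| * B) => x y /=; rewrite -mulrBr !normrM.
by split; rewrite -?mulrA ler_wpM2l//; have [] := FB x y.
Qed.

Lemma gopD F G a x : blip F -> blip G ->
  gop a (F \+ G) x = gop a F x + gop a G x.
Proof. by move=> bF bG; rewrite /gop RintegralD//; exact: blip_integrable. Qed.

Lemma gopZ F (k : R) a x : blip F -> gop a (fun x => k * F x) x = k * gop a F x.
Proof. by move=> bF; rewrite /gop RintegralZl//; exact: blip_integrable. Qed.

Lemma gopDcst F (c : R) a x : blip F -> gop a (fun x => F x + c) x = gop a F x + c.
Proof. by move=> bF; rewrite (@gopD F (cst c))// ?gop_cst//; exact: blip_cst. Qed.

Lemma gop_norm_le F (c : R) a x : blip F -> (forall y, `|F y| <= c) ->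
  `|gop a F x| <= c.
Proof.
move=> bF Fc; rewrite ler_norml; apply/andP; split.
  rewrite -(gop_cst (- c) a x); apply: gop_le => //; first exact: blip_cst.
  by move=> y /=; have := Fc y; rewrite ler_norml => /andP[].
rewrite -[leRHS](gop_cst c a x); apply: gop_le => //; first exact: blip_cst.
by move=> y /=; have := Fc y; rewrite ler_norml => /andP[].
Qed.

Lemma blip_shift F v : blip F -> blip (fun x => F (x + v)).
Proof.
move=> [B FB]; exists B => x y; have [h1 h2] := FB (x + v) (y + v); split => //.
by rewrite (le_trans h2)// opprD addrACA subrr addr0.
Qed.

Lemma gop_shift F a x y : gop a F (x + y) = gop a (fun z => F (z + y)) x.
Proof. by apply: eq_Rintegral => z _ /=; rewrite addrAC. Qed.

Lemma blip_gop F a : blip F -> blip (gop a F).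
Proof.
move=> bF; have [B FB] := bF; exists B => x y; split.
  by apply: gop_norm_le => // z; have [] := FB z z.
have -> : gop a F x - gop a F y =
    gop a (F \+ (fun z => -1 * F (z + (y - x)))) x.
  have bs : blip (fun z => F (z + (y - x))) by exact: blip_shift.
  rewrite gopD//; last exact: blipZ.
  by rewrite gopZ// -gop_shift mulN1r (addrC x) subrK.
apply: gop_norm_le.
  by apply: blipD => //; apply: blipZ; exact: blip_shift.
move=> z /=; rewrite mulN1r; have [_ h] := FB z (z + (y - x)).
by rewrite (le_trans h)// opprD addNKr opprB.
Qed.

Lemma measurable_blip_line2 F x a b : blip F ->
  measurable_fun setT (fun z : R * R => F (x + z.1 *: a + z.2 *: b)).
Proof.
move=> bF.
pose X (z : R * R) : 'M[R]_(2, 1) := \matrix_(i, j) (if i == 0 then z.1 else z.2).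
pose g (M : 'M[R]_(2, 1)) := F (x + M 0 0 *: a + M 1 0 *: b).
rewrite (_ : (fun _ => _) = (fun w => g (X w))); last first.
  by apply/funext => z; rewrite /g !mxE.
apply: measurable_continuous_mx.
  move=> i j; rewrite /entry.
  rewrite (_ : (fun _ => _) = if i == 0 then fst else snd).
    by case: ifP => _ //.
  by apply/funext => z; rewrite mxE; case: ifP.
have cM i : continuous (fun M : 'M[R]_(2, 1) => M i 0).
  by move=> N; exact: coord_continuous.
have cZ i (c : V) : continuous (fun M : 'M[R]_(2, 1) => M i 0 *: c).
  move=> N; apply: (@continuous_comp _ _ _ (fun M : 'M[R]_(2, 1) => M i 0) (fun k : R => k *: c)).
    exact: cM.
  exact: scalel_continuous.
move=> M; apply: (@continuous_comp _ _ _ (fun M : 'M[R]_(2, 1) => x + M 0 0 *: a + M 1 0 *: b) F).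
  apply: (@cvgD _ V _ (nbhs M)); last exact: cZ.
  by apply: (@cvgD _ V _ (nbhs M)); [exact: cvg_cst|exact: cZ].
exact: (blip_continuous bF).
Qed.

(** Adding the bound B makes the integrand nonnegative, so that Tonelli's theorem and the stability
    formula apply. *)
Lemma gop_ge0 F B a x : blip F -> (forall x, `|F x| <= B) ->
  ((gop a F x + B)%:E = \int[normal_prob 0 s]_z (F (x + z *: a) + B)%:E)%E.
Proof.
move=> bF FB; rewrite -gopDcst// gopE//.
by apply: blipD => //; exact: blip_cst.
Qed.

Lemma gopC F a b : blip F -> gop a (gop b F) = gop b (gop a F).
Proof.
move=> bF; apply/funext => x.
have [B FB] := bF.
have FB1 y : `|F y| <= B by exact: (FB y y).1.
have FB2 c y : `|gop c F y| <= B by exact: gop_norm_le.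
have G0 y : (0 <= (F y + B)%:E)%E.
  by have := FB1 y; rewrite lee_fin ler_norml -[0 <= _]subr_ge0 subr0 -subr_ge0 opprK => /andP[].
apply: (@addIr _ B); apply: EFin_inj.
rewrite (gop_ge0 a x (blip_gop b bF) (FB2 b)) (gop_ge0 b x (blip_gop a bF) (FB2 a)).
under eq_integral => z _ do rewrite (gop_ge0 _ _ bF FB1).
under [RHS]eq_integral => z _ do rewrite (gop_ge0 _ _ bF FB1).
have m2 : measurable_fun setT (fun z : R * R => (F (x + z.1 *: a + z.2 *: b) + B)%:E).
  by apply/measurable_EFinP; apply: measurable_funD => //; exact: measurable_blip_line2.
apply: (eq_trans (@fubini_tonelli _ _ _ _ _ (normal_prob 0 s) (normal_prob 0 s)
  (fun z : R * R => (F (x + z.1 *: a + z.2 *: b) + B)%:E) m2 (fun z => G0 _))).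
by apply: eq_integral => z _; apply: eq_integral => y _ /=; rewrite addrAC.
Qed.

Lemma gop_stable F a : blip F ->
  gop a F = gop ((Num.sqrt 2)^-1 *: a) (gop ((Num.sqrt 2)^-1 *: a) F).
Proof.
move=> bF; apply/funext => x; set b := _ *: a.
have [B FB] := bF.
have FB1 y : `|F y| <= B by exact: (FB y y).1.
have FB2 c y : `|gop c F y| <= B by exact: gop_norm_le.
have G0 y : (0 <= F y + B).
  by have := FB1 y; rewrite ler_norml -[0 <= _]subr_ge0 subr0 -subr_ge0 opprK => /andP[].
apply: (@addIr _ B); apply: EFin_inj.
rewrite (gop_ge0 a x bF FB1) (gop_ge0 b x (blip_gop b bF) (FB2 b)).
under [RHS]eq_integral => z _ do rewrite (gop_ge0 _ _ bF FB1).
have cG : continuous (fun z : R => F (x + z *: a) + B).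
  by move=> z; apply: cvgD; [exact: blip_continuous_line|exact: cvg_cst].
apply: (eq_trans (esym (ge0_integral_normal_stable s_neq0 cG (fun z => G0 _)))).
apply: eq_integral => z _; apply: eq_integral => y _; congr (F _ + B)%:E.
by rewrite /b -addrA !scalerA -scalerDl mulrDl.
Qed.

Lemma blip_gops L F : blip F -> blip (gops L F).
Proof. by move=> bF; elim: L => //= a L IH; exact: blip_gop. Qed.

Lemma gops_le L F G x : blip F -> blip G -> (forall y, F y <= G y) ->
  gops L F x <= gops L G x.
Proof.
move=> bF bG FG; elim: L x => //= a L IH x.
by apply: gop_le => //; exact: blip_gops.
Qed.

Lemma gopsDcst L F (c : R) x : blip F -> gops L (fun x => F x + c) x = gops L F x + c.
Proof.
move=> bF; elim: L x => //= a L IH x.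
rewrite (_ : gops L _ = fun x => gops L F x + c); last exact/funext.
by rewrite gopDcst//; exact: blip_gops.
Qed.

Lemma gop_gopsC a L F : blip F -> gop a (gops L F) = gops L (gop a F).
Proof.
by move=> bF; elim: L => //= b L <-; rewrite gopC//; exact: blip_gops.
Qed.

Lemma gopsC L L' F : blip F -> gops L (gops L' F) = gops L' (gops L F).
Proof.
move=> bF; elim: L => //= a L ->.
by rewrite gop_gopsC//; exact: blip_gops.
Qed.

Lemma gops_stable L F : blip F ->
  gops L F = gops [seq (Num.sqrt 2)^-1 *: a | a <- L]
               (gops [seq (Num.sqrt 2)^-1 *: a | a <- L] F).
Proof.
move=> bF; elim: L => //= a L IH; rewrite IH gop_stable; last first.
  by do 2 apply: blip_gops.
set b := _ *: a; set L' := map _ _.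
by rewrite (@gop_gopsC b L' (gops L' F))//; exact: blip_gops.
Qed.

Lemma blip_iter n L F : blip F -> blip (iter n (gops L) F).
Proof. by move=> bF; elim: n => //= n IH; exact: blip_gops. Qed.

(** Stability applied m times splits the Gaussian vector into 2^m independent copies, each scaled by
    2^(-m/2). *)
Lemma gops_iter m L F : blip F ->
  gops L F = iter (2 ^ m) (gops [seq (Num.sqrt 2)^-1 ^+ m *: a | a <- L]) F.
Proof.
move=> bF; elim: m => [|m ->].
  rewrite /= (_ : map _ _ = L)//.
  by rewrite -[RHS]map_id; apply: eq_map => a; rewrite expr0 scale1r.
rewrite expnS mul2n -addnn.
set L' := map _ _; set L'' := map _ _.
have E : L'' = [seq (Num.sqrt 2)^-1 *: a | a <- L'].
  by rewrite -map_comp; apply: eq_map => a /=; rewrite scalerA -exprS.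
elim: (2 ^ m)%N => //= n ->.
by rewrite addnS /= gops_stable ?E//; exact: blip_iter.
Qed.

(** The copies are exchanged one at a time. The operators commute, preserve order and commute with
    the addition of constants, so each exchange costs at most eta. *)
Lemma iter_gops_le n L L' F (eta : R) : blip F ->
  (forall x, gops L' F x - eta <= gops L F x) ->
  forall x, iter n (gops L') F x - n%:R * eta <= iter n (gops L) F x.
Proof.
move=> bF H; elim: n => [|n IH] x; first by rewrite mul0r subr0.
have itle G G' y : blip G -> blip G' -> (forall y, G y <= G' y) ->
    iter n (gops L) G y <= iter n (gops L) G' y.
  move=> bG bG' GG'; elim: n y {IH} => //= k IH y.
  by apply: gops_le => //; exact: blip_iter.
have itD G (c : R) y : blip G ->
    iter n (gops L) (fun x => G x + c) y = iter n (gops L) G y + c.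
  move=> bG; elim: n y {IH itle} => //= k IH y.
  rewrite (_ : iter k _ _ = fun x => iter k (gops L) G x + c); last exact/funext.
  by rewrite gopsDcst//; exact: blip_iter.
have itC G : blip G -> iter n (gops L) (gops L' G) = gops L' (iter n (gops L) G).
  move=> bG; elim: n {IH itle itD} => //= k ->.
  by rewrite gopsC//; exact: blip_iter.
rewrite [leRHS](_ : _ = iter n (gops L) (gops L F) x); last by rewrite -iterSr.
apply: le_trans (itle _ _ _ _ _ H); last 2 first.
- by apply: (@blipD _ (cst _)); [exact: blip_gops|exact: blip_cst].
- exact: blip_gops.
rewrite itD; last exact: blip_gops.
rewrite itC// mulrSr mulrDl mul1r opprD addrA lerD2r /=.
rewrite -gopsDcst; last exact: blip_iter.
apply: gops_le => //; last exact: blip_iter.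
by apply: (@blipD _ (cst _)); [exact: blip_iter|exact: blip_cst].
Qed.

(* Lindeberg's argument: [gops L] is the 2^m-th iterate of the same operator with
   the vectors scaled by e = 2^(-m/2), and the errors add up to 2^m * C * e^3. *)
Lemma gops_le_infinitesimal L L' F (C : R) x : blip F ->
  (forall (e : R) y, 0 < e <= 1 ->
     gops [seq e *: a | a <- L'] F y - C * e ^+ 3 <=
     gops [seq e *: a | a <- L] F y) ->
  gops L' F x <= gops L F x.
Proof.
move=> bF H.
pose c : R := (Num.sqrt 2)^-1.
have c0 : 0 < c by rewrite invr_gt0 sqrtr_gt0.
have c2 : c ^+ 2 = 2^-1 by rewrite exprVn sqr_sqrtr.
have c1 : c < 1 by rewrite -(@ltr_pXn2r _ 2) ?nnegrE ?ltW// c2 expr1n; lra.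
have K m : gops L' F x - C * c ^+ m <= gops L F x.
  rewrite (gops_iter m L)// (gops_iter m L')//.
  have e01 : 0 < c ^+ m <= 1 by rewrite exprn_gt0//= exprn_ile1 ?ltW.
  have := @iter_gops_le (2 ^ m) _ _ F _ bF (fun y => H _ y e01) x.
  apply: le_trans; rewrite lerD2l lerN2 natrX.
  have -> : 2 ^+ m * (C * (c ^+ m) ^+ 3) = C * c ^+ m * (2 * c ^+ 2) ^+ m :> R.
    by rewrite exprMn -(exprM c 2 m) mulnC exprM; ring.
  by rewrite c2 divff// expr1n mulr1.
suff : (gops L' F x - C * c ^+ m @[m --> \oo]) --> gops L' F x - C * 0.
  rewrite mulr0 subr0 => cv.
  rewrite -(cvg_lim (@Rhausdorff R) cv); apply: limr_le.
    by apply/cvg_ex; exists (gops L' F x).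
  exact: nearW.
apply: cvgB; first exact: cvg_cst.
apply: cvgMr; apply: cvg_expr.
by rewrite ger0_norm// ltW.
Qed.

End gaussian_operator.

(** * Taylor estimates on the real line *)

Section bounded_derivative.
Context {R : realType}.

Lemma derive_bound_lipschitz (f f' : R -> R) (K : R) :
  (forall t, is_derive t (1 : R) f (f' t)) -> (forall t, `|f' t| <= K) ->
  forall x y, `|f x - f y| <= K * `|x - y|.
Proof.
move=> df fK.
have cf : continuous f.
  move=> t; apply: differentiable_continuous; apply/derivable1_diffP.
  exact: (@ex_derive _ _ _ _ _ _ _ (df t)).
suff H x y : x <= y -> `|f y - f x| <= K * `|y - x|.
  move=> x y; have [xy|/ltW yx] := leP x y; last exact: H.
  by rewrite distrC (distrC x); exact: H.
rewrite le_eqVlt => /predU1P[->|xy].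
  by rewrite !subrr !normr0 mulr0.
have [c _ ->] : exists2 c, c \in `]x, y[ & f y - f x = f' c * (y - x).
  by apply: (MVT xy) => // t; exact: continuous_subspaceT.
by rewrite normrM ler_wpM2r.
Qed.

Lemma derive_bound_lipschitz0 (f f' : R -> R) (K x : R) :
  (forall t, is_derive t (1 : R) f (f' t)) ->
  (forall t, `|t| <= `|x| -> `|f' t| <= K) ->
  `|f x - f 0| <= K * `|x|.
Proof.
move=> df fK.
have cf : continuous f.
  move=> t; apply: differentiable_continuous; apply/derivable1_diffP.
  exact: (@ex_derive _ _ _ _ _ _ _ (df t)).
have [x0|x0|->] := ltgtP x 0; last by rewrite !subrr !normr0 mulr0.
  have [c] : exists2 c, c \in `]x, 0[ & f 0 - f x = f' c * (0 - x).
    by apply: (MVT x0) => // t; exact: continuous_subspaceT.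
  rewrite in_itv/= => /andP[xc c0] E; rewrite distrC E normrM sub0r normrN.
  apply: ler_wpM2r => //; apply: fK.
  by rewrite (ler0_norm (ltW c0)) (ler0_norm (ltW x0)) lerN2 ltW.
have [c] : exists2 c, c \in `]0, x[ & f x - f 0 = f' c * (x - 0).
  by apply: (MVT x0) => // t; exact: continuous_subspaceT.
rewrite in_itv/= => /andP[c0 cx] ->; rewrite normrM subr0.
apply: ler_wpM2r => //; apply: fK.
by rewrite (ger0_norm (ltW c0)) (ger0_norm (ltW x0)) ltW.
Qed.

(** The mean value theorem is applied at three successive orders from the base point 0, giving the
    constant K in place of the sharp K / 6. *)
Lemma taylor2_bound (f f1 f2 f3 : R -> R) (K x : R) :
  (forall t, is_derive t (1 : R) f (f1 t)) ->
  (forall t, is_derive t (1 : R) f1 (f2 t)) ->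
  (forall t, is_derive t (1 : R) f2 (f3 t)) ->
  (forall t, `|f3 t| <= K) ->
  `|f x - f 0 - x * f1 0 - x ^+ 2 / 2 * f2 0| <= K * `|x| ^+ 3.
Proof.
move=> d1 d2 d3 fK.
have K0 : 0 <= K by apply: le_trans (fK 0).
have b2 t : `|f2 t - f2 0| <= K * `|t|.
  by rewrite -[X in _ <= _ * `|X|]subr0; exact: derive_bound_lipschitz.
have b1 t : `|f1 t - t * f2 0 - f1 0| <= K * `|t| ^+ 2.
  have := @derive_bound_lipschitz0 (fun u => f1 u - u * f2 0)
    (fun u => f2 u - f2 0) (K * `|t|) t.
  rewrite mul0r subr0 expr2 mulrA; apply.
    move=> u; apply: is_derive_eq; rewrite /GRing.scale/=.
    by rewrite mulr0 add0r mulr1.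
  by move=> u ut; rewrite (le_trans (b2 u))// ler_wpM2l.
have := @derive_bound_lipschitz0 (fun u => f u - u * f1 0 - u ^+ 2 / 2 * f2 0)
  (fun u => f1 u - u * f2 0 - f1 0) (K * `|x| ^+ 2) x.
rewrite expr0n/= !mul0r !subr0; move=> H.
have -> : f x - f 0 - x * f1 0 - x ^+ 2 / 2 * f2 0 =
  f x - x * f1 0 - x ^+ 2 / 2 * f2 0 - f 0 by ring.
rewrite (exprSr _ 2) mulrA; apply: H.
  move=> u; apply: is_derive_eq; rewrite /GRing.scale/=.
  by field.
move=> u ux; rewrite (le_trans (b1 u))// ler_wpM2l//.
by rewrite ler_pXn2r// nnegrE.
Qed.

(** One term of the exponential series bounds exp w from below. Every derivative of [gumbel] is a
    polynomial in exponential sums times exp(-w), with w the full sum, so this gives bounds uniform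
    in the point. *)
Lemma exprn_expRN_le (w : R) k : 0 <= w -> w ^+ k * expR (- w) <= k`!%:R.
Proof.
move=> w0; rewrite expRN ler_pdivrMr ?expR_gt0//.
case: k => [|k].
  by rewrite expr0 mul1r -[leLHS]expR0 ler_expR.
have := @expR_ge1Dxn R w k w0.
rewrite -ler_pdivrMl ?ltr0n ?fact_gt0// => H; apply: le_trans H.
by rewrite mulrC lerDr.
Qed.

End bounded_derivative.

(** * Derivatives of the smooth orthant indicator *)

Section gumbel.
Context {R : realType}.
Variables (n : nat) (be : R).
Hypothesis be_ge0 : 0 <= be.
Notation V := 'cV[R]_n.
Implicit Types (x a b : V) (c : 'I_n -> R).

(** The weights make the family closed under differentiation along lines: each derivative in the
    direction b multiplies the weight of i by be b_i. *)
Definition expsum c x := \sum_i c i * expR (be * x i 0).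
(* Tends to the indicator of the negative orthant as [be] grows. *)
Definition gumbel x := expR (- expsum (fun=> 1) x).

Lemma is_derive_expsum c x b (t : R) :
  is_derive t (1 : R) (fun t => expsum c (x + t *: b))
    (expsum (fun i => be * b i 0 * c i) (x + t *: b)).
Proof.
rewrite /expsum.
under eq_fun do under eq_bigr do rewrite !mxE.
rewrite (_ : (fun _ => _) =
   \sum_i (fun u : R => c i * expR (be * (x i 0 + u * b i 0)))); last first.
  by apply/funext => u; rewrite fct_sumE.
apply: is_derive_eq; apply: eq_bigr => i _; rewrite !mxE /GRing.scale/=.
by ring.
Qed.

Lemma normr_coord_le x i : `|x i 0| <= `|x|.
Proof.
have -> : `|x| = mx_norm x by [].
rewrite mx_normrE.
exact: (le_bigmax _ (fun ij => `|x ij.1 ij.2|) (i, 0)).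
Qed.

Lemma expsum1_ge0 x : 0 <= expsum (fun=> 1) x.
Proof. by apply: sumr_ge0 => i _; rewrite mul1r expR_ge0. Qed.

Lemma expsum_norm_le c (M : R) x : (forall i, `|c i| <= M) ->
  `|expsum c x| <= M * expsum (fun=> 1) x.
Proof.
move=> cM; rewrite (le_trans (ler_norm_sum _ _ _))// mulr_sumr ler_sum// => i _.
by rewrite normrM mul1r (ger0_norm (expR_ge0 _)) ler_wpM2r ?expR_ge0.
Qed.

Lemma gumbel_ge0 x : 0 <= gumbel x. Proof. exact: expR_ge0. Qed.

Lemma gumbel_le1 x : gumbel x <= 1.
Proof. by rewrite -expR0 ler_expR oppr_le0 expsum1_ge0. Qed.

Lemma is_derive_gumbel x b (t : R) :
  is_derive t (1 : R) (fun t => gumbel (x + t *: b))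
    (- expsum (fun i => be * b i 0) (x + t *: b) * gumbel (x + t *: b)).
Proof.
rewrite /gumbel; have D := is_derive_expsum (fun=> 1) x b t.
apply: is_derive_eq; rewrite /GRing.scale/= mulrC; congr (- _ * _).
by apply: eq_bigr => i _; rewrite mulr1.
Qed.

(** [gumbel1] and [gumbel2] are the first and second derivatives of [gumbel] in the direction a. *)
Definition gumbel1 a x := - expsum (fun i => be * a i 0) x * gumbel x.

Definition gumbel2 a x :=
  (expsum (fun i => be * a i 0) x ^+ 2 - expsum (fun i => (be * a i 0) ^+ 2) x)
  * gumbel x.

Lemma blip_of_line (G : V -> R) (B : R) (G' : V -> V -> R -> R) :
  (forall x b (t : R), is_derive t (1 : R) (fun t => G (x + t *: b)) (G' x b t)) ->
  (forall x, `|G x| <= B) ->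
  (forall x b t, `|G' x b t| <= B * `|b|) -> blip G.
Proof.
move=> dG GB G'B; exists B => x y; split => //.
have := @derive_bound_lipschitz R (fun t => G (x + t *: (y - x)))
  (G' x (y - x)) (B * `|y - x|) (dG x (y - x)) (G'B x (y - x)) 0 1.
by rewrite scale0r addr0 scale1r (addrC x) subrK sub0r normrN normr1 mulr1 (distrC y).
Qed.

Lemma scale_coord_le a i : `|be * a i 0| <= be * `|a|.
Proof. by rewrite normrM ger0_norm// ler_wpM2l// normr_coord_le. Qed.

Lemma blip_gumbel : blip gumbel.
Proof.
apply: (@blip_of_line _ (1 + be) _ (is_derive_gumbel)).
  by move=> x; rewrite ger0_norm ?gumbel_ge0// (le_trans (gumbel_le1 x))// lerDl.
move=> x b t; rewrite normrM normrN (ger0_norm (gumbel_ge0 _)).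
set y := x + _.
apply: (@le_trans _ _ (be * `|b| * (expsum (fun=> 1) y * gumbel y))).
  rewrite mulrA ler_wpM2r ?gumbel_ge0//.
  by apply: expsum_norm_le => i; exact: scale_coord_le.
have := @exprn_expRN_le _ (expsum (fun=> 1) y) 1 (expsum1_ge0 y).
rewrite expr1 => h; apply: (@le_trans _ _ (be * `|b| * 1)).
  by rewrite ler_wpM2l// mulr_ge0.
by rewrite mulr1 ler_wpM2r// lerDr.
Qed.

Lemma gumbel2_bound a x : `|gumbel2 a x| <= (be * `|a|) ^+ 2 * 3.
Proof.
set w := expsum (fun=> 1) x.
have w0 : 0 <= w by exact: expsum1_ge0.
have M0 : 0 <= be * `|a| by rewrite mulr_ge0.
have h1 : `|expsum (fun i => be * a i 0) x| <= be * `|a| * w.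
  by apply: expsum_norm_le => i; exact: scale_coord_le.
have h2 : `|expsum (fun i => (be * a i 0) ^+ 2) x| <= (be * `|a|) ^+ 2 * w.
  apply: expsum_norm_le => i; rewrite normrX ler_pXn2r ?nnegrE//.
  exact: scale_coord_le.
have e1 := exprn_expRN_le 1 w0; have e2 := exprn_expRN_le 2 w0.
rewrite /gumbel2 normrM (ger0_norm (gumbel_ge0 _)).
apply: (@le_trans _ _ ((be * `|a|) ^+ 2 * (w ^+ 2 * expR (- w) + w ^+ 1 * expR (- w)))).
  rewrite -mulrDl mulrA ler_wpM2r ?gumbel_ge0// mulrDr -exprMn expr1.
  rewrite (le_trans (ler_normB _ _))// lerD// normrX ler_pXn2r ?nnegrE//.
  exact: mulr_ge0.
rewrite ler_wpM2l ?exprn_ge0//.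
by rewrite (le_trans (lerD e2 e1))// -natrD.
Qed.

(** The third-derivative estimate with numbers in place of the weighted sums. Factoring out M^2 N
    leaves (w^3 + 3 w^2 + w) exp(-w), at most 3! + 3 * 2! + 1! = 13. *)
Lemma gumbel3_bound (w M N w1 w2 w3 wv w1v w2v : R) : 0 <= w -> 0 <= M -> 0 <= N ->
  `|w1| <= M * w -> `|w2| <= M ^+ 2 * w -> `|wv| <= N * w ->
  `|w1v| <= M * N * w -> `|w2v| <= M ^+ 2 * N * w ->
  `|(2 * w1 * w1v - w2v - (w1 ^+ 2 - w2) * wv) * expR (- w)| <= M ^+ 2 * N * 13.
Proof.
move=> w0 M0 N0 h1 h2 hv h1v h2v.
have e1 := exprn_expRN_le 1 w0; have e2 := exprn_expRN_le 2 w0.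
have e3 := exprn_expRN_le 3 w0.
rewrite normrM (ger0_norm (expR_ge0 _)).
apply: (@le_trans _ _ (M ^+ 2 * N * (w ^+ 3 * expR (- w) + 3 * (w ^+ 2 * expR (- w))
   + w ^+ 1 * expR (- w)))).
  rewrite mulrA -!mulrDl mulrA ler_wpM2r ?expR_ge0//.
  rewrite (le_trans (ler_normB _ _))//.
  apply: (@le_trans _ _ ((2 * (M * w) * (M * N * w) + M ^+ 2 * N * w) +
     ((M * w) ^+ 2 + M ^+ 2 * w) * (N * w))); last by rewrite le_eqVlt; apply/orP; left; apply/eqP; ring.
  apply: lerD.
    rewrite (le_trans (ler_normB _ _))// lerD// !normrM ger0_norm//.
    by rewrite ler_pM// ?mulr_ge0// ler_wpM2l.
  rewrite normrM ler_pM// (le_trans (ler_normB _ _))// lerD// normrX.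
  by rewrite ler_pXn2r ?nnegrE// mulr_ge0.
rewrite ler_wpM2l ?mulr_ge0 ?exprn_ge0//.
have -> : 13 = 3`!%:R + 3 * 2`!%:R + 1`!%:R :> R by rewrite !factS fact0; lra.
by rewrite !lerD// ler_wpM2l.
Qed.

(** The direction b is independent of a: arbitrary b yields the Lipschitz property of [gumbel2], and
    b = a yields the third derivative for the Taylor expansion. *)
Lemma is_derive_gumbel2 a x b (t : R) :
  is_derive t (1 : R) (fun t => gumbel2 a (x + t *: b))
   ((2 * expsum (fun i => be * a i 0) (x + t *: b)
       * expsum (fun i => be * b i 0 * (be * a i 0)) (x + t *: b)
     - expsum (fun i => be * b i 0 * (be * a i 0) ^+ 2) (x + t *: b)
     - (expsum (fun i => be * a i 0) (x + t *: b) ^+ 2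
        - expsum (fun i => (be * a i 0) ^+ 2) (x + t *: b))
       * expsum (fun i => be * b i 0) (x + t *: b)) * gumbel (x + t *: b)).
Proof.
rewrite /gumbel2.
have D1 := is_derive_expsum (fun i => be * a i 0) x b t.
have D2 := is_derive_expsum (fun i => (be * a i 0) ^+ 2) x b t.
have D := is_derive_gumbel x b t.
apply: is_derive_eq; rewrite /GRing.scale/=.
by ring.
Qed.

Lemma gumbel2_derive_bound a x b :
  `|(2 * expsum (fun i => be * a i 0) x
       * expsum (fun i => be * b i 0 * (be * a i 0)) x
     - expsum (fun i => be * b i 0 * (be * a i 0) ^+ 2) x
     - (expsum (fun i => be * a i 0) x ^+ 2
        - expsum (fun i => (be * a i 0) ^+ 2) x)
       * expsum (fun i => be * b i 0) x) * gumbel x|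
  <= (be * `|a|) ^+ 2 * (be * `|b|) * 13.
Proof.
have M0 (c : V) : 0 <= be * `|c| by rewrite mulr_ge0.
have sq i : (be * a i 0) ^+ 2 <= (be * `|a|) ^+ 2.
  by rewrite -real_normK ?num_real// ler_pXn2r ?nnegrE//; exact: scale_coord_le.
apply: gumbel3_bound => //; first exact: expsum1_ge0.
- by apply: expsum_norm_le => i; exact: scale_coord_le.
- by apply: expsum_norm_le => i; rewrite ger0_norm ?sqr_ge0.
- by apply: expsum_norm_le => i; exact: scale_coord_le.
- apply: expsum_norm_le => i; rewrite normrM mulrC.
  by apply: ler_pM => //; exact: scale_coord_le.
- apply: expsum_norm_le => i; rewrite normrM mulrC.
  by apply: ler_pM => //; [rewrite ger0_norm ?sqr_ge0|exact: scale_coord_le].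
Qed.

Lemma blip_gumbel2 a : blip (gumbel2 a).
Proof.
have M0 (c : V) : 0 <= be * `|c| by rewrite mulr_ge0.
apply: (@blip_of_line _ ((be * `|a|) ^+ 2 * 3 + (be * `|a|) ^+ 2 * be * 13) _ (is_derive_gumbel2 a)).
  move=> x; rewrite (le_trans (gumbel2_bound a x))// lerDl.
  by rewrite !mulr_ge0// exprn_ge0.
move=> x b t; rewrite (le_trans (gumbel2_derive_bound _ _ _))//.
rewrite [leRHS]mulrDl; have := normr_ge0 b; move: (be * `|a|) (M0 a) => M M1 b0.
have -> : M ^+ 2 * be * 13 * `|b| = M ^+ 2 * (be * `|b|) * 13 by ring.
by rewrite lerDr !mulr_ge0// exprn_ge0.
Qed.

Lemma gumbel_taylor a x (t : R) :
  `|gumbel (x + t *: a) - gumbel x - t * gumbel1 a x - t ^+ 2 / 2 * gumbel2 a x|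
  <= (be * `|a|) ^+ 3 * 13 * `|t| ^+ 3.
Proof.
have := @taylor2_bound R (fun t => gumbel (x + t *: a))
  (fun t => gumbel1 a (x + t *: a)) (fun t => gumbel2 a (x + t *: a)) _
  ((be * `|a|) ^+ 3 * 13) t (is_derive_gumbel x a) _ (is_derive_gumbel2 a x a).
rewrite scale0r addr0; apply.
  move=> u; rewrite /gumbel1 /gumbel2.
  have D1 := is_derive_expsum (fun i => be * a i 0) x a u.
  have D := is_derive_gumbel x a u.
  apply: is_derive_eq; rewrite /GRing.scale/=.
  have -> : (fun i => be * a i 0 * (be * a i 0)) = (fun i => (be * a i 0) ^+ 2).
    by apply/funext => i; rewrite expr2.
  by ring.
by move=> u; rewrite (exprSr (be * `|a|) 2); exact: gumbel2_derive_bound.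
Qed.

End gumbel.

Section integrable_EFin.
Context d (T : measurableType d) (R : realType) (mu : {measure set T -> \bar R}).
Implicit Types (f g : T -> R) (D : set T).

Lemma integrable_EFinD D f g : measurable D -> mu.-integrable D (EFin \o f) ->
  mu.-integrable D (EFin \o g) -> mu.-integrable D (EFin \o (fun z => f z + g z)).
Proof. by move=> mD If Ig; exact: (integrableD mD If Ig). Qed.

Lemma integrable_EFinB D f g : measurable D -> mu.-integrable D (EFin \o f) ->
  mu.-integrable D (EFin \o g) -> mu.-integrable D (EFin \o (fun z => f z - g z)).
Proof. by move=> mD If Ig; exact: (integrableB mD If Ig). Qed.

Lemma integrable_EFinZ D f (c : R) : measurable D -> mu.-integrable D (EFin \o f) ->
  mu.-integrable D (EFin \o (fun z => c * f z)).
Proof. by move=> mD If; exact: (integrableZl mD c If). Qed.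

End integrable_EFin.

Lemma Rintegral_prob_cst d (T : measurableType d) (R : realType)
  (P : probability T R) (c : R) : \int[P]_z c = c.
Proof. by rewrite Rintegral_cst// [fine (P setT)](_ : _ = 1) ?mulr1// probability_setT. Qed.

(** * Slepian's inequality for the smooth indicator *)

Section slepian.
Context {R : realType}.
Variables (s : R) (n : nat) (be : R).
Hypotheses (s_gt0 : 0 < s) (be_ge0 : 0 <= be).
Notation V := 'cV[R]_n.
Notation F := (gumbel be).
Notation N := (normal_prob 0 s).
Implicit Types (x a b : V) (L : seq V).

Let s_neq0 : s != 0. Proof. by rewrite gt_eqF. Qed.

Let v2 : R := \int[N]_z (z ^+ 2).
Let m1 : R := \int[N]_z `|z|.
Let m3 : R := \int[N]_z (`|z| ^+ 3).

Let i3 : N.-integrable setT (EFin \o (fun z : R => `|z| ^+ 3)).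
Proof. exact: integrable_normal_normX3. Qed.

Let i03 : N.-integrable setT (EFin \o (fun z : R => 1 + `|z| ^+ 3)).
Proof.
apply: integrable_EFinD => //.
exact: finite_measure_integrable_cst.
Qed.

Let i2 : N.-integrable setT (EFin \o (fun z : R => z ^+ 2)).
Proof.
apply: (le_integrable measurableT _ _ i03).
- by apply/measurable_EFinP; exact: measurable_funX.
- move=> z _ /=; rewrite lee_fin normrX [leRHS]ger0_norm ?addr_ge0 ?exprn_ge0//.
  have := normr_ge0 z; move: `|z| => y y0.
  by have [y1|/ltW y1] := lerP y 1; nra.
Qed.

Let i1 : N.-integrable setT (EFin \o (fun z : R => z)).
Proof.
apply: (le_integrable measurableT _ _ i03).
- by apply/measurable_EFinP; exact: measurable_id.
- move=> z _ /=; rewrite lee_fin (@ger0_norm _ (1 + _)) ?addr_ge0 ?exprn_ge0//.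
  have := normr_ge0 z; move: `|z| => y y0.
  by have [y1|/ltW y1] := lerP y 1; nra.
Qed.

Let i1' : N.-integrable setT (EFin \o (fun z : R => `|z|)).
Proof.
apply: (le_integrable measurableT _ _ i1).
- by apply/measurable_EFinP; exact: normr_measurable.
- by move=> z _ /=; rewrite lee_fin normr_id.
Qed.

Lemma normr_Rintegral_le (h g : R -> R) : N.-integrable setT (EFin \o h) ->
  N.-integrable setT (EFin \o g) -> (forall z, `|h z| <= g z) ->
  `|\int[N]_z h z| <= \int[N]_z g z.
Proof.
move=> ih ig hg; apply: (le_trans (le_normr_Rintegral _ _)) => //.
apply: le_Rintegral => //.
apply: (le_integrable measurableT _ _ ih).
  apply/measurable_EFinP; apply: measurableT_comp => //.
  by apply/measurable_EFinP; exact: measurable_int ih.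
by move=> z _ /=; rewrite lee_fin normr_id.
Qed.

(** The first-order term vanishes by symmetry of the normal law. The constant must not depend on x,
    because the error is accumulated along all the copies in Lindeberg's method. *)
Lemma gop_gumbel_expansion a : exists2 C, 0 <= C & forall (e : R) x, 0 < e <= 1 ->
  `|gop s (e *: a) F x - F x - e ^+ 2 * v2 / 2 * gumbel2 be a x| <= C * e ^+ 3.
Proof.
pose K := (be * `|a|) ^+ 3 * 13.
have K0 : 0 <= K by rewrite mulr_ge0// exprn_ge0// mulr_ge0.
exists (K * m3); first by rewrite mulr_ge0// Rintegral_ge0// => z _; rewrite exprn_ge0.
move=> e x /andP[e0 e1].
have iF : N.-integrable setT (EFin \o (fun z : R => F (x + z *: (e *: a)))).
  by apply: blip_integrable; exact: blip_gumbel.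
have ic (c : R) : N.-integrable setT (EFin \o (fun=> c)).
  exact: finite_measure_integrable_cst.
have iz (c : R) : N.-integrable setT (EFin \o (fun z => c * z)).
  exact: integrable_EFinZ.
have iz2 (c : R) : N.-integrable setT (EFin \o (fun z => c * z ^+ 2)).
  exact: integrable_EFinZ.
have iB (f g : R -> R) : N.-integrable setT (EFin \o f) ->
   N.-integrable setT (EFin \o g) -> N.-integrable setT (EFin \o (fun z => f z - g z)).
  exact: integrable_EFinB.
have -> : gop s (e *: a) F x - F x - e ^+ 2 * v2 / 2 * gumbel2 be a x =
   \int[N]_z (F (x + z *: (e *: a)) - F x - e * gumbel1 be a x * z
       - e ^+ 2 / 2 * gumbel2 be a x * z ^+ 2).
  rewrite RintegralB//; last by apply: (iB) => //; apply: (iB).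
  rewrite RintegralB//; last exact: (iB).
  rewrite RintegralB// RintegralZl// RintegralZl//.
  rewrite Rintegral_prob_cst.
  rewrite Rintegral_normal_id// mulr0 subr0 -/v2; congr (_ - _ - _).
  by ring.
rewrite [leRHS](_ : _ = \int[N]_z (K * e ^+ 3 * `|z| ^+ 3)); last first.
  by rewrite RintegralZl// -/m3; ring.
apply: normr_Rintegral_le.
- by apply: (iB) => //; apply: (iB) => //; apply: (iB).
- exact: integrable_EFinZ.
- move=> z; have := gumbel_taylor be_ge0 a x (z * e).
  rewrite -scalerA -/K normrM exprMn (gtr0_norm e0).
  have -> : z * e * gumbel1 be a x = e * gumbel1 be a x * z by ring.
  have -> : z ^+ 2 * e ^+ 2 / 2 * gumbel2 be a x = e ^+ 2 / 2 * gumbel2 be a x * z ^+ 2 by ring.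
  by have -> : K * (`|z| * e) ^+ 3 = K * e ^+ 3 * `|z| ^+ 3 by ring.
Qed.

(** An error of order e suffices here, since the estimate is applied to second-order terms that
    already carry a factor e^2. *)
Lemma gop_blip_expansion (G : V -> R) a : blip G -> exists2 C, 0 <= C &
  forall (e : R) x, 0 < e -> `|gop s (e *: a) G x - G x| <= C * e.
Proof.
move=> bG; have [B GB] := bG.
have B0 : 0 <= B by apply: le_trans (GB 0 0).1.
exists (B * `|a| * m1); first by rewrite !mulr_ge0// Rintegral_ge0.
move=> e x e0.
have iG : N.-integrable setT (EFin \o (fun z : R => G (x + z *: (e *: a)))).
  exact: blip_integrable.
have ic (c : R) : N.-integrable setT (EFin \o (fun=> c)).
  exact: finite_measure_integrable_cst.
have -> : gop s (e *: a) G x - G x = \int[N]_z (G (x + z *: (e *: a)) - G x).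
  by rewrite RintegralB// Rintegral_prob_cst.
rewrite [leRHS](_ : _ = \int[N]_z (B * `|a| * e * `|z|)); last first.
  by rewrite RintegralZl// -/m1; ring.
apply: normr_Rintegral_le.
- exact: integrable_EFinB.
- exact: integrable_EFinZ.
- move=> z; rewrite (le_trans (GB _ _).2)//.
  rewrite addrC addKr !normrZ (gtr0_norm e0).
  by rewrite le_eqVlt; apply/orP; left; apply/eqP; ring.
Qed.

Lemma gops_gumbel_expansion L : exists2 C, 0 <= C & forall (e : R) x, 0 < e <= 1 ->
  `|gops s [seq e *: a | a <- L] F x - F x -
    e ^+ 2 * v2 / 2 * \sum_(a <- L) gumbel2 be a x| <= C * e ^+ 3.
Proof.
elim: L => [|a L [C C0 IH]].
  by exists 0 => // e x _; rewrite big_nil mulr0 subr0 subrr normr0 mul0r.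
pose S x := \sum_(a <- L) gumbel2 be a x.
have bS : blip S.
  rewrite /S; elim: L {C C0 IH S} => [|b L IH].
    by under eq_fun do rewrite big_nil; exact: blip_cst.
  under eq_fun do rewrite big_cons.
  by apply: (blipD (F := gumbel2 be b)) => //; exact: blip_gumbel2.
have [C1 C10 H1] := gop_gumbel_expansion a.
have [C2 C20 H2] := gop_blip_expansion a bS.
have v20 : 0 <= v2 by apply: Rintegral_ge0 => z _; exact: sqr_ge0.
exists (C + C1 + v2 / 2 * C2); first by rewrite !addr_ge0// mulr_ge0// divr_ge0.
move=> e x e01; have /andP[e0 e1] := e01.
set k := e ^+ 2 * v2 / 2.
have k0 : 0 <= k by rewrite /k divr_ge0// mulr_ge0// sqr_ge0.
have bF : blip (F : V -> R) by exact: blip_gumbel.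
rewrite /= big_cons -/(S x).
set G := gops _ _ _; have bG : blip G by exact: blip_gops.
have bkS : blip (fun x => k * S x) by exact: blipZ.
have bFS : blip (F \+ (fun x => k * S x)) by exact: blipD.
have bNFS : blip (fun x => -1 * (F x + k * S x)) by exact: (blipZ (-1) bFS).
have bD : blip (G \+ (fun x => -1 * (F x + k * S x))) by exact: blipD.
(* Three errors: the induction hypothesis averaged by [gop], which does not increase a uniform
   bound; the expansion of [gumbel] itself; and the variation of the second-order sum S under one
   averaging. *)
have -> : gop s (e *: a) G x - F x - k * (gumbel2 be a x + S x) =
  gop s (e *: a) (G \+ (fun x => -1 * (F x + k * S x))) x
  + (gop s (e *: a) F x - F x - k * gumbel2 be a x)
  + k * (gop s (e *: a) S x - S x).
  rewrite gopD// (gopZ _ (-1) _ _ bFS)// gopD// gopZ//.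
  by ring.
rewrite !mulrDl (le_trans (ler_normD _ _))// lerD//; last first.
  rewrite normrM (ger0_norm k0).
  apply: (@le_trans _ _ (k * (C2 * e))); first by rewrite ler_wpM2l// H2.
  by rewrite /k le_eqVlt; apply/orP; left; apply/eqP; ring.
rewrite (le_trans (ler_normD _ _))// lerD//; last exact: H1.
apply: gop_norm_le => // y /=.
by rewrite mulN1r opprD addrA; exact: IH.
Qed.

(** The second-order term depends on L only through the covariances, and those in the double sum
    have positive coefficients. This sign is the source of Slepian's inequality. *)
Lemma sum_gumbel2 L x :
  \sum_(a <- L) gumbel2 be a x = be ^+ 2 * F x *
    (\sum_i \sum_j (\sum_(a <- L) a i 0 * a j 0) * (expR (be * x i 0) * expR (be * x j 0))
     - \sum_i (\sum_(a <- L) a i 0 * a i 0) * expR (be * x i 0)).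
Proof.
have E a : gumbel2 be a x = be ^+ 2 * F x *
    (\sum_i \sum_j (a i 0 * a j 0) * (expR (be * x i 0) * expR (be * x j 0))
     - \sum_i (a i 0 * a i 0) * expR (be * x i 0)).
  rewrite /gumbel2 mulrC -mulrA mulrCA; congr (_ * _).
  rewrite mulrBr; congr (_ - _); last first.
    by rewrite mulr_sumr; apply: eq_bigr => i _; ring.
  rewrite expr2 {1}/expsum mulr_suml mulr_sumr; apply: eq_bigr => i _.
  rewrite mulr_sumr mulr_sumr; apply: eq_bigr => j _.
  by ring.
rewrite (eq_bigr _ (fun a _ => E a)) -mulr_sumr; congr (_ * _).
rewrite sumrB; congr (_ - _).
  rewrite exchange_big; apply: eq_bigr => i _ /=.
  by rewrite exchange_big; apply: eq_bigr => j _ /=; rewrite mulr_suml.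
by rewrite exchange_big; apply: eq_bigr => i _ /=; rewrite mulr_suml.
Qed.

(** Equal variances cancel the subtracted single sum and the ordered covariances order the double
    sum, so the expansions are ordered up to O(e^3), as Lindeberg's argument requires. *)
Lemma slepian_gumbel L L' x :
  (forall i : 'I_n, \sum_(a <- L) a i 0 * a i 0 = \sum_(a <- L') a i 0 * a i 0) ->
  (forall i j : 'I_n, \sum_(a <- L') a i 0 * a j 0 <= \sum_(a <- L) a i 0 * a j 0) ->
  gops s L' F x <= gops s L F x.
Proof.
move=> Ed Eo.
have [C C0 H] := gops_gumbel_expansion L.
have [C' C'0 H'] := gops_gumbel_expansion L'.
apply: (@gops_le_infinitesimal _ _ _ s_neq0 _ _ _ (C + C')); first exact: blip_gumbel.
move=> e y e01.
have v20 : 0 <= v2 by apply: Rintegral_ge0 => z _; exact: sqr_ge0.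
have k0 : 0 <= e ^+ 2 * v2 / 2 by rewrite divr_ge0// mulr_ge0// sqr_ge0.
have := H e y e01; rewrite ler_norml => /andP[h1 _].
have := H' e y e01; rewrite ler_norml => /andP[_ h2].
have h3 : \sum_(a <- L') gumbel2 be a y <= \sum_(a <- L) gumbel2 be a y.
  rewrite !sum_gumbel2 ler_wpM2l ?mulr_ge0 ?sqr_ge0 ?gumbel_ge0//.
  rewrite lerB//; last by rewrite (eq_bigr _ (fun i _ => congr1 ( *%R^~ _) (Ed i))).
  apply: ler_sum => i _; apply: ler_sum => j _.
  by rewrite ler_wpM2r// mulr_ge0 ?expR_ge0.
have := ler_wpM2l k0 h3.
rewrite mulrDl; lra.
Qed.

End slepian.

(** * Independent Gaussian families and their existence *)

Section gaussian_family.
Context {R : realType}.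

(* Independent N(0, s^2) variables, with independence expressed by the two
   integration formulas that are needed. *)
Record gaussian_family (s : R) disp (T : measurableType disp)
    (P : probability T R) (I : finType) (X : I -> T -> R) : Prop := GaussianFamily {
  gfam_measurable : forall i, measurable_fun setT (X i) ;
  gfam_gops : forall (V : normedModType R) (F : V -> R) (a : I -> V) (x : V),
    blip F ->
    \int[P]_w F (x + \sum_i X i w *: a i) = gops s [seq a i | i <- enum I] F x ;
  gfam_prod : forall (psi : I -> R -> R) (q : I -> R),
    (forall i, measurable_fun setT (psi i)) -> (forall i x, 0 <= psi i x) ->
    (forall i, (\int[normal_prob 0 s]_z (psi i z)%:E = (q i)%:E)%E) ->
    (\int[P]_w (\prod_i psi i (X i w))%:E = (\prod_i q i)%:E)%E }.

Lemma measurable_blip_lincomb disp (T : measurableType disp) m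
    (X : 'I_m -> T -> R) (V : normedModType R) (F : V -> R) (a : 'I_m -> V) (x : V) :
  (forall i, measurable_fun setT (X i)) -> blip F ->
  measurable_fun setT (fun w => F (x + \sum_i X i w *: a i)).
Proof.
move=> mX bF.
pose Y w : 'cV[R]_m := \col_i X i w.
pose g (v : 'cV[R]_m) := F (x + \sum_i v i 0 *: a i).
rewrite (_ : (fun _ => _) = (fun w => g (Y w))); last first.
  by apply/funext => w; congr (F (_ + _)); apply: eq_bigr => i _; rewrite mxE.
apply: measurable_continuous_mx.
  move=> i j; rewrite /entry (_ : (fun _ => _) = X i)//.
  by apply/funext => w; rewrite mxE.
have cZ i : continuous (fun v : 'cV[R]_m => v i 0 *: a i).
  move=> v; apply: (@continuous_comp _ _ _ (fun v : 'cV[R]_m => v i 0) (fun k : R => k *: a i)).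
    exact: coord_continuous.
  exact: scalel_continuous.
have cS : continuous (fun v : 'cV[R]_m => \sum_i v i 0 *: a i).
  rewrite (_ : (fun _ => _) = \sum_i (fun v : 'cV[R]_m => v i 0 *: a i)); last first.
    by apply/funext => v; rewrite fct_sumE.
  elim/big_ind : _ => [|f g' cf cg|i _]; [exact: cst_continuous| |exact: cZ].
  by move=> v; apply: (@cvgD _ V _ (nbhs v)); [exact: cf|exact: cg].
move=> v; apply: (@continuous_comp _ _ _ (fun v : 'cV[R]_m => x + \sum_i v i 0 *: a i) F).
  by apply: (@cvgD _ V _ (nbhs v)); [exact: cvg_cst|exact: cS].
exact: (blip_continuous bF).
Qed.

Lemma prob_bounded_integrable disp (T : measurableType disp) (P : probability T R)
    (h : T -> R) (B : R) : measurable_fun setT h -> (forall w, `|h w| <= B) ->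
  P.-integrable setT (EFin \o h).
Proof.
move=> mh hB.
apply: (@le_integrable _ _ _ P setT measurableT _ (cst B%:E)).
- exact/measurable_EFinP.
- by move=> z _ /=; rewrite lee_fin (le_trans (hB z))// ler_norm.
- exact: finite_measure_integrable_cst.
Qed.

(** Built by iterated products with the normal law, starting from a point mass. Fubini's theorem
    peels off the coordinates in the order in which [gops] folds its list. *)
Lemma gaussian_family_ord (s : R) (m : nat) :
  exists disp (T : measurableType disp) (P : probability T R) (X : 'I_m -> T -> R),
    gaussian_family s P X.
Proof.
elim: m => [|m [d [T [P [X [mX Xgops Xprod]]]]]].
  exists _, unit, (\d_tt : probability unit R), (fun _ _ => 0); split=> //.
  - move=> V F a x bF; rewrite (_ : enum 'I_0 = [::])/=; last first.
      by apply/size0nil; rewrite size_enum_ord.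
    under eq_Rintegral do rewrite big_ord0 addr0.
    exact: Rintegral_prob_cst.
  - move=> psi q _ _ _.
    under eq_integral do rewrite big_ord0.
    by rewrite big_ord0 integral_cst// mul1e; exact: probability_setT.
pose N : probability _ R := normal_prob 0 s.
pose X' (i : 'I_m.+1) (zw : R * T) :=
  if unlift ord0 i is Some j then X j zw.2 else zw.1.
have X'0 zw : X' ord0 zw = zw.1 by rewrite /X' unlift_none.
have X'l j zw : X' (lift ord0 j) zw = X j zw.2 by rewrite /X' liftK.
exists _, _, (N \x P)%E, X'; split.
- move=> i; case: (unliftP ord0 i) => [j ->|->].
    rewrite (_ : X' _ = X j \o snd); first exact: measurableT_comp.
    by apply/funext => zw; rewrite X'l.
  rewrite (_ : X' _ = fst)//.
  by apply/funext => zw; rewrite X'0.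
- move=> V F a x bF; rewrite enum_ordSl /=.
  have [B FB] := bF.
  pose h (zw : R * T) := F (x + \sum_i X' i zw *: a i).
  have mh : measurable_fun setT h.
    apply: measurable_blip_lincomb => // i.
    case: (unliftP ord0 i) => [j ->|->].
      rewrite (_ : X' _ = X j \o snd); first exact: measurableT_comp.
      by apply/funext => zw; rewrite X'l.
    rewrite (_ : X' _ = fst)//.
    by apply/funext => zw; rewrite X'0.
  have ih : (N \x P)%E.-integrable setT (EFin \o h).
    by apply: (@prob_bounded_integrable _ _ _ _ B) => // w; exact: (FB _ 0).1.
  rewrite /Rintegral -(integral12_prod_meas1 ih).
  rewrite /gop /Rintegral; congr fine; apply: eq_integral => z _.
  rewrite -map_comp -(Xgops V F (a \o lift ord0)) //.
  rewrite /Rintegral fineK; last first.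
    apply: integrable_fin_num => //.
    apply: (@prob_bounded_integrable _ _ _ _ B); first exact: measurable_blip_lincomb.
    by move=> w; exact: (FB _ 0).1.
  apply: eq_integral => w _; rewrite /h /=.
  rewrite big_ord_recl X'0 addrA; congr (F (_ + _))%:E.
  by apply: eq_bigr => i _; rewrite X'l.
- move=> psi q mpsi psi0 psiq.
  have mp : measurable_fun setT (fun zw : R * T => (\prod_i psi i (X' i zw))%:E).
    apply/measurable_EFinP.
    apply: measurable_prod => i _; apply: measurableT_comp => //.
    case: (unliftP ord0 i) => [j ->|->].
      rewrite (_ : X' _ = X j \o snd); first exact: measurableT_comp.
      by apply/funext => zw; rewrite X'l.
    rewrite (_ : X' _ = fst)//.
    by apply/funext => zw; rewrite X'0.
  have p0 zw : (0 <= (\prod_i psi i (X' i zw))%:E)%E.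
    by rewrite lee_fin; apply: prodr_ge0.
  apply: (eq_trans (@fubini_tonelli1 _ _ _ _ _ N P (fun zw : R * T => (\prod_i psi i (X' i zw))%:E) mp p0)).
  rewrite big_ord_recl EFinM -psiq.
  rewrite -(Xprod (psi \o lift ord0) (q \o lift ord0)); last 3 first.
  + by move=> i; exact: mpsi.
  + by move=> i z; exact: psi0.
  + by move=> i; exact: psiq.
  rewrite -ge0_integralZr//; last 3 first.
  + by apply/measurable_EFinP; exact: mpsi.
  + by move=> z _; rewrite lee_fin; exact: psi0.
  + by apply: integral_ge0 => w _; rewrite lee_fin; apply: prodr_ge0 => i _; exact: psi0.
  apply: eq_integral => z _; rewrite /fubini_F -ge0_integralZl//.
  + apply: eq_integral => w _ /=; rewrite big_ord_recl X'0 EFinM; congr (_ * _%:E)%E.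
    by apply: eq_bigr => i _; rewrite X'l.
  + apply/measurable_EFinP; apply: measurable_prod => i _.
    by apply: measurableT_comp => //; exact: mpsi.
  + by move=> w _; rewrite lee_fin; apply: prodr_ge0 => i _; exact: psi0.
  + by rewrite lee_fin; exact: psi0.
Qed.

Lemma map_enum_val (I : finType) : [seq enum_val i | i <- enum 'I_#|I|] = enum I.
Proof.
case: (pickP (xpredT : pred I)) => [x0 _|I0]; last first.
  case: (enum I) => [|x t]; last by have := I0 x.
  by case: (map _ _) => [//|x t]; have := I0 x.
apply: (@eq_from_nth _ x0); first by rewrite size_map size_enum_ord cardE.
move=> i; rewrite size_map size_enum_ord => iI.
by rewrite (nth_map (Ordinal iI)) ?size_enum_ord// (enum_val_nth x0) nth_enum_ord.
Qed.

Lemma gaussian_family_exists (s : R) (I : finType) :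
  exists disp (T : measurableType disp) (P : probability T R) (X : I -> T -> R),
    gaussian_family s P X.
Proof.
have [d [T [P [X [mX Xgops Xprod]]]]] := gaussian_family_ord s #|I|.
exists d, T, P, (fun i => X (enum_rank i)); split.
- by move=> i; exact: mX.
- move=> V F a x bF.
  have -> : [seq a i | i <- enum I] = [seq a (enum_val j) | j <- enum 'I_#|I|].
    by rewrite (map_comp a enum_val) map_enum_val.
  rewrite -(Xgops V F (a \o enum_val) x bF).
  apply: eq_Rintegral => w _; congr (F (_ + _)).
  rewrite (reindex (@enum_val I I))/=; last by apply: onW_bij; exact: (@enum_val_bij I).
  by apply: eq_bigr => j _; rewrite enum_valK.
- move=> psi q mpsi psi0 psiq.
  rewrite (reindex (@enum_val I I))/=; last by apply: onW_bij; exact: (@enum_val_bij I).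
  rewrite -(Xprod (psi \o enum_val) (q \o enum_val))//=.
  apply: eq_integral => w _; congr EFin.
  rewrite (reindex (@enum_val I I))/=; last by apply: onW_bij; exact: (@enum_val_bij I).
  by apply: eq_bigr => j _; rewrite enum_valK.
Qed.

End gaussian_family.

Section dot_facts.
Context {R : realType}.

Lemma dotC n (u v : 'cV[R]_n) : dot u v = dot v u.
Proof. by apply: eq_bigr => i _; rewrite mulrC. Qed.

Lemma dotDl n (u v w : 'cV[R]_n) : dot (u + v) w = dot u w + dot v w.
Proof. by rewrite /dot -big_split/=; apply: eq_bigr => i _; rewrite !mxE mulrDl. Qed.

Lemma dotZl n (c : R) (u w : 'cV[R]_n) : dot (c *: u) w = c * dot u w.
Proof. by rewrite /dot mulr_sumr; apply: eq_bigr => i _; rewrite !mxE mulrA. Qed.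

Lemma dotDr n (u v w : 'cV[R]_n) : dot w (u + v) = dot w u + dot w v.
Proof. by rewrite dotC dotDl !(dotC w). Qed.

Lemma dotZr n (c : R) (u w : 'cV[R]_n) : dot w (c *: u) = c * dot w u.
Proof. by rewrite dotC dotZl (dotC w). Qed.

Lemma dot_ge0 n (u : 'cV[R]_n) : 0 <= dot u u.
Proof. by apply: sumr_ge0 => i _; rewrite -expr2 sqr_ge0. Qed.

Lemma dot_unit_le1 n (u v : 'cV[R]_n) : dot u u = 1 -> dot v v = 1 -> dot u v <= 1.
Proof.
move=> u1 v1; have := dot_ge0 (u + -1 *: v).
rewrite !dotDl !dotDr !dotZl !dotZr u1 v1 (dotC v u); lra.
Qed.

End dot_facts.

(** * Operator norm of a Gaussian matrix *)

Section bilinear_comparison.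
Context {R : realType}.
Variables (s : R) (l d n : nat).
Hypothesis s_gt0 : 0 < s.
Variables (u : 'I_n.+1 -> 'cV[R]_l) (v : 'I_n.+1 -> 'cV[R]_d).
Hypotheses (u1 : forall i, dot (u i) (u i) = 1) (v1 : forall i, dot (v i) (v i) = 1).
Context d1 (T1 : measurableType d1) (P : probability T1 R)
  (X : 'I_l * 'I_d -> T1 -> R) (gX : gaussian_family s P X).
Context d2 (T2 : measurableType d2) (Q : probability T2 R)
  (Y : 'I_l + 'I_d -> T2 -> R) (gY : gaussian_family s Q Y).

Let V := 'cV[R]_n.+1.
(** [a] and [b] are the loadings of the bilinear and linear vectors on their independent
    coordinates. [one] is the loading of the extra Gaussian, which adds 1 to every covariance. *)
Let a (p : 'I_l * 'I_d) : V := \col_i (u i p.1 0 * v i p.2 0).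
Let one : V := const_mx 1.
Let b (j : 'I_l + 'I_d) : V :=
  \col_i (match j with inl p => u i p 0 | inr q => v i q 0 end).

Let bil i w := \sum_p X p w * a p i 0.
Let lin i w := \sum_j Y j w * b j i 0.

Let N : probability _ R := normal_prob 0 s.
Let NP : probability _ R := (N \x P)%E.

Let mbil i : measurable_fun setT (bil i).
Proof.
apply: measurable_sum => p; apply: measurable_funM => //.
exact: gfam_measurable gX p.
Qed.

Let mlin i : measurable_fun setT (lin i).
Proof.
apply: measurable_sum => p; apply: measurable_funM => //.
exact: gfam_measurable gY p.
Qed.

(* The covariance gap is (1 - u_i.u_j)(1 - v_i.v_j), nonnegative and zero for
   i = j. *)
Lemma gops_bilinear_comparison be x : 0 <= be ->
  gops s [seq b j | j <- enum {: 'I_l + 'I_d}] (gumbel be) x <=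
  gop s one (gops s [seq a p | p <- enum {: 'I_l * 'I_d}] (gumbel be)) x.
Proof.
move=> be0; rewrite -[leRHS]/(gops s (one :: [seq a p | p <- enum {: 'I_l * 'I_d}]) (gumbel be) x).
have CL i j : \sum_(c <- one :: [seq a p | p <- enum {: 'I_l * 'I_d}]) c i 0 * c j 0 =
    1 + dot (u i) (u j) * dot (v i) (v j).
  rewrite big_cons !mxE mulr1 big_map big_enum/=; congr (1 + _).
  rewrite /dot mulr_suml.
  under [RHS]eq_bigr do rewrite mulr_sumr.
  rewrite pair_big /=; apply: eq_big => [//|[p q] _ /=]; rewrite !mxE /=.
  by ring.
have CL' i j : \sum_(c <- [seq b j | j <- enum {: 'I_l + 'I_d}]) c i 0 * c j 0 =
    dot (u i) (u j) + dot (v i) (v j).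
  rewrite big_map big_enum/= big_sumType/=.
  by congr (_ + _); apply: eq_bigr => p _; rewrite !mxE.
apply: slepian_gumbel => //.
  by move=> i; rewrite CL CL' u1 v1; lra.
move=> i j; rewrite CL CL'.
have h1 := dot_unit_le1 (u1 i) (u1 j); have h2 := dot_unit_le1 (v1 i) (v1 j).
by nra.
Qed.

Lemma Rintegral_gumbel_comparison be (c : R) : 0 <= be ->
  \int[Q]_w gumbel be (\col_i (lin i w - c)) <=
  \int[NP]_zw gumbel be (\col_i (zw.1 + bil i zw.2 - c)).
Proof.
(* Starting both Gaussian vectors at -c turns the orthant at 0 into the orthant at level c. *)
move=> be0; pose x : V := const_mx (- c).
have := @gops_bilinear_comparison be x be0.
have bF := blip_gumbel n.+1 be0.
rewrite -(gfam_gops gY b x bF).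
have -> : \int[Q]_w gumbel be (x + \sum_i Y i w *: b i) =
    \int[Q]_w gumbel be (\col_i (lin i w - c)).
  apply: eq_Rintegral => w _; congr (gumbel be _); apply/colP => i.
  by rewrite !mxE summxE addrC /lin; congr (_ + _); apply: eq_bigr => p _; rewrite !mxE.
have mh : measurable_fun setT (fun zw : R * T1 => gumbel be (\col_i (zw.1 + bil i zw.2 - c))).
  apply: (@measurable_continuous_mx _ _ _ _ _ (fun zw : R * T1 => \col_i (zw.1 + bil i zw.2 - c))).
    move=> i j; rewrite /entry.
    rewrite (_ : (fun _ => _) = (fun zw : R * T1 => zw.1 + bil i zw.2 - c)); last first.
      by apply/funext => zw; rewrite mxE.
    apply: measurable_funB => //; apply: measurable_funD => //.
    exact: measurableT_comp.
  exact: blip_continuous.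
have ih : NP.-integrable setT (EFin \o (fun zw : R * T1 => gumbel be (\col_i (zw.1 + bil i zw.2 - c)))).
  apply: (@prob_bounded_integrable _ _ _ _ _ 1) => // w.
  by rewrite ger0_norm ?gumbel_ge0// gumbel_le1.
move=> H; apply: (le_trans H).
rewrite /gop /Rintegral -(integral12_prod_meas1 ih).
rewrite le_eqVlt; apply/orP; left; apply/eqP; congr fine.
apply: eq_integral => z _.
rewrite -(gfam_gops gX a (x + z *: one) bF) /Rintegral fineK; last first.
  apply: integrable_fin_num => //.
  apply: (@prob_bounded_integrable _ _ _ _ _ 1) => //; last first.
    by move=> w; rewrite ger0_norm ?gumbel_ge0// gumbel_le1.
  apply: (@measurable_continuous_mx _ _ _ _ _ (fun w => x + z *: one + \sum_i X i w *: a i)); last exact: blip_continuous.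
  move=> i j; rewrite /entry.
  rewrite (_ : (fun _ => _) = (fun w => x i j + z * one i j + \sum_p X p w * a p i j)).
    apply: measurable_funD => //; apply: measurable_sum => p; apply: measurable_funM => //.
    exact: gfam_measurable gX p.
  by apply/funext => w; rewrite !mxE summxE; congr (_ + _); apply: eq_bigr => p _; rewrite !mxE.
apply: eq_integral => w _ /=; congr (gumbel be _)%:E; apply/colP => i.
rewrite !mxE summxE (_ : \sum_p (X p w *: a p) i 0 = bil i w); last first.
  by apply: eq_bigr => p _; rewrite !mxE.
by ring.
Qed.

(** Outside the orthant some coordinate exceeds eta, and that single term makes [gumbel] at most
    exp(-exp(be eta)), hence at most exp(-be eta). *)
Lemma gumbel_upper be (eta : R) (x : V) : 0 <= be -> 0 < eta ->
  gumbel be x <= \1_[set y : V | forall i, y i 0 <= eta] x + expR (- (be * eta)).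
Proof.
move=> be0 eta0; rewrite indicE.
have [xin|/negP xnin] := boolP (x \in _).
  by rewrite (le_trans (gumbel_le1 _ _))// lerDl expR_ge0.
rewrite add0r ler_expR lerN2.
have [i xi] : exists i, eta < x i 0.
  apply: contrapT => /forallNP H; apply: xnin; rewrite inE => i /=.
  by rewrite leNgt; apply/negP/H.
apply: (@le_trans _ _ (expR (be * x i 0))).
  apply: (@le_trans _ _ (be * x i 0)); first by rewrite ler_wpM2l// ltW.
  by apply: le_trans (expR_ge1Dx _); rewrite lerDr.
rewrite /expsum (bigD1 i)//= mul1r lerDl.
by apply: sumr_ge0 => j _; rewrite mul1r expR_ge0.
Qed.

(** Inside the orthant each of the n + 1 exponentials is at most exp(-be eta), and exp(-y) >= 1 -
    y. *)
Lemma gumbel_lower be (eta : R) (x : V) : 0 <= be -> 0 < eta ->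
  \1_[set y : V | forall i, y i 0 <= - eta] x - n.+1%:R * expR (- (be * eta)) <=
  gumbel be x.
Proof.
move=> be0 eta0; rewrite indicE.
have [xin|xnin] := boolP (x \in _); last first.
  by rewrite add0r (@le_trans _ _ 0) ?gumbel_ge0// oppr_le0 mulr_ge0// expR_ge0.
apply: le_trans (expR_ge1Dx _); rewrite lerD2l lerN2 /expsum.
rewrite mulr_natl -[X in _ *+ X]card_ord -sumr_const; apply: ler_sum => i _.
rewrite mul1r ler_expR -mulrN ler_wpM2l//.
by move: xin; rewrite inE => /(_ i).
Qed.

Let evQ (c : R) := [set w | forall i, lin i w <= c].
Let evP (c : R) := [set zw : R * T1 | forall i, zw.1 + bil i zw.2 <= c].

Let mevQ c : measurable (evQ c).
Proof.
rewrite (_ : evQ c = \bigcap_(i in [set: 'I_n.+1]) (lin i @^-1` [set` `]-oo, c]])).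
  apply: fin_bigcap_measurable => // i _; rewrite -[X in measurable X]setTI.
  exact: mlin.
by apply/seteqP; split => [w H i _|w H i] /=; [rewrite in_itv/=|have := H i Logic.I; rewrite /= in_itv].
Qed.

Let mevP c : measurable (evP c).
Proof.
rewrite (_ : evP c = \bigcap_(i in [set: 'I_n.+1])
   ((fun zw : R * T1 => zw.1 + bil i zw.2) @^-1` [set` `]-oo, c]])).
  apply: fin_bigcap_measurable => // i _; rewrite -[X in measurable X]setTI.
  have : measurable_fun setT (fun zw : R * T1 => zw.1 + bil i zw.2).
    by apply: measurable_funD => //; exact: measurableT_comp.
  exact.
by apply/seteqP; split => [w H i _|w H i] /=; [rewrite in_itv/=|have := H i Logic.I; rewrite /= in_itv].
Qed.

Lemma Rintegral_prob_indic dd (T : measurableType dd) (M : probability T R) (A : set T) :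
  measurable A -> \int[M]_w (\1_A w) = fine (M A).
Proof. by move=> mA; rewrite /Rintegral integral_indic// setIT. Qed.

Lemma integrable_indicT dd (T : measurableType dd) (M : probability T R) (A : set T) :
  measurable A -> M.-integrable setT (EFin \o (\1_A : T -> R)).
Proof.
move=> mA; apply: (@prob_bounded_integrable _ _ _ _ _ 1).
  exact: measurable_indic.
by move=> w; rewrite indicE; case: (_ \in _); rewrite ?normr1 ?normr0.
Qed.

(** [gumbel] is squeezed between indicators of shifted orthants. As be grows the additive errors
    vanish, and only the margin eta on each side remains. *)
Lemma slepian_bilinear (c eta : R) : 0 < eta ->
  (Q (evQ (c - eta)) <= NP (evP (c + eta)))%E.
Proof.
move=> eta0.
rewrite -(fineK (fin_num_measure Q _ (mevQ _))) -(fineK (fin_num_measure NP _ (mevP _))).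
rewrite lee_fin; apply/ler_addgt0Pr => e e0.
(* The lower estimate costs n + 1 copies of exp(-be eta) and the upper one costs a single copy; be
   is chosen to keep the n + 2 of them below e. *)
pose K : R := n.+2%:R.
have K0 : 0 < K by rewrite ltr0n.
pose be := K / (eta * e).
have be0 : 0 <= be by rewrite divr_ge0// ?ltW// mulr_gt0.
pose t := expR (- (be * eta)).
have tle : K * t <= e.
  rewrite /t expRN ler_pdivrMr ?expR_gt0//.
  apply: (@le_trans _ _ (e * (be * eta))).
    rewrite /be (_ : e * (K / (eta * e) * eta) = K)//.
    by field; rewrite !gt_eqF.
  rewrite ler_wpM2l ?ltW//; apply: lt_le_trans (expR_ge1Dx _).
  by rewrite ltrDr.
have H := Rintegral_gumbel_comparison c be0.
have ic dd (T : measurableType dd) (M : probability T R) (r : R) : M.-integrable setT (EFin \o (fun=> r)).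
  exact: finite_measure_integrable_cst.
have HQ : fine (Q (evQ (c - eta))) - n.+1%:R * t <= \int[Q]_w gumbel be (\col_i (lin i w - c)).
  rewrite -Rintegral_prob_indic// -(Rintegral_prob_cst Q (n.+1%:R * t)).
  rewrite -RintegralB//; [|exact: integrable_indicT|exact: ic].
  apply: le_Rintegral => //.
  - by apply: integrable_EFinB => //; [exact: integrable_indicT|exact: ic].
  - apply: (@prob_bounded_integrable _ _ _ _ _ 1); last first.
      by move=> w; rewrite ger0_norm ?gumbel_ge0// gumbel_le1.
    apply: (@measurable_continuous_mx _ _ _ _ _ (fun w => \col_i (lin i w - c))); last first.
      by apply: blip_continuous; exact: blip_gumbel.
    move=> i j; rewrite /entry (_ : (fun _ => _) = (fun w => lin i w - c)).
      exact: measurable_funB.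
    by apply/funext => w; rewrite mxE.
  - move=> w _; apply: le_trans (gumbel_lower _ be0 eta0).
    rewrite lerD2r !indicE; rewrite le_eqVlt; apply/orP; left; apply/eqP.
    congr (nat_of_bool _)%:R; apply/idP/idP; rewrite !inE => h i; have := h i.
      by rewrite mxE; lra.
    by rewrite mxE; lra.
have HP : \int[NP]_zw gumbel be (\col_i (zw.1 + bil i zw.2 - c)) <=
    fine (NP (evP (c + eta))) + t.
  rewrite -(Rintegral_prob_indic NP (mevP _)) -[X in _ <= _ + X](Rintegral_prob_cst NP).
  rewrite -[leRHS](RintegralD measurableT (integrable_indicT NP (mevP _)) (ic _ _ NP t)).
  apply: le_Rintegral => //.
  - apply: (@prob_bounded_integrable _ _ _ _ _ 1); last first.
      by move=> w; rewrite ger0_norm ?gumbel_ge0// gumbel_le1.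
    apply: (@measurable_continuous_mx _ _ _ _ _ (fun zw : R * T1 => \col_i (zw.1 + bil i zw.2 - c))); last first.
      by apply: blip_continuous; exact: blip_gumbel.
    move=> i j; rewrite /entry (_ : (fun _ => _) = (fun zw : R * T1 => zw.1 + bil i zw.2 - c)).
      apply: measurable_funB => //; apply: measurable_funD => //.
      exact: measurableT_comp.
    by apply/funext => w; rewrite mxE.
  - exact: (integrable_EFinD measurableT (integrable_indicT NP (mevP _)) (ic _ _ NP t)).
  - move=> w _; apply: (le_trans (gumbel_upper _ be0 eta0)).
    rewrite lerD2r !indicE; rewrite le_eqVlt; apply/orP; left; apply/eqP.
    congr (nat_of_bool _)%:R; apply/idP/idP; rewrite !inE => h i; have := h i.
      by rewrite mxE; lra.
    by rewrite mxE; lra.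
move: tle HQ HP H; rewrite /K (mulrSr _ n.+1) mulrDl mul1r; lra.
Qed.

End bilinear_comparison.

Section stochastic_order.
Context {R : realType}.

(** By the layer-cake formula each expectation is the integral of its tail probabilities. *)
Lemma ge0_integral_stochastic_le d1 (T1 : measurableType d1) (P : probability T1 R)
    d2 (T2 : measurableType d2) (Q : probability T2 R) (f : T1 -> R) (g : T2 -> R) :
  measurable_fun setT f -> measurable_fun setT g ->
  (forall w, 0 <= f w) -> (forall w, 0 <= g w) ->
  (forall r, 0 <= r -> (P [set w | (r < f w)%R] <= Q [set w | (r < g w)%R])%E) ->
  (\int[P]_w (f w)%:E <= \int[Q]_w (g w)%:E)%E.
Proof.
move=> mf mg f0 g0 H.
pose f' : {mfun T1 >-> R} := HB.pack f (isMeasurableFun.Build _ _ _ _ f mf).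
pose g' : {mfun T2 >-> R} := HB.pack g (isMeasurableFun.Build _ _ _ _ g mg).
have := @ge0_expectation_ccdf _ _ _ P f' f0; rewrite expectation_def => ->.
have := @ge0_expectation_ccdf _ _ _ Q g' g0; rewrite expectation_def => ->.
apply: ge0_le_integral => //.
- by apply: measurable_funTS; exact: ccdf_measurable.
- by apply: measurable_funTS; exact: ccdf_measurable.
- move=> r /=; rewrite in_itv/= andbT => r0; have := H r r0.
  by rewrite /ccdf /distribution /pushforward !set_itvoy.
Qed.

Lemma measurable_bigmaxr d (T : measurableType d) (I : Type) (r : seq I)
    (f0 : T -> R) (f : I -> T -> R) :
  measurable_fun setT f0 -> (forall i, measurable_fun setT (f i)) ->
  measurable_fun setT (fun w => \big[Num.max/f0 w]_(i <- r) f i w).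
Proof.
move=> m0 mf; elim: r => [|i r IH]; first by under eq_fun do rewrite big_nil.
by under eq_fun do rewrite big_cons; exact: measurable_maxr.
Qed.

End stochastic_order.

(** * Tail of the maximum of finitely many bilinear forms *)

Section bilinear_tail.
Context {R : realType}.
Variables (s : R) (l d n : nat).
Hypotheses (s_gt0 : 0 < s) (l_gt0 : (0 < l)%N) (d_gt0 : (0 < d)%N).
Variables (u : 'I_n.+1 -> 'cV[R]_l) (v : 'I_n.+1 -> 'cV[R]_d).
Hypotheses (u1 : forall i, dot (u i) (u i) = 1) (v1 : forall i, dot (v i) (v i) = 1).

(** The coefficient of z^2 is what [dot_le_sqr] leaves at the rate ka / s with weight s (sqrt m +
    ka). It gives q^2 = 1 + ka / sqrt m <= exp(ka / sqrt m), so m such factors contribute at most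
    exp(ka sqrt m / 2). *)
Lemma integral_normal_expsqr_le (m : nat) (ka : R) : (0 < m)%N -> 0 < ka ->
  exists2 q : R, q <= expR (ka / (2 * Num.sqrt m%:R)) /\ 0 <= q &
  (\int[normal_prob 0 s]_z
    (expR (ka / s / (2 * (s * (Num.sqrt m%:R + ka))) * z ^+ 2))%:E = q%:E)%E.
Proof.
move=> m0 ka0; set c := _ / _ / _.
have r0 : (0 : R) < Num.sqrt m%:R by rewrite sqrtr_gt0 ltr0n.
set r := Num.sqrt m%:R in r0 c *.
have e1 : 2 * c * s ^+ 2 = ka / (r + ka).
  by rewrite /c; field; rewrite !gt_eqF// addr_gt0.
have lt1 : 2 * c * s ^+ 2 < 1.
  by rewrite e1 ltr_pdivrMr ?addr_gt0// mul1r ltrDr.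
exists (Num.sqrt (1 - 2 * c * s ^+ 2))^-1; last exact: integral_normal_expsqr.
split; last by rewrite invr_ge0 sqrtr_ge0.
rewrite e1 (_ : 1 - ka / (r + ka) = (1 + ka / r)^-1); last first.
  by field; rewrite !gt_eqF// addr_gt0.
have p0 : 0 < 1 + ka / r by rewrite addr_gt0// divr_gt0.
rewrite sqrtrV ?(ltW p0)// invrK.
rewrite -(@ler_pXn2r _ 2) ?nnegrE ?sqrtr_ge0 ?expR_ge0// sqr_sqrtr ?(ltW p0)//.
rewrite -expRM_natl; apply: (le_trans (expR_ge1Dx _)).
rewrite ler_expR le_eqVlt; apply/orP; left; apply/eqP.
by field; rewrite gt_eqF.
Qed.

(** Weighted arithmetic-geometric mean. The bound is uniform in the unit vector and is a sum over
    coordinates, so its exponential factors by independence. *)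
Lemma dot_le_sqr (m : nat) (a : 'cV[R]_m) (b : 'I_m -> R) (c : R) :
  0 < c -> dot a a = 1 ->
  \sum_p b p * a p 0 <= (2 * c)^-1 * \sum_p b p ^+ 2 + c / 2.
Proof.
move=> c0 a1.
have -> : c / 2 = \sum_p c / 2 * (a p 0 * a p 0) by rewrite -mulr_sumr -/(dot a a) a1 mulr1.
rewrite mulr_sumr -big_split/=; apply: ler_sum => p _.
rewrite -subr_ge0 (_ : _ - _ = (2 * c)^-1 * (b p - c * a p 0) ^+ 2).
  by rewrite mulr_ge0 ?sqr_ge0// invr_ge0 mulr_ge0// ltW.
by field; rewrite gt_eqF.
Qed.

(** At the rate la = t / s the linear process has exponential moment at most exp(t (sqrt l + sqrt d)
    + t^2). Dividing by the factor exp(t^2/2) of the extra Gaussian and multiplying by the Markov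
    factor exp(- t (sqrt l + sqrt d + t)) leaves exp(-t^2/2). *)
Lemma bilinear_tail (t : R) d1 (T1 : measurableType d1) (P : probability T1 R)
    (X : 'I_l * 'I_d -> T1 -> R) : 0 < t -> gaussian_family s P X ->
  (P [set w | (exists i, s * (Num.sqrt l%:R + Num.sqrt d%:R + t) <=
       \sum_p X p w * (u i p.1 0 * v i p.2 0))%R] <= (expR (- (t ^+ 2 / 2)))%:E)%E.
Proof.
move=> t0 gX.
have [d2 [T2 [Q [Y gY]]]] := gaussian_family_exists s (('I_l + 'I_d)%type : finType).
pose bil i w := \sum_p X p w * (u i p.1 0 * v i p.2 0).
pose bv (j : 'I_l + 'I_d) i := match j with inl p => u i p 0 | inr q => v i q 0 end.
pose lin i w := \sum_j Y j w * bv j i.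
have mbil i : measurable_fun setT (bil i).
  apply: measurable_sum => p; apply: measurable_funM => //.
  exact: gfam_measurable gX p.
have mlin i : measurable_fun setT (lin i).
  apply: measurable_sum => p; apply: measurable_funM => //.
  exact: gfam_measurable gY p.
pose N : probability _ R := normal_prob 0 s.
pose NP : probability _ R := (N \x P)%E.
have sle c eta : 0 < eta -> (Q [set w | (forall i, lin i w <= c - eta)%R] <=
   NP [set zw | (forall i, zw.1 + bil i zw.2 <= c + eta)%R])%E.
  move=> eta0; have := slepian_bilinear s_gt0 u1 v1 gX gY c eta0.
  congr (Q _ <= NP _)%E; apply/seteqP; split => w /= h i; have := h i;
   by under eq_bigr do rewrite mxE.
pose M w := \big[Num.max/bil ord0 w]_i bil i w.
pose Z w := \big[Num.max/lin ord0 w]_i lin i w.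
have mM : measurable_fun setT M by exact: measurable_bigmaxr.
have mZ : measurable_fun setT Z by exact: measurable_bigmaxr.
pose la := t / s; have la0 : 0 < la by exact: divr_gt0.
have las : la * s = t by rewrite divfK ?gt_eqF.
pose sl : R := Num.sqrt l%:R; pose sd : R := Num.sqrt d%:R.
have sl0 : 0 < sl by rewrite sqrtr_gt0 ltr0n.
have sd0 : 0 < sd by rewrite sqrtr_gt0 ltr0n.
have Zbound w : la * Z w <= \sum_j (match j with inl _ => t / s / (2 * (s * (sl + t)))
       | inr _ => t / s / (2 * (s * (sd + t))) end) * Y j w ^+ 2
     + (t * (sl + t) / 2 + t * (sd + t) / 2).
  have b10 : 0 < s * (sl + t) by rewrite mulr_gt0// addr_gt0.
  have b20 : 0 < s * (sd + t) by rewrite mulr_gt0// addr_gt0.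
  have li i : la * lin i w <= \sum_j (match j with inl _ => t / s / (2 * (s * (sl + t)))
       | inr _ => t / s / (2 * (s * (sd + t))) end) * Y j w ^+ 2
     + (t * (sl + t) / 2 + t * (sd + t) / 2).
    rewrite /lin !big_sumType/=.
    have h1 := @dot_le_sqr _ (u i) (fun p => Y (inl p) w) _ b10 (u1 i).
    have h2 := @dot_le_sqr _ (v i) (fun p => Y (inr p) w) _ b20 (v1 i).
    rewrite -!mulr_sumr.
    have := ler_wpM2l (ltW la0) (lerD h1 h2).
    move=> /le_trans; apply; rewrite le_eqVlt; apply/orP; left; apply/eqP.
    by rewrite /la; field; rewrite !gt_eqF// ?addr_gt0.
  rewrite -ler_pdivlMl//; apply/bigmax_leP; split => [|i _]; rewrite ler_pdivlMl//; exact: li.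
(* Half of t (sl + sd), together with t^2, is the constant in [Zbound]; the other half is
   contributed by the l + d Gaussian-square factors. *)
pose B := expR (t * (sl + sd) + t ^+ 2).
have E2 : (\int[Q]_w (expR (la * Z w))%:E <= B%:E)%E.
  have [q1 [q1le q10] q1E] := integral_normal_expsqr_le l_gt0 t0.
  have [q2 [q2le q20] q2E] := integral_normal_expsqr_le d_gt0 t0.
  pose psi (j : 'I_l + 'I_d) (z : R) := expR ((match j with
       | inl _ => t / s / (2 * (s * (sl + t)))
       | inr _ => t / s / (2 * (s * (sd + t))) end) * z ^+ 2).
  pose q (j : 'I_l + 'I_d) := match j with inl _ => q1 | inr _ => q2 end.
  pose K := expR (t * (sl + t) / 2 + t * (sd + t) / 2).
  have mpsi j : measurable_fun setT (psi j).
    by apply: measurableT_comp => //; apply: measurable_funM => //; exact: measurable_funX.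
  have psi0 j z : 0 <= psi j z by exact: expR_ge0.
  have psiq j : (\int[normal_prob 0 s]_z (psi j z)%:E = (q j)%:E)%E.
    by case: j => j; [exact: q1E|exact: q2E].
  have prE := gfam_prod gY mpsi psi0 psiq.
  have mprod : measurable_fun setT (fun w => (\prod_j psi j (Y j w))%:E).
    apply/measurable_EFinP; apply: measurable_prod => j _.
    by apply: measurableT_comp => //; exact: gfam_measurable gY j.
  apply: (@le_trans _ _ (\int[Q]_w (K%:E * (\prod_j psi j (Y j w))%:E))%E).
    apply: ge0_le_integral => //.
    - apply/measurable_EFinP; apply: measurableT_comp => //.
      exact: measurable_funM.
    - exact: emeasurable_funM.
    - move=> w _; rewrite -EFinM lee_fin /psi -expR_sum -expRD ler_expR addrC.
      exact: Zbound.
  rewrite ge0_integralZl//; last 2 first.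
  - by move=> w _; rewrite lee_fin; apply: prodr_ge0 => j _; exact: psi0.
  - by rewrite lee_fin expR_ge0.
  rewrite prE -EFinM lee_fin big_sumType/= !prodr_const !card_ord.
  apply: (@le_trans _ _ (K * (expR (t / (2 * sl)) ^+ l * expR (t / (2 * sd)) ^+ d))).
    rewrite ler_wpM2l ?expR_ge0// ler_pM ?exprn_ge0//.
      by rewrite lerXn2r// nnegrE ?expR_ge0.
    by rewrite lerXn2r// nnegrE ?expR_ge0.
  rewrite -!expRM_natl -!expRD ler_expR le_eqVlt; apply/orP; left; apply/eqP.
  have lE : l%:R = sl ^+ 2 by rewrite sqr_sqrtr.
  have dE : d%:R = sd ^+ 2 by rewrite sqr_sqrtr.
  by rewrite lE dE; field; rewrite !gt_eqF.
have E1 eta : 0 < eta -> (\int[NP]_zw (expR (la * (zw.1 + M zw.2)))%:E <=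
    (expR (2 * la * eta) * B)%:E)%E.
  move=> eta0; apply: (@le_trans _ _ (\int[Q]_w (expR (la * (Z w + 2 * eta)))%:E)%E).
    apply: ge0_integral_stochastic_le => //.
    - apply: measurableT_comp => //; apply: measurable_funM => //.
      by apply: measurable_funD => //; exact: measurableT_comp.
    - by apply: measurableT_comp => //; apply: measurable_funM => //; exact: measurable_funD.
    move=> r; rewrite le_eqVlt => /predU1P[<-|r0].
      rewrite (_ : [set w | 0 < expR (la * (Z w + 2 * eta))] = setT).
        rewrite probability_setT probability_le1//.
        rewrite -[X in measurable X]setTI.
        apply: (@measurable_fun_ltr _ _ _ setT (cst 0)
          (fun zw : R * T1 => expR (la * (zw.1 + M zw.2)))) => //.
        apply: measurableT_comp => //; apply: measurable_funM => //.
        by apply: measurable_funD => //; exact: measurableT_comp.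
      by apply/seteqP; split => // w _ /=; rewrite expR_gt0.
    (* Centred so that the two margins of [slepian_bilinear] put z + M at the level ln r / la and Z
       at that level minus 2 eta. *)
    pose c := ln r / la - eta.
    have mQ : measurable [set w | (forall i, lin i w <= c - eta)%R].
      rewrite (_ : [set _ | _] = \bigcap_(i in [set: 'I_n.+1]) (lin i @^-1` [set` `]-oo, c - eta]])).
        apply: fin_bigcap_measurable => // i _; rewrite -[X in measurable X]setTI.
        exact: mlin.
      by apply/seteqP; split => [w H i _|w H i] /=; [rewrite in_itv/=|have := H i Logic.I; rewrite /= in_itv].
    have mP : measurable [set zw : R * T1 | (forall i, zw.1 + bil i zw.2 <= c + eta)%R].
      rewrite (_ : [set _ | _] = \bigcap_(i in [set: 'I_n.+1])
        ((fun zw : R * T1 => zw.1 + bil i zw.2) @^-1` [set` `]-oo, c + eta]])).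
        apply: fin_bigcap_measurable => // i _; rewrite -[X in measurable X]setTI.
        have : measurable_fun setT (fun zw : R * T1 => zw.1 + bil i zw.2).
          by apply: measurable_funD => //; exact: measurableT_comp.
        exact.
      by apply/seteqP; split => [w H i _|w H i] /=; [rewrite in_itv/=|have := H i Logic.I; rewrite /= in_itv].
    have bmP m (g : 'I_n.+1 -> R) (x : R) : (m <= x)%R = (m <= x)%R -> (\big[Num.max/g ord0]_i g i <= x) = [forall i, g i <= x].
      move=> _; apply/bigmax_leP/forallP => [[_ h] i|h]; first exact: h.
      by split => [|i _]; exact: h.
    rewrite (_ : [set w | r < expR (la * (Z w + 2 * eta))] = ~` [set w | (forall i, lin i w <= c - eta)%R]); last first.
      have E w : (r < expR (la * (Z w + 2 * eta))) = ~~ [forall i, lin i w <= c - eta].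
        rewrite -(bmP 0)// -ltNge -{1}(lnK r0) ltr_expR -ltr_pdivrMl// mulrC /c.
        by rewrite -ltrBlDr; congr (_ < _); lra.
      apply/seteqP; split => w /=; first by rewrite E => /forallPn[i hi] /(_ i); apply/negP.
      by move=> H; rewrite E; apply/negP => /forallP.
    rewrite (_ : [set w | r < expR _] = ~` [set zw : R * T1 | (forall i, zw.1 + bil i zw.2 <= c + eta)%R]); last first.
      have E (zw : R * T1) : (r < expR (la * (zw.1 + M zw.2))) = ~~ [forall i, zw.1 + bil i zw.2 <= c + eta].
        under eq_forallb do rewrite -lerBrDl.
        rewrite -(bmP 0)// -ltNge -{1}(lnK r0) ltr_expR -ltr_pdivrMl// mulrC /c.
        by rewrite ltrBlDl subrK.
      apply/seteqP; split => w /=; first by rewrite E => /forallPn[i hi] /(_ i); apply/negP.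
      by move=> H; rewrite E; apply/negP => /forallP.
    rewrite !probability_setC// leeB//.
    exact: sle.
  under eq_integral => w _.
    rewrite (_ : la * (Z w + 2 * eta) = 2 * la * eta + la * Z w); last by ring.
    rewrite expRD EFinM; over.
  rewrite ge0_integralZl ?lee_fin ?expR_ge0//; last first.
    by apply/measurable_EFinP; apply: measurableT_comp => //; exact: measurable_funM.
  by rewrite EFinM lee_wpmul2l// lee_fin expR_ge0.
have mNP : measurable_fun setT (fun zw : R * T1 => (expR (la * (zw.1 + M zw.2)))%:E).
  apply/measurable_EFinP; apply: measurableT_comp => //; apply: measurable_funM => //.
  by apply: measurable_funD => //; exact: measurableT_comp.
have mE : measurable_fun setT (fun w => (expR (la * M w))%:E).
  by apply/measurable_EFinP; apply: measurableT_comp => //; exact: measurable_funM.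
set I := (\int[P]_w (expR (la * M w))%:E)%E.
have I0 : (0 <= I)%E by apply: integral_ge0 => w _; rewrite lee_fin expR_ge0.
have NPE : (\int[NP]_zw (expR (la * (zw.1 + M zw.2)))%:E = (expR (t ^+ 2 / 2))%:E * I)%E.
  apply: (eq_trans (@fubini_tonelli1 _ _ _ _ _ N P (fun zw : R * T1 => (expR (la * (zw.1 + M zw.2)))%:E) mNP (fun zw => expR_ge0 _))).
  transitivity (\int[N]_z ((expR (la * z))%:E * I))%E.
    apply: eq_integral => z _; rewrite /fubini_F /I -ge0_integralZl ?lee_fin ?expR_ge0//.
    by apply: eq_integral => w _ /=; rewrite mulrDr expRD EFinM.
  rewrite ge0_integralZr//; last first.
    by apply/measurable_EFinP; apply: measurableT_comp => //; exact: measurable_funM.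
  by rewrite integral_normal_expZ ?gt_eqF// -exprMn las.
pose m0 := s * (sl + sd + t).
set ev := [set w | _].
have mev : measurable ev.
  rewrite (_ : ev = \bigcup_(i in [set: 'I_n.+1]) (bil i @^-1` [set` `[m0, +oo[ ])).
    apply: fin_bigcup_measurable => // i _; rewrite -[X in measurable X]setTI.
    exact: mbil.
  apply/seteqP; split => [w [i hi]|w [i _]] /=.
    by exists i => //=; rewrite in_itv/= andbT.
  by rewrite in_itv/= andbT; exists i.
have mark : ((expR (la * m0))%:E * P ev <= I)%E.
  rewrite (_ : P ev = (\int[P]_w (\1_ev w)%:E)%E); last by rewrite integral_indic// setIT.
  rewrite -ge0_integralZl ?lee_fin ?expR_ge0//; last exact/measurable_EFinP/measurable_indic.
  apply: ge0_le_integral => //.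
  - by apply: emeasurable_funM => //; exact/measurable_EFinP/measurable_indic.
  - move=> w _; rewrite -EFinM lee_fin indicE.
    have [|] := boolP (w \in ev); last by rewrite mulr0 expR_ge0.
    rewrite inE => -[i hi]; rewrite mulr1 ler_expR ler_wpM2l ?(ltW la0)//.
    by apply: (le_trans hi); exact: (le_bigmax _ (fun i => bil i w)).
rewrite -(fineK (fin_num_measure P _ mev)) lee_fin; set p := fine _.
have pE : P ev = p%:E by rewrite /p fineK// fin_num_measure.
set Et := expR (- (t ^+ 2 / 2)).
have Et0 : 0 < Et by exact: expR_gt0.
have key eta : 0 < eta -> p <= expR (2 * la * eta) * Et.
  move=> eta0; have := E1 eta eta0; rewrite NPE => h.
  have : ((expR (t ^+ 2 / 2))%:E * ((expR (la * m0))%:E * P ev) <= (expR (2 * la * eta) * B)%:E)%E.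
    by apply: le_trans h; rewrite lee_wpmul2l// lee_fin expR_ge0.
  rewrite pE -!EFinM lee_fin mulrA -expRD mulrC -ler_pdivlMr ?expR_gt0//.
  move/le_trans; apply; rewrite /B /Et -expRN -!expRD ler_expR.
  rewrite le_eqVlt; apply/orP; left; apply/eqP.
  by rewrite /m0 mulrA las; field.
apply/ler_addgt0Pr => e e0.
have x1 : 1 < 1 + e / Et by rewrite ltrDl divr_gt0.
have l0 : 0 < ln (1 + e / Et) by rewrite ln_gt0.
have la20 : 0 < 2 * la by rewrite mulr_gt0.
(* With this margin exp(2 la eta) = 1 + e / Et, so the bound exceeds Et by exactly e. *)
have := key _ (divr_gt0 l0 la20).
rewrite (mulrC (2 * la)) divfK ?(gt_eqF la20)// lnK ?posrE ?(lt_trans _ x1)//.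
by rewrite mulrDl mul1r divfK ?gt_eqF.
Qed.

End bilinear_tail.

(** * The Euclidean norm and the Cauchy-Schwarz inequality *)

Section euclidean_facts.
Context {R : realType}.

Lemma norm2_ge0 n (u : 'cV[R]_n) : 0 <= norm2 u.
Proof. exact: sqrtr_ge0. Qed.

Lemma norm2_sqr n (u : 'cV[R]_n) : norm2 u ^+ 2 = dot u u.
Proof. by rewrite sqr_sqrtr// dot_ge0. Qed.

Lemma norm2_eq0 n (u : 'cV[R]_n) : norm2 u = 0 -> u = 0.
Proof.
move=> u0; have : dot u u = 0 by rewrite -norm2_sqr u0 expr0n.
move/eqP; rewrite psumr_eq0 => [/allP h|i _]; last by rewrite -expr2 sqr_ge0.
apply/colP => i; rewrite mxE; apply/eqP.
by have := h i (mem_index_enum i); rewrite implyTb -expr2 sqrf_eq0.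
Qed.

Lemma norm20 n : norm2 (0 : 'cV[R]_n) = 0.
Proof. by rewrite /norm2 /dot big1 ?sqrtr0// => i _; rewrite mxE mul0r. Qed.

Lemma norm2Z n (c : R) (u : 'cV[R]_n) : norm2 (c *: u) = `|c| * norm2 u.
Proof.
by rewrite /norm2 dotZl dotZr mulrA -expr2 sqrtrM ?sqr_ge0// sqrtr_sqr.
Qed.

Lemma dot_unit_normalize n (u : 'cV[R]_n) : norm2 u != 0 ->
  dot ((norm2 u)^-1 *: u) ((norm2 u)^-1 *: u) = 1.
Proof.
by move=> u0; rewrite dotZl dotZr -norm2_sqr; field.
Qed.

Lemma dot_le_norm2 n (u v : 'cV[R]_n) : dot u v <= norm2 u * norm2 v.
Proof.
have [u0|u0] := eqVneq (norm2 u) 0.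
  by rewrite u0 mul0r (norm2_eq0 u0) /dot big1// => i _; rewrite mxE mul0r.
have [v0|v0] := eqVneq (norm2 v) 0.
  by rewrite v0 mulr0 (norm2_eq0 v0) /dot big1// => i _; rewrite mxE mulr0.
have := dot_unit_le1 (dot_unit_normalize u0) (dot_unit_normalize v0).
rewrite dotZl dotZr mulrA -invfM mulrC ler_pdivrMr ?mul1r//.
by rewrite lt_neqAle eq_sym mulf_neq0//= mulr_ge0// norm2_ge0.
Qed.

Lemma norm2D n (u v : 'cV[R]_n) : norm2 (u + v) <= norm2 u + norm2 v.
Proof.
rewrite -(@ler_pXn2r _ 2) ?nnegrE ?addr_ge0 ?norm2_ge0// norm2_sqr.
rewrite dotDl !dotDr (dotC v u) sqrrD !norm2_sqr.
by have := dot_le_norm2 u v; lra.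
Qed.

Lemma norm2N n (u : 'cV[R]_n) : norm2 (- u) = norm2 u.
Proof. by rewrite -scaleN1r norm2Z normrN normr1 mul1r. Qed.

Lemma norm2_mulmx_le_of_dot l d (A : 'M[R]_(l, d)) (c : R) : 0 <= c ->
  (forall u v, dot u (A *m v) <= c * (norm2 u * norm2 v)) ->
  forall v, norm2 (A *m v) <= c * norm2 v.
Proof.
move=> c0 H v; have := H (A *m v) v; rewrite -norm2_sqr expr2.
have [->|n0] := eqVneq (norm2 (A *m v)) 0; first by rewrite mulr_ge0// norm2_ge0.
by rewrite mulrCA ler_pM2l// lt_neqAle eq_sym n0 norm2_ge0.
Qed.

End euclidean_facts.

Section matrix_continuity.
Context {R : realType}.

Lemma continuous_id_fun (T : topologicalType) : continuous (fun x : T => x).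
Proof. by move=> x; exact: cvg_id. Qed.

Lemma continuous_coords (T : topologicalType) m n (f : T -> 'M[R]_(m, n)) :
  (forall i j, continuous (fun x => f x i j)) -> continuous f.
Proof. by move=> H x; apply: cvg_mx => i j; exact: H. Qed.

Lemma continuous_entry (T : topologicalType) m n (f : T -> 'M[R]_(m, n)) i j :
  continuous f -> continuous (fun x => f x i j).
Proof.
move=> cf x; apply: (@continuous_comp _ _ _ f (fun M : 'M[R]_(m, n) => M i j)).
  exact: cf.
exact: coord_continuous.
Qed.

Lemma continuous_bigsum (T : topologicalType) (I : finType) (f : I -> T -> R) :
  (forall i, continuous (f i)) -> continuous (fun x => \sum_i f i x).
Proof.
move=> cf; rewrite (_ : (fun _ => _) = \sum_i f i); last by apply/funext => x; rewrite fct_sumE.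
elim/big_ind : _ => [|g h cg ch|i _]; [exact: cst_continuous| |exact: cf].
by move=> x; apply: cvgD; [exact: cg|exact: ch].
Qed.

Lemma continuous_mulmx (T : topologicalType) m n p
    (f : T -> 'M[R]_(m, n)) (g : T -> 'M[R]_(n, p)) :
  continuous f -> continuous g -> continuous (fun x => f x *m g x).
Proof.
move=> cf cg; apply: continuous_coords => i j.
under eq_fun do rewrite mxE.
apply: continuous_bigsum => k x.
by apply: cvgM; [exact: (continuous_entry cf)|exact: (continuous_entry cg)].
Qed.

Lemma continuous_dot (T : topologicalType) n (f g : T -> 'cV[R]_n) :
  continuous f -> continuous g -> continuous (fun x => dot (f x) (g x)).
Proof.
move=> cf cg; apply: continuous_bigsum => k x.
by apply: cvgM; [exact: (continuous_entry cf)|exact: (continuous_entry cg)].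
Qed.

Lemma continuous_norm2 (T : topologicalType) n (f : T -> 'cV[R]_n) :
  continuous f -> continuous (fun x => norm2 (f x)).
Proof.
move=> cf x; apply: (@continuous_comp _ _ _ (fun x => dot (f x) (f x)) Num.sqrt).
  exact: continuous_dot.
exact: sqrt_continuous.
Qed.

End matrix_continuity.

(** * Laws of random matrices *)

Section matrix_space.
Context {R : realType}.

(** A pi-system on which independence of the entries gives the law explicitly. *)
Definition mxrect m n : set (set 'M[R]_(m, n)) :=
  [set A | exists2 B : 'I_m -> 'I_n -> set R, (forall i j, measurable (B i j)) &
     A = [set M : 'M[R]_(m, n) | forall i j, B i j (M i j)]].

Definition mxspace m n : measurableType _ := g_sigma_algebraType (@mxrect m n).

Lemma measurable_mxspace d (T : measurableType d) m n (X : T -> 'M[R]_(m, n)) :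
  (forall i j, measurable_fun setT (entry X i j)) ->
  measurable_fun setT (X : T -> mxspace m n).
Proof.
move=> mX; apply: (@measurability _ _ _ (mxspace m n) _ _ (@mxrect m n)) => //.
move=> _ [_ [B mB ->] <-]; rewrite setTI.
rewrite (_ : _ @^-1` _ = \bigcap_(ij in [set: 'I_m * 'I_n]) (entry X ij.1 ij.2 @^-1` B ij.1 ij.2)).
  apply: fin_bigcap_measurable => // -[i j] _; rewrite -[X in measurable X]setTI.
  exact: mX.
by apply/seteqP; split => w /= H => [ij _|i j]; [exact: H|exact: (H (i, j))].
Qed.

Lemma measurable_mxspace_entry m n i j :
  measurable_fun setT (fun M : mxspace m n => (M : 'M[R]_(m, n)) i j).
Proof.
move=> _ B mB; rewrite setTI; apply: sub_sigma_algebra.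
exists (fun i' j' => if (i' == i) && (j' == j) then B else setT).
  by move=> i' j'; case: ifP.
apply/seteqP; split => M /=; first by move=> BM i' j'; case: ifP => // /andP[/eqP-> /eqP->].
by move=> /(_ i j); rewrite !eqxx.
Qed.

Lemma measurable_mxspace_continuous m n (g : 'M[R]_(m, n) -> R) : continuous g ->
  measurable_fun setT (g : mxspace m n -> R).
Proof.
move=> cg; apply: (@measurable_continuous_mx _ _ (mxspace m n) m n id) => //.
by move=> i j; exact: measurable_mxspace_entry.
Qed.

(** Finite measures that agree on a generating pi-system are equal; rectangles are closed under
    intersection. *)
Lemma mxrect_law_unique m n d1 (T1 : measurableType d1) (P1 : probability T1 R)
    (S1 : T1 -> 'M[R]_(m, n)) d2 (T2 : measurableType d2) (P2 : probability T2 R)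
    (S2 : T2 -> 'M[R]_(m, n)) :
  (forall i j, measurable_fun setT (entry S1 i j)) ->
  (forall i j, measurable_fun setT (entry S2 i j)) ->
  (forall B : 'I_m -> 'I_n -> set R, (forall i j, measurable (B i j)) ->
     P1 [set w | forall i j, B i j (S1 w i j)] =
     P2 [set w | forall i j, B i j (S2 w i j)]) ->
  forall A : set (mxspace m n), measurable A -> P1 (S1 @^-1` A) = P2 (S2 @^-1` A).
Proof.
move=> mS1 mS2 H.
have m1 := measurable_mxspace mS1; have m2 := measurable_mxspace mS2.
pose g1 : T1 -> mxspace m n := S1; pose g2 : T2 -> mxspace m n := S2.
pose f1 : {mfun T1 >-> mxspace m n} := HB.pack g1 (isMeasurableFun.Build _ _ _ _ g1 m1).
pose f2 : {mfun T2 >-> mxspace m n} := HB.pack g2 (isMeasurableFun.Build _ _ _ _ g2 m2).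
move=> A mA.
apply: (@measure_unique _ R (mxspace m n) (@mxrect m n) (fun=> setT) _ _ _ _
  (distribution P1 f1) (distribution P2 f2)) => //.
- move=> _ _ [B mB ->] [C mC ->]; exists (fun i j => B i j `&` C i j).
    by move=> i j; exact: measurableI.
  by apply/seteqP; split => M /= => [[h1 h2] i j|h]; [split|split=> i j; have [] := h i j].
- move=> _; exists (fun _ _ => setT) => //.
  by apply/seteqP; split.
- by rewrite bigcup_const.
- by move=> _ [B mB ->]; exact: H.
- move=> _; have : (P1 setT < +oo)%E by rewrite probability_setT ltry.
  exact.
Qed.

End matrix_space.

(** * From countably many bilinear forms to the operator norm *)

Section operator_norm_tail.
Context {R : realType}.
Variables (l d : nat).
Hypotheses (l_gt0 : (0 < l)%N) (d_gt0 : (0 < d)%N).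

(** Zero is sent to a basis vector, because the comparison requires every vector of the family to be
    a unit vector. *)
Definition normalize n (n_gt0 : (0 < n)%N) (u : 'cV[R]_n) : 'cV[R]_n :=
  if norm2 u == 0 then delta_mx (Ordinal n_gt0) 0 else (norm2 u)^-1 *: u.

Lemma dot_normalize n (n_gt0 : (0 < n)%N) (u : 'cV[R]_n) :
  dot (normalize n_gt0 u) (normalize n_gt0 u) = 1.
Proof.
rewrite /normalize; case: ifPn => [_|]; last exact: dot_unit_normalize.
rewrite /dot (bigD1 (Ordinal n_gt0))//= big1 => [|i /negPf ni].
  by rewrite mxE !eqxx mulr1 addr0.
by rewrite mxE ni mul0r.
Qed.

(** A single index enumerates all pairs of grid points, as in the Gaussian comparison, where u_i and
    v_i share their index. Codes that decode to nothing yield zero vectors. *)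
Definition grid_pair (i : nat) : (nat * 'cV[int]_l) * (nat * 'cV[int]_d) :=
  odflt ((0%N, 0), (0%N, 0)) (unpickle i).

Definition uvec (i : nat) : 'cV[R]_l :=
  normalize l_gt0 (grid_mx (grid_pair i).1.1 (grid_pair i).1.2).

Definition vvec (i : nat) : 'cV[R]_d :=
  normalize d_gt0 (grid_mx (grid_pair i).2.1 (grid_pair i).2.2).

(** Homogeneity removes the normalization at grid points; density is then used once in each
    variable. *)
Lemma bilinear_bound_of_grid (A : 'M[R]_(l, d)) (c : R) : 0 <= c ->
  (forall i, dot (uvec i) (A *m vvec i) <= c) ->
  forall u v, dot u (A *m v) <= c * (norm2 u * norm2 v).
Proof.
move=> c0 H.
have G k q k' q' : dot (grid_mx k q) (A *m grid_mx k' q') <=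
    c * (norm2 (grid_mx k q) * norm2 (grid_mx k' q')).
  have := H (pickle ((k, q), (k', q'))).
  rewrite /uvec /vvec /grid_pair pickleK /= /normalize.
  case: ifPn => [/eqP u0 _|u0].
    by rewrite u0 mul0r mulr0 (norm2_eq0 u0) /dot big1// => i _; rewrite mxE mul0r.
  case: ifPn => [/eqP v0 _|v0].
    by rewrite v0 !mulr0 (norm2_eq0 v0) mulmx0 /dot big1// => i _; rewrite !mxE mulr0.
  rewrite -scalemxAr dotZl dotZr mulrA -invfM mulrC ler_pdivrMr//.
  by rewrite lt_neqAle eq_sym mulf_neq0//= mulr_ge0// norm2_ge0.
have cc (n : nat) (w : R) : continuous (fun u : 'cV[R]_n => w * norm2 u).
  move=> u; apply: (@continuous_comp _ _ _ (fun u : 'cV[R]_n => norm2 u) (fun x => w * x)).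
    exact: (continuous_norm2 (@continuous_id_fun _)).
  exact: mulrl_continuous.
move=> u v; apply: (@grid_mx_dense_le _ _ _ (fun u => dot u (A *m v)) (fun u => c * (norm2 u * norm2 v))).
- by apply: continuous_dot; [exact: continuous_id_fun|exact: cst_continuous].
- under eq_fun do rewrite (mulrC (norm2 _)) mulrA.
  exact: cc.
- move=> k q; apply: (@grid_mx_dense_le _ _ _ (fun v => dot (grid_mx k q) (A *m v)) (fun v => c * (norm2 (grid_mx k q) * norm2 v))) => //.
  + apply: continuous_dot; first exact: cst_continuous.
    by apply: continuous_mulmx; [exact: cst_continuous|exact: continuous_id_fun].
  + under eq_fun do rewrite mulrA.
    exact: cc.
Qed.

Lemma measurable_bilinear_le (n : nat) (c : R) :
  measurable [set A : mxspace l d | forall i, (i < n)%N ->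
     dot (uvec i) ((A : 'M[R]_(l, d)) *m vvec i) < c].
Proof.
rewrite (_ : [set _ | _] = \bigcap_(i in [set i | (i < n)%N])
   ((fun A : mxspace l d => dot (uvec i) ((A : 'M[R]_(l, d)) *m vvec i)) @^-1` [set` `]-oo, c[ ])).
  apply: bigcap_measurableType => i _; rewrite -[X in measurable X]setTI.
  apply: (@measurable_mxspace_continuous _ _ _ (fun A : 'M[R]_(l, d) => dot (uvec i) (A *m vvec i))) => //.
  apply: continuous_dot; first exact: cst_continuous.
  by apply: continuous_mulmx; [exact: continuous_id_fun|exact: cst_continuous].
apply/seteqP; split => A /= H i /=; first by move=> ni; rewrite in_itv/= H.
by move=> ni; have := H i ni; rewrite /= in_itv.
Qed.

End operator_norm_tail.

Section scaled_gaussian_norm.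
Context {R : realType}.

Definition norm_bounded l d (c : R) : set (mxspace l d) :=
  [set A : mxspace l d | forall v, norm2 ((A : 'M[R]_(l, d)) *m v) <= c * norm2 v].

(** Transfers estimates proved on an auxiliary product space to the given sketch. On a rectangle
    both probabilities are products over the entries; for X this is [gfam_prod] applied to
    indicators. *)
Lemma scaled_gaussian_law l d (s : R) : s = Num.sqrt l%:R^-1 ->
  forall d1 (T1 : measurableType d1) (P : probability T1 R) (X : 'I_l * 'I_d -> T1 -> R)
  d2 (T2 : measurableType d2) (Q : probability T2 R) (S : T2 -> 'M[R]_(l, d)),
  gaussian_family s P X -> scaled_gaussian Q S ->
  forall A : set (mxspace l d), measurable A ->
    Q (S @^-1` A) = P ((fun w => \matrix_(i, j) X (i, j) w) @^-1` A).
Proof.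
move=> sE d1 T1 P X d2 T2 Q S gX [mS lS iS].
have mX i j : measurable_fun setT (entry (fun w => \matrix_(i, j) X (i, j) w) i j).
  rewrite (_ : entry _ _ _ = X (i, j)); first exact: gfam_measurable gX (i, j).
  by apply/funext => w; rewrite /entry mxE.
apply: mxrect_law_unique => // B mB.
rewrite iS//.
pose psi (p : 'I_l * 'I_d) (z : R) : R := \1_(B p.1 p.2) z.
pose N : probability _ R := normal_prob 0 s.
pose q (p : 'I_l * 'I_d) := fine (N (B p.1 p.2)).
have mpsi p : measurable_fun setT (psi p) by exact: measurable_indic.
have psi0 p z : 0 <= psi p z by rewrite /psi indicE.
have psiq p : (\int[normal_prob 0 s]_z (psi p z)%:E = (q p)%:E)%E.
  have := @integral_indic _ _ R N setT measurableT (B p.1 p.2) (mB _ _).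
  move=> h; rewrite /q fineK; last exact: (fin_num_measure N _ (mB _ _)).
  by apply: (eq_trans h); rewrite setIT.
have := gfam_prod gX mpsi psi0 psiq.
have -> : (fun w => (\prod_i psi i (X i w))%:E) = (fun w =>
   (\1_[set w | forall i j, B i j ((\matrix_(i, j) X (i, j) w) i j)] w)%:E).
  apply/funext => w; congr EFin; rewrite indicE.
  have [|nin] := boolP (w \in _).
    rewrite inE => H; apply: big1 => -[i j] _; rewrite /psi indicE mem_set//.
    by have := H i j; rewrite mxE.
  have [[i j] nB] : exists p : 'I_l * 'I_d, ~ B p.1 p.2 (X p w).
    apply/existsNP => H; move/negP: nin; apply; rewrite inE => i j.
    by rewrite mxE; exact: (H (i, j)).
  by rewrite (bigD1 (i, j))//= /psi indicE memNset// mul0r.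
rewrite integral_indic//; last first.
  rewrite (_ : [set w | _] = \bigcap_(ij in [set: 'I_l * 'I_d]) (entry (fun w => \matrix_(i, j) X (i, j) w) ij.1 ij.2 @^-1` B ij.1 ij.2)).
    apply: fin_bigcap_measurable => // -[i j] _; rewrite -[X in measurable X]setTI.
    exact: mX.
  by apply/seteqP; split => w /= H => [ij _|i j]; [exact: H|exact: (H (i, j))].
rewrite setIT => ->.
rewrite pair_bigA /= (big_morph (@EFin R) (@EFinM R) erefl); apply: eq_bigr => -[i j] _ /=.
have := lS i j (B i j) (mB i j); rewrite -sE => h.
by apply: (eq_trans h); rewrite /q fineK//; exact: (fin_num_measure N _ (mB _ _)).
Qed.

(** The finite families of grid pairs give decreasing events, each of probability at least the
    stated bound, and continuity from above carries it to their intersection E. A measurable subset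
    of [norm_bounded] is produced because the latter quantifies over uncountably many vectors. *)
Lemma scaled_gaussian_norm_tail l d (t : R) dT (T : measurableType dT)
    (Q : probability T R) (S : T -> 'M[R]_(l, d)) : (0 < l)%N -> 0 < t ->
  scaled_gaussian Q S ->
  exists2 E : set (mxspace l d), measurable E &
    E `<=` norm_bounded (1 + (Num.sqrt d%:R + t) / Num.sqrt l%:R) /\
    ((1 - expR (- (t ^+ 2 / 2)))%:E <= Q (S @^-1` E))%E.
Proof.
(* Dimension 0 contains no unit vector and is settled by taking the whole space. *)
move=> l0 t0 gS; case: (posnP d) => [d00|d0].
  subst d; exists setT => //; split.
    by move=> A _ v; rewrite (flatmx0 v) mulmx0 !norm20 mulr0.
  by rewrite preimage_setT probability_setT lee_fin gerBl expR_ge0.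
pose s : R := Num.sqrt l%:R^-1.
have s0 : 0 < s by rewrite sqrtr_gt0 invr_gt0 ltr0n.
have [d1 [T1 [P [X gX]]]] := gaussian_family_exists s (('I_l * 'I_d)%type : finType).
pose c := s * (Num.sqrt l%:R + Num.sqrt d%:R + t).
have cE : c = 1 + (Num.sqrt d%:R + t) / Num.sqrt l%:R.
  rewrite /c /s sqrtrV ?ler0n//; field.
  by rewrite gt_eqF// sqrtr_gt0 ltr0n.
pose G n := [set A : mxspace l d | forall i, (i < n)%N ->
     dot (uvec d l0 i) ((A : 'M[R]_(l, d)) *m vvec l d0 i) < c].
have mG n : measurable (G n) by exact: measurable_bilinear_le.
pose X' w : 'M[R]_(l, d) := \matrix_(i, j) X (i, j) w.
have QP := scaled_gaussian_law erefl gX gS.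
have mX' : measurable_fun setT (X' : T1 -> mxspace l d).
  apply: measurable_mxspace => i j.
  rewrite (_ : entry _ _ _ = X (i, j)); first exact: gfam_measurable gX (i, j).
  by apply/funext => w; rewrite /entry mxE.
have mS : measurable_fun setT (S : T -> mxspace l d).
  by apply: measurable_mxspace; case: gS.
have mSG n : measurable (S @^-1` G n).
  by rewrite -[X in measurable X]setTI; exact: mS.
have PG n : ((1 - expR (- (t ^+ 2 / 2)))%:E <= Q (S @^-1` G n.+1))%E.
  rewrite QP//.
  have mpre : measurable (X' @^-1` G n.+1).
    by rewrite -[X in measurable X]setTI; exact: mX'.
  have := bilinear_tail s0 l0 d0 (u := fun i : 'I_n.+1 => uvec d l0 i)
     (v := fun i : 'I_n.+1 => vvec l d0 i) (fun i => dot_normalize _ _)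
     (fun i => dot_normalize _ _) t0 gX.
  rewrite (_ : [set w | _] = ~` (X' @^-1` G n.+1)).
    rewrite probability_setC// -(fineK (fin_num_measure P _ mpre)) -EFinB !lee_fin.
    by move: (fine _) (expR _) => x y; lra.
  have E w i j : \sum_p X p w * (uvec d l0 i p.1 0 * vvec l d0 j p.2 0) =
      dot (uvec d l0 i) (X' w *m vvec l d0 j) :> R.
    rewrite /dot; under [RHS]eq_bigr do rewrite mxE mulr_sumr.
    rewrite pair_big /=; apply: eq_big => [//|[p q] _ /=].
    by rewrite mxE; ring.
  apply/seteqP; split => w /=.
    by move=> [i hi] /(_ i (ltn_ord i)); rewrite -E ltNge => /negP; exact.
  move=> /existsNP[i /not_implyP[ni /negP]]; rewrite -leNgt => hi.
  by exists (Ordinal ni); rewrite E.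
have c0 : 0 <= c by rewrite cE addr_ge0// divr_ge0 ?sqrtr_ge0// addr_ge0 ?sqrtr_ge0// ltW.
pose E : set (mxspace l d) := \bigcap_n G n.+1.
have SE : S @^-1` E = \bigcap_n (S @^-1` G n.+1) by rewrite preimage_bigcap.
exists E; first exact: bigcapT_measurable.
split.
  move=> A EA; rewrite -cE => v.
  apply: norm2_mulmx_le_of_dot => //.
  apply: (@bilinear_bound_of_grid R l d l0 d0 (A : 'M[R]_(l, d)) c c0) => i.
  exact: (ltW (EA i Logic.I i (ltnSn i))).
rewrite SE; have := @nonincreasing_cvg_mu _ _ _ Q (fun n => S @^-1` G n.+1).
have -> : (Q (S @^-1` G 1%N) < +oo)%E by rewrite ltey_eq fin_num_measure.
move=> /(_ isT (fun n => mSG n.+1)) h.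
have mI : measurable (\bigcap_n (S @^-1` G n.+1)) by exact: bigcapT_measurable.
have {h} h := h mI.
have nd : {homo (fun n => S @^-1` G n.+1) : n m / (n <= m)%N >-> (m <= n)%O}.
  move=> n m nm; apply/subsetPset => w /= H i ni; apply: H.
  exact: (leq_trans ni).
have {h} h := h nd.
rewrite -(cvg_lim _ h)//; apply: lime_ge.
  by apply/cvg_ex; exists (Q (\bigcap_n (S @^-1` G n.+1))).
by apply: nearW => n; exact: PG.
Qed.

End scaled_gaussian_norm.

(** * Sketches independent of the past *)

Section freezing.
Context {R : realType} {d : measure_display} {T : measurableType d}.
Variables (P : probability T R) (G : set (set T)).
Hypotheses (sG : sigma_algebra setT G) (mG : G `<=` measurable).

(** The same points with G as measurable structure: being adapted to G becomes ordinary
    measurability. *)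
Definition sub_space (G : set (set T)) : measurableType _ := g_sigma_algebraType G.

Lemma measurable_sub_space (A : set (sub_space G)) : measurable A <-> G A.
Proof. by rewrite /measurable/= sigma_algebra_id. Qed.

Lemma measurable_to_sub_space d' (T' : measurableType d') (f : T' -> T) :
  (forall A, G A -> measurable (f @^-1` A)) -> measurable_fun setT (f : T' -> sub_space G).
Proof. by move=> H _ A /measurable_sub_space GA; rewrite setTI; exact: H. Qed.

Variables (d2 : measure_display) (T2 : measurableType d2) (Y : T -> T2).
Hypotheses (mY : measurable_fun setT Y).
Hypothesis indep : forall A B, G A -> measurable B ->
  P (A `&` Y @^-1` B) = (P A * P (Y @^-1` B))%E.

(* By independence, w |-> (w, Y w) carries P to the product of P restricted to [G]
   and the law of [Y]. *)
Lemma freezing (E : set (sub_space G * T2)) (p : R) : 0 <= p -> measurable E ->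
  (forall w, (p%:E <= P (Y @^-1` (xsection E w)))%E) ->
  forall A, G A -> (p%:E * P A <= P (A `&` [set w | E (w, Y w)]))%E.
Proof.
move=> p0 mE HE A GA.
pose i1 : T -> sub_space G := fun w => w.
pose ph : T -> (sub_space G * T2)%type := fun w => (i1 w, Y w).
have mi1 : measurable_fun setT i1.
  by apply: measurable_to_sub_space => B GB; exact: mG.
have mph : measurable_fun setT ph by exact: measurable_fun_pair.
pose f1 : {mfun T >-> sub_space G} := HB.pack i1 (isMeasurableFun.Build _ _ _ _ i1 mi1).
pose fY : {mfun T >-> T2} := HB.pack Y (isMeasurableFun.Build _ _ _ _ Y mY).
pose fp : {mfun T >-> (sub_space G * T2)%type} := HB.pack ph (isMeasurableFun.Build _ _ _ _ ph mph).
have rect (B : set (sub_space G)) (C : set T2) : measurable B -> measurable C ->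
    distribution P fp (B `*` C) = (distribution P f1 B * distribution P fY C)%E.
  by move=> /measurable_sub_space GB mC; exact: indep.
have mAT : measurable (A `*` [set: T2] : set (sub_space G * T2)).
  by apply: measurableX => //; exact/measurable_sub_space.
have mAE : measurable (A `*` [set: T2] `&` E : set (sub_space G * T2)).
  exact: measurableI.
have -> : P (A `&` [set w | E (w, Y w)]) = distribution P fp (A `*` [set: T2] `&` E).
  by rewrite /distribution/pushforward; congr (P _); apply/seteqP; split => w /=; [move=> [? ?]|move=> [[? _] ?]].
rewrite -(product_measure_unique rect mAE) /product_measure1.
have mA : measurable (A : set (sub_space G)) by exact/measurable_sub_space.
have m1 : measurable_fun setT (fun w : sub_space G => (\1_(A : set (sub_space G)) w)%:E : \bar R).
  by apply/measurable_EFinP; exact: measurable_indic.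
have -> : (p%:E * P A)%E = (\int[distribution P f1]_w (p%:E * (\1_(A : set (sub_space G)) w)%:E))%E.
  rewrite ge0_integralZl_EFin//.
  by rewrite integral_indic// setIT.
apply: ge0_le_integral => //.
- by move=> w _; rewrite mule_ge0// lee_fin.
- exact: measurable_funeM.
- exact: measurable_fun_xsection.
- move=> w _ /=; have [wA|wA] := boolP (w \in (A : set (sub_space G))).
    rewrite xsectionI in_xsectionX// setTI indicE wA mule1; exact: HE.
  by rewrite indicE (negPf wA) mule0.
Qed.

End freezing.

Section continuous_arithmetic.
Context {R : realType} (T : topologicalType).
Implicit Types f g : T -> R.

Lemma continuous_addr f g : continuous f -> continuous g -> continuous (fun x => f x + g x).
Proof. by move=> cf cg x; apply: cvgD; [exact: cf|exact: cg]. Qed.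

Lemma continuous_subr f g : continuous f -> continuous g -> continuous (fun x => f x - g x).
Proof. by move=> cf cg x; apply: cvgB; [exact: cf|exact: cg]. Qed.

Lemma continuous_mulr f g : continuous f -> continuous g -> continuous (fun x => f x * g x).
Proof. by move=> cf cg x; apply: cvgM; [exact: cf|exact: cg]. Qed.

Lemma continuous_scaler (c : R) f : continuous f -> continuous (fun x => c * f x).
Proof. by move=> cf; apply: continuous_mulr => //; exact: cst_continuous. Qed.

End continuous_arithmetic.

(** * Measurability and conditional probability of a true iteration *)

Section sketch_event.
Context {R : realType}.
Variables (l d m : nat).

(** The two matrices are packed side by side, as [M | A^T], so that measurability follows from
    continuity in a single matrix argument. *)
Lemma continuous_sketch_gap (z : 'cV[R]_m) (e : R) :
  continuous (fun B : 'M[R]_(d, m + l) =>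
    (1 - e) * norm2 (lsubmx B *m z) ^+ 2 - norm2 ((rsubmx B)^T *m (lsubmx B *m z)) ^+ 2).
Proof.
have cl : continuous (fun B : 'M[R]_(d, m + l) => lsubmx B).
  apply: continuous_coords => i j; under eq_fun do rewrite mxE.
  exact: (continuous_entry (@continuous_id_fun _)).
have cr : continuous (fun B : 'M[R]_(d, m + l) => (rsubmx B)^T).
  apply: continuous_coords => i j; under eq_fun do rewrite !mxE.
  exact: (continuous_entry (@continuous_id_fun _)).
have cz : continuous (fun B : 'M[R]_(d, m + l) => lsubmx B *m z).
  by apply: continuous_mulmx => //; exact: cst_continuous.
under eq_fun do rewrite !norm2_sqr.
apply: continuous_subr; first by apply: continuous_scaler; exact: continuous_dot.
by apply: continuous_dot; exact: continuous_mulmx.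
Qed.

Lemma measurable_sketch_gap d1 (T1 : measurableType d1) (M : T1 -> 'M[R]_(d, m))
    (A : T1 -> 'M[R]_(l, d)) (e : R) (z : 'cV[R]_m) :
  (forall i j, measurable_fun setT (entry M i j)) ->
  (forall i j, measurable_fun setT (entry A i j)) ->
  measurable [set w | (1 - e) * norm2 (M w *m z) ^+ 2 <= norm2 (A w *m M w *m z) ^+ 2].
Proof.
move=> mM mA.
have mX : forall i j, measurable_fun setT (entry (fun w => row_mx (M w) (A w)^T) i j).
  move=> i j; rewrite -(splitK j); case: (fintype.split j) => k /=.
    rewrite (_ : entry _ _ _ = entry M i k)//.
    by apply/funext => w; rewrite /entry row_mxEl.
  rewrite (_ : entry _ _ _ = entry A k i)//.
  by apply/funext => w; rewrite /entry row_mxEr mxE.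
have := measurable_continuous_mx mX (@continuous_sketch_gap z e).
move=> /(_ measurableT `]-oo, 0]%classic (measurable_itv _)).
rewrite setTI; congr measurable; apply/seteqP; split => w /=;
  by rewrite in_itv/= row_mxKl row_mxKr trmxK mulmxA subr_le0.
Qed.

(** Turns the uncountable intersection over z into a countable one, hence into a measurable
    event. *)
Lemma embedding_of_grid (M : 'M[R]_(d, m)) (A : 'M[R]_(l, d)) (e : R) :
  (forall k q, (1 - e) * norm2 (M *m grid_mx k q) ^+ 2 <= norm2 (A *m M *m grid_mx k q) ^+ 2) ->
  forall z, (1 - e) * norm2 (M *m z) ^+ 2 <= norm2 (A *m M *m z) ^+ 2.
Proof.
have cq p (B : 'M[R]_(p, m)) : continuous (fun z : 'cV[R]_m => norm2 (B *m z) ^+ 2).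
  under eq_fun do rewrite norm2_sqr.
  by apply: continuous_dot; apply: continuous_mulmx;
    [exact: cst_continuous|exact: continuous_id_fun|exact: cst_continuous|exact: continuous_id_fun].
apply: grid_mx_dense_le; last exact: cq.
by apply: continuous_scaler; exact: cq.
Qed.

End sketch_event.

Lemma countable_bigcapT_measurable d (T : measurableType d) (U : countType) (F : U -> set T) :
  (forall i, measurable (F i)) -> measurable (\bigcap_i F i).
Proof.
move=> mF; rewrite -(setCK (\bigcap_i F i)) setC_bigcap; apply: measurableC.
by apply: countable_bigcupT_measurable => [|i]; [exact: countableP|exact: measurableC].
Qed.

Section sketch_probability.
Context {R : realType} {dT : measure_display} {T : measurableType dT}.

Lemma probabilityI_ge (P : probability T R) (A B : set T) (a b : R) :
  measurable A -> measurable B ->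
  ((1 - a)%:E <= P A)%E -> ((1 - b)%:E <= P B)%E -> ((1 - (a + b))%:E <= P (A `&` B))%E.
Proof.
move=> mA mB hA hB.
have mI : measurable (A `&` B) by exact: measurableI.
have : (P (~` (A `&` B)) <= P (~` A) + P (~` B))%E.
  rewrite setCI; exact: (measureU2 _ (measurableC mA) (measurableC mB)).
rewrite !probability_setC//; move: hA hB.
rewrite -(fineK (fin_num_measure P _ mA)) -(fineK (fin_num_measure P _ mB)).
rewrite -(fineK (fin_num_measure P _ mI)) -!EFinB -EFinD !lee_fin; lra.
Qed.

Lemma mx_measurable_wrtP (G : set (set T)) m n (M : T -> 'M[R]_(m, n)) :
  sigma_algebra setT G -> mx_measurable_wrt G M ->
  forall i j, measurable_fun setT (entry M i j : sub_space G -> R).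
Proof.
by move=> sG mM i j _ B mB; rewrite setTI; apply/(measurable_sub_space sG); exact: mM.
Qed.

(** Independence of the sketch is assumed on the sigma-algebra of its entries; this extends it to
    all events determined by the whole matrix. *)
Lemma sigma_mx_preimage m n (S : T -> 'M[R]_(m, n)) (B : set (mxspace m n)) :
  measurable B -> sigma_mx S (S @^-1` B).
Proof.
move=> mB.
have mS : forall i j, measurable_fun setT (entry S i j : g_sigma_algebraType
    [set A | exists i j, exists2 B : set R, measurable B & A = entry S i j @^-1` B] -> R).
  move=> i j _ C mC; rewrite setTI; apply: sub_sigma_algebra.
  by exists i, j, C.
by have := measurable_mxspace mS measurableT mB; rewrite setTI.
Qed.

Variables (P : probability T R) (l d r : nat) (Cl : R).
Hypotheses (Cl_emb : embedding_constant Cl)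
  (l_def : l%:R = 4 * Cl * (ln 16 + r%:R + 1)).

(** E is a joint event in the past and the sketch, evaluated at (w, S w). For a frozen past, M w is
    a fixed matrix to which the embedding constant applies, and a union bound gives 1 - 1/16 - 1/16
    = 7/8; [freezing] makes this conditional. The first clause places E in any larger sigma-algebra
    that makes S measurable, in particular the next one of the filtration. *)
Lemma sketch_event_exists (G : set (set T)) (S : T -> 'M[R]_(l, d))
    (M : T -> 'M[R]_(d, d.+1)) :
  sigma_algebra setT G -> G `<=` measurable -> scaled_gaussian P S ->
  independent_families P G (sigma_mx S) -> mx_measurable_wrt G M ->
  (forall w, (\rank (M w) <= r.+1)%N) ->
  exists E : set T, [/\
    forall G', sigma_algebra setT G' -> G `<=` G' -> mx_measurable_wrt G' S -> G' E,
    forall w v, E w -> norm2 (S w *m v) <= S_max Cl d r * norm2 v,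
    forall w z, E w -> (1 - 1 / 2) * norm2 (M w *m z) ^+ 2 <= norm2 (S w *m M w *m z) ^+ 2 &
    forall A, G A -> ((7 / 8)%:E * P A <= P (A `&` E))%E].
Proof.
move=> sG mG gS iGS mM rM.
have ln16 : 0 < ln 16 :> R by rewrite ln_gt0// ltr1n.
have Cl0 : 0 < Cl by case: Cl_emb.
have l0 : (0 < l)%N.
  by rewrite -(ltr0n R) l_def !mulr_gt0// addr_gt0// ltr_wpDr.
have t0 : 0 < Num.sqrt (2 * ln 16) :> R by rewrite sqrtr_gt0 mulr_gt0.
have [EN mEN [ENn PEN]] := scaled_gaussian_norm_tail l0 t0 gS.
have mS i j : measurable_fun setT (entry S i j) by case: gS.
have mSS : measurable_fun setT (S : T -> mxspace l d) by exact: measurable_mxspace.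
pose E2 : set (sub_space G * mxspace l d) :=
  (snd @^-1` EN) `&` \bigcap_(i in [set: nat * 'cV[int]_(d.+1)])
   [set p | (1 - 1 / 2) * norm2 (M p.1 *m grid_mx i.1 i.2 : 'cV[R]_d) ^+ 2 <=
            norm2 ((p.2 : 'M[R]_(l, d)) *m M p.1 *m grid_mx i.1 i.2) ^+ 2].
have mE2 : measurable E2.
  apply: measurableI; first by rewrite -[X in measurable X]setTI; exact: measurable_snd.
  apply: countable_bigcapT_measurable => -[k q] /=; apply: measurable_sketch_gap => i j.
    apply: (measurableT_comp (mx_measurable_wrtP sG mM i j)).
    exact: measurable_fst.
  apply: (measurableT_comp (@measurable_mxspace_entry R l d i j)).
  exact: measurable_snd.
have E2P w : E2 (w, S w) -> EN (S w) /\ forall z,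
    (1 - 1 / 2) * norm2 (M w *m z) ^+ 2 <= norm2 (S w *m M w *m z) ^+ 2.
  move=> [/= h1 h2]; split => // z; apply: embedding_of_grid => k q.
  exact: (h2 (k, q)).
exists [set w | E2 (w, S w)]; split.
- move=> G' sG' GG' mS'.
  have m1 : measurable_fun setT ((fun w => w) : sub_space G' -> sub_space G).
    by apply: measurable_to_sub_space => // A GA; apply/(measurable_sub_space sG'); exact: GG'.
  have m2 : measurable_fun setT (S : sub_space G' -> mxspace l d).
    by apply: measurable_mxspace => i j; exact: mx_measurable_wrtP.
  apply/(measurable_sub_space sG').
  have := measurable_fun_pair m1 m2 measurableT mE2.
  by rewrite setTI.
- move=> w v /E2P[/ENn/(_ v) h _]; apply: (le_trans h).
  by rewrite /S_max -l_def.
- by move=> w z /E2P[_]; exact.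
have iGSp A (B : set (mxspace l d)) : G A -> measurable B ->
    P (A `&` S @^-1` B) = (P A * P (S @^-1` B))%E.
  by move=> GA mB; apply: iGS => //; exact: sigma_mx_preimage.
have p0 : 0 <= 7 / 8 :> R by lra.
apply: (freezing sG mG mSS iGSp p0 mE2) => w.
have mT i : measurable (S @^-1` xsection E2 w).
  by rewrite -[X in measurable X]setTI; apply: mSS => //; exact: measurable_xsection.
pose H := [set w' | forall z : 'cV[R]_(d.+1),
  (1 - 1 / 2) * norm2 (M w *m z) ^+ 2 <= norm2 (S w' *m M w *m z) ^+ 2].
have PH : ((1 - 1 / 16)%:E <= P H)%E.
  have e12 : 0 < (1 / 2 : R) < 1 by apply/andP; split; lra.
  have [_ emb] := Cl_emb.
  have := emb _ _ _ _ _ e12 (rM w) _ _ _ _ gS; rewrite -/H.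
  (* The factor 4 in the sketch dimension cancels the square of the distortion 1/2, which leaves a
     failure probability of 1/16. *)
  suff -> : - (l%:R * (1 / 2) ^+ 2 / Cl) + r%:R + 1 = - ln (16 : R).
    by rewrite expRN lnK ?posrE// div1r.
  by rewrite l_def; field; rewrite gt_eqF.
have HE : S @^-1` xsection E2 w = S @^-1` EN `&` H.
  rewrite /H; apply/seteqP; split => w' /=.
    rewrite /xsection/= inE => -[/= h1 h2]; split => // z.
    by apply: embedding_of_grid => k q; exact: (h2 (k, q)).
  by rewrite /xsection/= inE => -[h1 h2]; split => //= -[k q] _ /=; exact: h2.
rewrite HE (_ : 7 / 8 = 1 - (1 / 16 + 1 / 16)); last by lra.
apply: probabilityI_ge => //.
- by rewrite -[X in measurable X]setTI; exact: mSS.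
- rewrite (_ : H = \bigcap_(i in [set: nat * 'cV[int]_(d.+1)])
   [set w' | (1 - 1 / 2) * norm2 (M w *m grid_mx i.1 i.2 : 'cV[R]_d) ^+ 2 <=
            norm2 (S w' *m M w *m grid_mx i.1 i.2) ^+ 2]).
    apply: countable_bigcapT_measurable => -[k q] /=; apply: (@measurable_sketch_gap _ _ _ _ _ _ (fun=> M w)) => // i j.
    exact: measurable_cst.
  apply/seteqP; split => w' /= h; first by move=> [k q] _ /=; exact: h.
  by apply: embedding_of_grid => k q; exact: (h (k, q)).
- have : (1 - expR (- (Num.sqrt (2 * ln 16) ^+ 2 / 2)) = 1 - 1 / 16 :> R).
    rewrite sqr_sqrtr ?mulr_ge0 ?(ltW ln16)// mulrAC divff ?mul1r//.
    by rewrite expRN lnK ?posrE// div1r.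
  by move=> <-.
Qed.

End sketch_probability.

(** * One iteration *)

Section operator_norm.
Context {R : realType}.

Lemma dot_norm2_le n (u v : 'cV[R]_n) : dot u v ^+ 2 <= dot u u * dot v v.
Proof.
rewrite -!norm2_sqr -exprMn -[X in X <= _]real_normK ?num_real//.
rewrite ler_pXn2r ?nnegrE ?mulr_ge0 ?norm2_ge0//.
rewrite ler_norml dot_le_norm2 andbT lerNl.
by rewrite -mulN1r -dotZl scaleN1r -(norm2N u) dot_le_norm2.
Qed.

(** Cauchy-Schwarz row by row. It bounds the set defining [opnorm2] from above, so that its supremum
    is a genuine one. *)
Lemma norm2_mulmx_frobenius m n (A : 'M[R]_(m, n)) v :
  norm2 (A *m v) <= Num.sqrt (\sum_i norm2 (row i A)^T ^+ 2) * norm2 v.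
Proof.
rewrite -(@ler_pXn2r _ 2) ?nnegrE ?mulr_ge0 ?norm2_ge0 ?sqrtr_ge0//.
have s0 : 0 <= \sum_i norm2 (row i A)^T ^+ 2 by apply: sumr_ge0 => i _; exact: sqr_ge0.
rewrite exprMn (sqr_sqrtr s0) norm2_sqr mulr_suml ler_sum// => i _.
rewrite !norm2_sqr -expr2 (_ : (A *m v) i 0 = dot (row i A)^T v) ?dot_norm2_le//.
by rewrite mxE; apply: eq_bigr => j _; rewrite !mxE.
Qed.

Lemma norm2_mulmx_le_opnorm2 m n (A : 'M[R]_(m, n)) v :
  norm2 (A *m v) <= opnorm2 A * norm2 v.
Proof.
have [v0|v0] := eqVneq (norm2 v) 0.
  by rewrite v0 mulr0 (norm2_eq0 v0) mulmx0 norm20.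
have v1 : 0 < norm2 v by rewrite lt_neqAle eq_sym v0 norm2_ge0.
rewrite -ler_pdivrMr// mulrC -[X in X * _]ger0_norm ?invr_ge0 ?norm2_ge0//.
rewrite -norm2Z scalemxAr; apply: ub_le_sup.
  exists (Num.sqrt (\sum_i norm2 (row i A)^T ^+ 2)) => _ [u /= u1 <-].
  apply: (le_trans (norm2_mulmx_frobenius A u)).
  by rewrite ler_piMr// sqrtr_ge0.
exists ((norm2 v)^-1 *: v) => //=.
by rewrite norm2Z ger0_norm ?invr_ge0 ?norm2_ge0// mulVf.
Qed.

End operator_norm.

(** * Taylor expansions with a Lipschitz Hessian *)

Section line_derivatives.
Context {R : realType}.

(** Subtracting the antiderivative of the quadratic bound leaves a function with nonpositive
    derivative on [0, 1]; the mean value theorem then plays the role of integration. *)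
Lemma increment_le_quadratic (phi phi' : R -> R) (a b c : R) :
  (forall t, is_derive t (1 : R) phi (phi' t)) ->
  (forall t, 0 <= t <= 1 -> phi' t <= a + b * t + c * t ^+ 2) ->
  phi 1 - phi 0 <= a + b / 2 + c / 3.
Proof.
move=> dphi H.
pose q (t : R) := a * t + b / 2 * t ^+ 2 + c / 3 * t ^+ 3.
have dq t : is_derive t (1 : R) (fun t => phi t - q t) (phi' t - (a + b * t + c * t ^+ 2)).
  by rewrite /q; apply: is_derive_eq; rewrite /GRing.scale/= ; field.
have cq : continuous (fun t => phi t - q t).
  move=> t; apply: differentiable_continuous; apply/derivable1_diffP.
  exact: (@ex_derive _ _ _ _ _ _ _ (dq t)).
have [x] : exists2 x, x \in `]0, 1[ & (phi 1 - q 1) - (phi 0 - q 0) =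
    (phi' x - (a + b * x + c * x ^+ 2)) * (1 - 0).
  by apply: (MVT ltr01) => // t; exact: continuous_subspaceT.
rewrite in_itv/= => /andP[x0 x1].
have := H x; rewrite (ltW x0) (ltW x1) => /(_ isT).
rewrite /q !expr0n !mulr0 !expr1n; lra.
Qed.

Variable n : nat.
Implicit Types (x s u v : 'cV[R]_n).

Lemma cV_delta_sum s : s = \sum_i s i 0 *: delta_mx i 0.
Proof.
rewrite {1}[s]matrix_sum_delta; apply: eq_bigr => i _.
by rewrite big_ord1.
Qed.

Lemma derive_grad (F : 'cV[R]_n -> R) x s : differentiable F x ->
  'D_s F x = dot (grad F x) s.
Proof.
move=> dF; rewrite deriveE// {1}(cV_delta_sum s) linear_sum.
by apply: eq_bigr => i _; rewrite linearZ mxE deriveE// mulrC.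
Qed.

Lemma is_derive_line (F : 'cV[R]_n -> R) x s (t : R) :
  differentiable F (x + t *: s) ->
  is_derive t (1 : R) (fun t => F (x + t *: s)) (dot (grad F (x + t *: s)) s).
Proof.
move=> dF.
have E : (fun h : R => h^-1 *: (((fun t => F (x + t *: s)) \o shift t) (h *: (1 : R)) - F (x + t *: s))) =
    (fun h => h^-1 *: ((F \o shift (x + t *: s)) (h *: s) - F (x + t *: s))).
  apply/funext => h; congr (_ *: (F _ - _)).
  by rewrite (_ : h *: (1 : R) = h) ?/shift/= ?scalerDl 1?addrCA//; exact: mulr1.
split; first by rewrite /derivable E; exact: diff_derivable.
by rewrite -derive_grad// /derive E.
Qed.

Variables (f : 'cV[R]_n -> R) (L : R).
Hypotheses (L_ge0 : 0 <= L) (f_C2 : twice_continuously_differentiable f) (f_LH : lipschitz_hessian L f).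

Lemma differentiable_grad_coord i x : differentiable (fun y => grad f y i 0) x.
Proof.
have [_ dg _] := f_C2.
apply: (@differentiable_comp _ _ _ _ (grad f) (fun N : 'cV[R]_n => N i 0)) => //.
exact: differentiable_coord.
Qed.

Lemma grad_grad_coord i x s : dot (grad (fun y => grad f y i 0) x) s = (hess f x *m s) i 0.
Proof. by rewrite [RHS]mxE; apply: eq_bigr => j _; rewrite !mxE. Qed.

Lemma is_derive_grad_line u x s (t : R) :
  is_derive t (1 : R) (fun t => dot (grad f (x + t *: s)) u) (dot (hess f (x + t *: s) *m s) u).
Proof.
rewrite (_ : (fun _ => _) = \sum_i (fun t => u i 0 * grad f (x + t *: s) i 0)); last first.
  by apply/funext => t'; rewrite fct_sumE; apply: eq_bigr => i _; rewrite mulrC.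
have D i := is_derive_line (differentiable_grad_coord i (x + t *: s)).
apply: is_derive_eq.
by apply: eq_bigr => i _; rewrite grad_grad_coord mulrC.
Qed.

Lemma hess_increment_le x s u (t : R) : 0 <= t ->
  dot (hess f (x + t *: s) *m s) u <= dot (hess f x *m s) u + L * norm2 s ^+ 2 * norm2 u * t.
Proof.
move=> t0; rewrite -lerBlDl.
have -> : dot (hess f (x + t *: s) *m s) u - dot (hess f x *m s) u =
    dot ((hess f (x + t *: s) - hess f x) *m s) u.
  by rewrite mulmxBl dotDl -[X in _ = _ + dot X u]scaleN1r dotZl mulN1r.
apply: (le_trans (dot_le_norm2 _ _)).
rewrite (_ : _ * t = L * t * norm2 s * norm2 s * norm2 u); last by ring.
rewrite ler_wpM2r ?norm2_ge0// (le_trans (norm2_mulmx_le_opnorm2 _ _))//.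
rewrite ler_wpM2r ?norm2_ge0// (le_trans (f_LH _ _))//.
by rewrite addrC addKr norm2Z ger0_norm// mulrA.
Qed.

(** Pairing with a fixed u reduces the vector-valued expansion to a scalar function of t. *)
Lemma dot_grad_taylor x s u :
  dot (grad f (x + s)) u <=
  dot (grad f x + hess f x *m s) u + L / 2 * norm2 s ^+ 2 * norm2 u.
Proof.
have := @increment_le_quadratic _ _ (dot (hess f x *m s) u) (L * norm2 s ^+ 2 * norm2 u) 0
  (is_derive_grad_line u x s).
rewrite scale1r scale0r addr0 => H.
rewrite dotDl.
have /H : forall t : R, 0 <= t <= 1 -> dot (hess f (x + t *: s) *m s) u <=
   dot (hess f x *m s) u + L * norm2 s ^+ 2 * norm2 u * t + 0 * t ^+ 2.
  by move=> t /andP[t0 _]; rewrite mul0r addr0; exact: hess_increment_le.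
lra.
Qed.

Lemma dotBl (u v w : 'cV[R]_n) : dot (u - v) w = dot u w - dot v w.
Proof. by rewrite -(scaleN1r v) dotDl dotZl mulN1r. Qed.

(** The remainder is paired with itself, and one factor of its norm is cancelled. *)
Lemma grad_taylor x s :
  norm2 (grad f (x + s) - (grad f x + hess f x *m s)) <= L / 2 * norm2 s ^+ 2.
Proof.
set e := _ - _; have := dot_grad_taylor x s e.
rewrite -lerBlDl -dotBl -/e -norm2_sqr expr2.
have [->|e0] := eqVneq (norm2 e) 0.
  by move=> _; rewrite mulr_ge0 ?sqr_ge0// divr_ge0.
by rewrite ler_pM2r// lt_neqAle eq_sym e0 norm2_ge0.
Qed.

Lemma taylor3 x s : f (x + s) <= f x + dot (grad f x) s + 2^-1 * dot s (hess f x *m s)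
   + L / 6 * norm2 s ^+ 3.
Proof.
have [df _ _] := f_C2.
have := @increment_le_quadratic _ _ (dot (grad f x) s) (dot (hess f x *m s) s)
  (L / 2 * norm2 s ^+ 3) (fun t => is_derive_line (df (x + t *: s))).
rewrite scale1r scale0r addr0 => H.
have /H : forall t : R, 0 <= t <= 1 -> dot (grad f (x + t *: s)) s <=
   dot (grad f x) s + dot (hess f x *m s) s * t + L / 2 * norm2 s ^+ 3 * t ^+ 2.
  move=> t /andP[t0 _]; have := dot_grad_taylor x (t *: s) s.
  rewrite norm2Z ger0_norm// -scalemxAr dotDl dotZl.
  by rewrite !exprMn exprS; lra.
rewrite (dotC s); lra.
Qed.

(** The sign a covers the upper and the lower estimate at once. Along u the derivative is a
    difference of two gradients, and the two expansion errors, each with constant L / 2, add up to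
    L. *)
Lemma second_difference_le x u v (a : R) : `|a| = 1 ->
  a * (f (x + v + u) - f (x + u) - (f (x + v) - f x)) <=
  a * dot (hess f x *m v) u + L * (norm2 u + norm2 v) ^+ 3.
Proof.
move=> a1; have [df _ _] := f_C2.
have dphi (t : R) : is_derive t (1 : R) (fun t => a * (f (x + v + t *: u) - f (x + t *: u)))
    (a * (dot (grad f (x + v + t *: u)) u - dot (grad f (x + t *: u)) u)).
  have D1 := is_derive_line (df (x + v + t *: u)).
  have D2 := is_derive_line (df (x + t *: u)).
  by apply: is_derive_eq.
have := increment_le_quadratic (a := a * dot (hess f x *m v) u + L * (norm2 u + norm2 v) ^+ 3)
  (b := 0) (c := 0) dphi.
rewrite !scale1r !scale0r !addr0 -mulrBr => H.
suff /H : forall t : R, 0 <= t <= 1 ->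
    a * (dot (grad f (x + v + t *: u)) u - dot (grad f (x + t *: u)) u) <=
    a * dot (hess f x *m v) u + L * (norm2 u + norm2 v) ^+ 3 + 0 * t + 0 * t ^+ 2 by lra.
move=> t /andP[t0 t1]; rewrite !mul0r !addr0.
have := dot_grad_taylor x (v + t *: u) (a *: u).
have := dot_grad_taylor x (t *: u) (- a *: u).
rewrite !addrA mulmxDr !dotDl !dotZr !norm2Z normrN a1 mul1r (ger0_norm t0).
have n1 : norm2 (v + t *: u) <= norm2 u + norm2 v.
  rewrite (le_trans (norm2D _ _))// addrC lerD2r norm2Z (ger0_norm t0).
  by rewrite ler_piMl// norm2_ge0.
have n2 : t * norm2 u <= norm2 u + norm2 v.
  by rewrite (le_trans (ler_piMl (norm2_ge0 _) t1))// lerDl norm2_ge0.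
have p q : 0 <= q -> q <= norm2 u + norm2 v ->
    L / 2 * q ^+ 2 * norm2 u <= L / 2 * (norm2 u + norm2 v) ^+ 3.
  move=> q0 qK; rewrite -mulrA ler_wpM2l ?(divr_ge0 L_ge0)// (exprSr _ 2).
  apply: ler_pM; rewrite ?exprn_ge0 ?norm2_ge0// ?lerDl ?norm2_ge0//.
  by rewrite ler_pXn2r ?nnegrE// addr_ge0 ?norm2_ge0.
have := p _ (mulr_ge0 t0 (norm2_ge0 u)) n2.
have := p _ (norm2_ge0 _) n1.
move: (L / 2 * _ * _) (L / 2 * _ * _) (_ ^+ 3) => p1 p2 k; lra.
Qed.

(* Both sides are the second difference of f along t u and t v, up to o(t^2). *)
Lemma hess_dot_sym x u v : dot (hess f x *m u) v = dot (hess f x *m v) u.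
Proof.
suff le (y z : 'cV[R]_n) : dot (hess f x *m y) z <= dot (hess f x *m z) y.
  by apply/le_anti; rewrite !le.
rewrite leNgt; apply/negP => lt.
pose D := dot (hess f x *m y) z - dot (hess f x *m z) y.
have D0 : 0 < D by rewrite subr_gt0.
pose K := 2 * L * (norm2 y + norm2 z) ^+ 3.
have H (t : R) : 0 < t -> t ^+ 2 * D <= t ^+ 3 * K.
  move=> t0; have N1 : `|-1 : R| = 1 by rewrite normrN normr1.
  have := @second_difference_le x (t *: y) (t *: z) 1 (normr1 _).
  have := @second_difference_le x (t *: z) (t *: y) (-1) N1.
  rewrite -!scalemxAr !dotZl !dotZr !norm2Z (gtr0_norm t0) -!mulrDr !exprMn.
  rewrite (addrC (norm2 z)) (addrAC x) /D /K.
  move: (f _) (f _) (f _) (f _) (_ ^+ 3) => f1 f2 f3 f4 k; nra.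
have K0 : 0 <= K by apply: mulr_ge0; [exact: mulr_ge0|rewrite exprn_ge0// addr_ge0 ?norm2_ge0].
pose t := D / (K + D).
have t0 : 0 < t by rewrite divr_gt0// ltr_wpDl.
have := H t t0; rewrite (exprSr t 2) -mulrA ler_pM2l ?exprn_gt0// leNgt => /negP; apply.
have KD : 0 < K + D by rewrite ltr_wpDl.
by rewrite /t mulrAC (ltr_pdivrMr _ _ KD) ltr_pM2l// ltrDl.
Qed.

End line_derivatives.

(** * The cubic model and the decrease of one step *)

Section cubic_model.
Context {R : realType}.

(** Identifies a directional derivative from an O(h^2) remainder, which treats the cubed norm also
    at the origin, where the norm itself is not differentiable. *)
Lemma derive_of_quadratic_bound (V : normedModType R) (F : V -> R) (x v : V) (a K : R) :
  (forall h : R, `|h| <= 1 -> `|F (h *: v + x) - F x - h * a| <= K * h ^+ 2) ->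
  'D_v F x = a.
Proof.
move=> H; apply/cvg_lim => //; apply/cvgrPdist_le => e e0.
have K0 : 0 <= K by have := H 1; rewrite normr1 lexx expr1n mulr1 => /(_ isT); apply: le_trans.
near=> h.
have h0 : h != 0 by near: h; exact: nbhs_dnbhs_neq.
have h1 : `|h| <= Num.min 1 (e / (K + 1)).
  near: h; apply: dnbhs0_le; rewrite lt_min ltr01/= divr_gt0//.
  by rewrite ltr_wpDl.
have ha : 0 < `|h| by rewrite normr_gt0.
move: h1; rewrite le_min => /andP[h1 h2].
rewrite -(ler_pM2l ha) -normrM mulrBr /GRing.scale/= mulrA divff// mul1r.
rewrite distrC (le_trans (H h h1))// -real_normK ?num_real// expr2 mulrCA.
rewrite ler_pM2l// (le_trans (ler_wpM2l K0 h2))// mulrCA ler_piMr// ?(ltW e0)//.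
by rewrite ler_pdivrMr ?ltr_wpDl// mul1r lerDl.
Unshelve. all: by end_near. Qed.

(** With p and q the two norms, p^3 - q^3 = (3/2) q (p^2 - q^2) + (p - q)^2 (p + q/2). The first
    term is quadratic in h by expanding p^2, and (p - q)^2 <= h^2 |w|^2 by the triangle
    inequality. *)
Lemma norm2_cube_expansion n (s w : 'cV[R]_n) (h : R) : `|h| <= 1 ->
  `|norm2 (h *: w + s) ^+ 3 - norm2 s ^+ 3 - h * (3 * norm2 s * dot s w)| <=
  (norm2 w ^+ 2 * (3 * norm2 s + norm2 w)) * h ^+ 2.
Proof.
move=> h1; set p := norm2 (h *: w + s); set q := norm2 s; set W := norm2 w.
have p0 : 0 <= p by exact: norm2_ge0.
have q0 : 0 <= q by exact: norm2_ge0.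
have W0 : 0 <= W by exact: norm2_ge0.
have E : p ^+ 2 = q ^+ 2 + 2 * h * dot s w + h ^+ 2 * W ^+ 2.
  by rewrite !norm2_sqr !dotDl !dotDr !dotZl !dotZr (dotC w s); ring.
have pq : p <= q + `|h| * W.
  by rewrite (le_trans (norm2D _ _))// norm2Z addrC.
have qp : q <= p + `|h| * W.
  rewrite /q -[X in norm2 X](addKr (h *: w)) addrC (le_trans (norm2D _ _))//.
  by rewrite norm2N norm2Z.
have d : (p - q) ^+ 2 <= h ^+ 2 * W ^+ 2.
  rewrite -exprMn -[leRHS]real_normK ?num_real// -[leLHS]real_normK ?num_real//.
  by rewrite ler_pXn2r ?nnegrE// normrM (ger0_norm W0) ler_norml; lra.
have pq1 : p <= q + W.
  by rewrite (le_trans pq)// lerD2l ler_piMl.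
have -> : p ^+ 3 - q ^+ 3 - h * (3 * q * dot s w) =
    3 / 2 * q * (h ^+ 2 * W ^+ 2) + (p - q) ^+ 2 * (p + q / 2).
  have -> : h * (3 * q * dot s w) = 3 / 2 * q * (p ^+ 2 - q ^+ 2 - h ^+ 2 * W ^+ 2).
    by rewrite E; field.
  by field.
have hw0 : 0 <= h ^+ 2 * W ^+ 2 by rewrite mulr_ge0 ?sqr_ge0.
have X : (p - q) ^+ 2 * (p + q / 2) <= h ^+ 2 * W ^+ 2 * (3 / 2 * q + W).
  by apply: ler_pM; rewrite ?sqr_ge0//; lra.
have X0 : 0 <= (p - q) ^+ 2 * (p + q / 2) by rewrite mulr_ge0 ?sqr_ge0//; lra.
have Y0 : 0 <= 3 / 2 * q * (h ^+ 2 * W ^+ 2) by rewrite mulr_ge0//; lra.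
rewrite ger0_norm ?addr_ge0//.
rewrite (_ : _ * h ^+ 2 = 3 / 2 * q * (h ^+ 2 * W ^+ 2) + h ^+ 2 * W ^+ 2 * (3 / 2 * q + W)).
  by rewrite lerD2l.
by field.
Qed.

Variables (l d : nat) (f : 'cV[R]_d -> R) (L : R).
Hypotheses (L_ge0 : 0 <= L) (f_C2 : twice_continuously_differentiable f)
  (f_LH : lipschitz_hessian L f).
Implicit Types (x : 'cV[R]_d) (S : 'M[R]_(l, d)) (y : 'cV[R]_l).

Lemma dot_mulmx m n (A : 'M[R]_(m, n)) u v : dot u (A *m v) = dot (A^T *m u) v.
Proof.
rewrite /dot; under eq_bigr do rewrite mxE mulr_sumr.
rewrite exchange_big; apply: eq_bigr => j _; rewrite mxE mulr_suml.
by apply: eq_bigr => i _; rewrite mxE; ring.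
Qed.

Lemma qhatE x S y : qhat f x S y =
  f x + dot (grad f x) (S^T *m y) + 2^-1 * dot (S^T *m y) (hess f x *m (S^T *m y)).
Proof.
by rewrite /qhat (dotC (S *m _)) dot_mulmx (dotC _ (grad f x)) -!mulmxA (dot_mulmx S y).
Qed.

(** Symmetry of the Hessian merges the two cross terms of the quadratic form; what remains is
    O(h^2). *)
Lemma grad_mhat x S (al : R) y : grad (mhat f x S al) y =
  S *m (grad f x + hess f x *m (S^T *m y)) + (al^-1 * norm2 (S^T *m y)) *: (S *m (S^T *m y)).
Proof.
apply/colP => i; rewrite [LHS]mxE.
set s := S^T *m y; set w := S^T *m delta_mx i 0 : 'cV[R]_d.
have co (z : 'cV[R]_d) : (S *m z) i 0 = dot z w.
  rewrite dotC /w -dot_mulmx /dot (bigD1 i)//= big1 ?addr0 => [|j /negPf ji].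
    by rewrite !mxE !eqxx mul1r.
  by rewrite [X in X * _]mxE ji mul0r.
pose K := `|2^-1 * dot w (hess f x *m w)| + `|(3 * al)^-1| * (norm2 w ^+ 2 * (3 * norm2 s + norm2 w)).
apply: (@derive_of_quadratic_bound _ _ _ _ _ K) => h h1.
rewrite [X in h * X]mxE [X in h * (_ + X)]mxE !co /mhat !qhatE mulmxDr -scalemxAr -/s -/w.
have := norm2_cube_expansion s w h1; set D := (X in `|X|) => hD.
rewrite !mulmxDr -scalemxAr !(dotDl, dotDr, dotZl, dotZr).
rewrite (dotC w (hess f x *m s)) (dotC s (hess f x *m w)) (hess_dot_sym L_ge0 f_C2 f_LH x s w).
rewrite (_ : _ - h * _ = h ^+ 2 * (2^-1 * dot w (hess f x *m w)) + (3 * al)^-1 * D); last first.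
  by rewrite /D invfM; move: (al^-1) => ai; field.
rewrite (le_trans (ler_normD _ _))// /K [leRHS]mulrDl lerD//.
  by rewrite normrM ger0_norm ?sqr_ge0// mulrC.
by rewrite normrM -mulrA ler_wpM2l.
Qed.

Lemma model_decrease x S (al : R) y : mhat f x S al y <= mhat f x S al 0 ->
  norm2 (S^T *m y) ^+ 3 / (3 * al) <= qhat f x S 0 - qhat f x S y.
Proof.
by rewrite /mhat mulmx0 norm20 expr0n mulr0 addr0 mulrC; lra.
Qed.

Variable pr : rarc_params R.

Lemma qhat0 x S : qhat f x S 0 = f x.
Proof.
have d0 u : dot u (0 : 'cV[R]_d) = 0 by rewrite /dot big1// => i _; rewrite mxE mulr0.
by rewrite qhatE !mulmx0 !d0 mulr0 !addr0.
Qed.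

(** The Taylor error L/6 |s|^3 is absorbed by the fraction 1 - theta of the model decrease |s|^3 /
    (3 al) as soon as al <= 2 (1 - theta) / L, which is how [alpha_low] arises. *)
Lemma small_alpha_successful x S (al : R) y : 0 < L -> 0 < al -> al <= alpha_low pr L ->
  mhat f x S al y <= mhat f x S al 0 -> successful pr f x S y.
Proof.
move=> L0 al0 hal /model_decrease; rewrite /successful.
have := taylor3 f_C2 f_LH x (S^T *m y); rewrite -qhatE qhat0.
move: (norm2 _) (norm2_ge0 (S^T *m y)) => n n0.
have /andP[t0 t1] := theta_itv pr.
move: (qhat f x S y) => q h1 h2.
suff : L / 6 * n ^+ 3 <= (1 - theta pr) * (f x - q) by lra.
apply: (@le_trans _ _ ((1 - theta pr) * (n ^+ 3 / (3 * al)))); last first.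
  by rewrite ler_wpM2l// subr_ge0 ltW.
rewrite (mulrCA (1 - _)) (mulrC (L / 6)) ler_wpM2l ?exprn_ge0// ler_pdivlMr ?mulr_gt0//.
by move: hal; rewrite /alpha_low ler_pdivlMr//; lra.
Qed.

Lemma successful_decrease x S y (al : R) : 0 < al -> al <= alpha_max pr ->
  mhat f x S al y <= mhat f x S al 0 -> successful pr f x S y ->
  theta pr / (3 * alpha_max pr) * norm2 (S^T *m y) ^+ 3 <= f x - f (x + S^T *m y).
Proof.
move=> al0 alm /model_decrease h; rewrite /successful; apply: le_trans.
have /andP[t0 t1] := theta_itv pr.
rewrite -mulrA ler_wpM2l ?(ltW t0)//; apply: le_trans h.
rewrite mulrC ler_wpM2l ?exprn_ge0 ?norm2_ge0// lef_pV2 ?posrE ?mulr_gt0 ?alpha_max_gt0//.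
by rewrite ler_pM2l.
Qed.

(** The termination test bounds the sketched vector S g, where g = grad f + hess f s; the embedding
    carries the bound to g, and the Taylor expansion carries it from g to the gradient at the new
    point. *)
Lemma embedded_step x S y (al Sm e : R) : 0 < al -> 0 < Sm -> 0 < e < 1 ->
  norm2 (grad (mhat f x S al) y) <= kappaT pr * norm2 (S^T *m y) ^+ 2 ->
  (forall v, norm2 (S *m v) <= Sm * norm2 v) ->
  (1 - e) * norm2 (grad f x + hess f x *m (S^T *m y)) ^+ 2 <=
    norm2 (S *m (grad f x + hess f x *m (S^T *m y))) ^+ 2 ->
  norm2 (grad f (x + S^T *m y)) <=
  (L / 2 + (al^-1 * Sm + kappaT pr) / Num.sqrt (1 - e)) * norm2 (S^T *m y) ^+ 2.
Proof.
move=> al0 Sm0 /andP[e0 e1]; rewrite grad_mhat.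
set s := S^T *m y; set g : 'cV[R]_d := grad f x + _ => hk hS hemb.
have k0 := kappaT_ge0 pr.
have s0 : 0 < Num.sqrt (1 - e) by rewrite sqrtr_gt0 subr_gt0.
have h1 : norm2 (S *m g) <= (al^-1 * Sm + kappaT pr) * norm2 s ^+ 2.
  rewrite -[X in norm2 X](addrK ((al^-1 * norm2 s) *: (S *m s))).
  rewrite (le_trans (norm2D _ _))// addrC mulrDl lerD// norm2N norm2Z.
  rewrite ger0_norm ?mulr_ge0 ?invr_ge0 ?norm2_ge0 ?(ltW al0)//.
  rewrite -!mulrA ler_wpM2l ?invr_ge0 ?(ltW al0)// expr2 mulrCA.
  by rewrite ler_wpM2l ?norm2_ge0.
have h2 : norm2 g * Num.sqrt (1 - e) <= norm2 (S *m g).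
  rewrite -(@ler_pXn2r _ 2) ?nnegrE ?mulr_ge0 ?norm2_ge0 ?sqrtr_ge0//.
  have e1' : 0 <= 1 - e by rewrite subr_ge0 ltW.
  by rewrite exprMn (sqr_sqrtr e1') mulrC.
rewrite -[X in norm2 X](subrK g) (le_trans (norm2D _ _))// mulrDl lerD//.
  exact: grad_taylor.
by rewrite mulrAC ler_pdivlMr// (le_trans h2).
Qed.

Lemma true_successful_decrease x S y (al Sm e eps : R) : 0 < L ->
  0 < al -> al <= alpha_max pr -> 0 < Sm -> 0 < e < 1 -> 0 < eps ->
  mhat f x S al y <= mhat f x S al 0 ->
  norm2 (grad (mhat f x S al) y) <= kappaT pr * norm2 (S^T *m y) ^+ 2 ->
  (forall v, norm2 (S *m v) <= Sm * norm2 v) ->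
  (1 - e) * norm2 (grad f x + hess f x *m (S^T *m y)) ^+ 2 <=
    norm2 (S *m (grad f x + hess f x *m (S^T *m y))) ^+ 2 ->
  successful pr f x S y -> eps < norm2 (grad f (x + S^T *m y)) ->
  hbound pr L e Sm eps al <= f x - f (x + S^T *m y).
Proof.
move=> L0 al0 alm Sm0 e01 eps0 hm hg hS hemb hsucc heps.
apply: (le_trans _ (successful_decrease al0 alm hm hsucc)).
have := lt_le_trans heps (embedded_step al0 Sm0 e01 hg hS hemb).
have /andP[t0 t1] := theta_itv pr; have k0 := kappaT_ge0 pr.
move/andP: e01 => [e0 e1].
have s0 : 0 < Num.sqrt (1 - e) by rewrite sqrtr_gt0 subr_gt0.
rewrite /hbound; set C := al^-1 * Sm + kappaT pr; set n := norm2 _ => hn.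
have C0 : 0 < C by rewrite ltr_pwDl// mulr_gt0// invr_gt0.
have n0 : 0 <= n by exact: norm2_ge0.
rewrite -mulrA ler_wpM2l ?divr_ge0 ?mulr_ge0 ?(ltW t0) ?(ltW (alpha_max_gt0 pr))//.
(* The gradient bound controls n^2 and the decrease involves n^3, hence the exponent 3/2 in
   [hbound]. *)
have n3 : n ^+ 3 = (n ^+ 2) `^ (3 / 2).
  rewrite -[n ^+ 3]powR_mulrn// -[n ^+ 2]powR_mulrn// -powRrM; congr (_ `^ _); lra.
have p0 : 0 <= 3 / 2 :> R by lra.
have e20 : 0 <= eps / 2 by rewrite divr_ge0// ltW.
rewrite n3.
(* One of the two terms bounding the new gradient exceeds eps / 2; each case selects one branch of
   the minimum in [hbound]. *)
have [hc|hc] := leP (C / Num.sqrt (1 - e) * n ^+ 2) (eps / 2).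
  have le2 : (eps / 2) * (2 / L) <= n ^+ 2.
    by rewrite mulrA ler_pdivrMr//; move: hn; rewrite mulrDl; lra.
  apply: (@le_trans _ _ ((eps / 2) `^ (3 / 2) * (2 `^ (3 / 2) / L `^ (3 / 2)))).
    by rewrite ler_wpM2l ?powR_ge0// ge_min lexx.
  have -> : 2 `^ (3 / 2) / L `^ (3 / 2) = (2 / L) `^ (3 / 2) :> R.
    have Li : 0 <= L^-1 by rewrite invr_ge0 ltW.
    rewrite (powRM _ (ler0n _ 2) Li); congr (_ * _).
    apply: (mulIf (lt0r_neq0 (powR_gt0 (3 / 2) L0))).
    by rewrite mulVf ?lt0r_neq0 ?powR_gt0// -(powRM _ Li (ltW L0)) mulVf ?powR1// lt0r_neq0.
  have L2 : 0 <= 2 / L by rewrite divr_ge0// ltW.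
  rewrite -(powRM _ e20 L2); apply: ge0_ler_powR; rewrite ?nnegrE ?(mulr_ge0 e20 L2) ?sqr_ge0//.
apply: (@le_trans _ _ ((eps / 2) `^ (3 / 2) * (Num.sqrt (1 - e) / C) `^ (3 / 2))).
  by rewrite ler_wpM2l ?powR_ge0// ge_min lexx orbT.
have sC : 0 <= Num.sqrt (1 - e) / C by rewrite divr_ge0// ltW.
rewrite -(powRM _ e20 sC); apply: ge0_ler_powR; rewrite ?nnegrE ?(mulr_ge0 e20 sC) ?sqr_ge0//.
rewrite mulrA ler_pdivrMr// -ler_pdivlMr//.
by rewrite -mulrA [leRHS]mulrC ltW.
Qed.

End cubic_model.

(** * Counting iterations along one path *)

Section step_size_counting.
Context {R : realType} (pr : rarc_params R) (LH : R).
Hypothesis LH_gt0 : 0 < LH.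

Let g0 : 0 < gamma1 pr. Proof. by case/andP: (gamma1_itv pr). Qed.
Let g1 : gamma1 pr < 1. Proof. by case/andP: (gamma1_itv pr). Qed.

Lemma alpha0_gt0 : 0 < alpha0 pr.
Proof. by rewrite mulr_gt0 ?alpha_max_gt0 ?exprn_gt0. Qed.

(** The cap lies on the same geometric grid as the step sizes, so that capping keeps exponents
    integral. *)
Lemma alpha_max_alpha0 : alpha_max pr = alpha0 pr * gamma1 pr ^ (- (pexp pr)%:Z).
Proof. by rewrite /alpha0 -exprnN -mulrA divff ?mulr1// expf_neq0// gt_eqF. Qed.

Lemma gamma1_exprz_anti (a b : int) : a <= b -> gamma1 pr ^ b <= gamma1 pr ^ a.
Proof.
move=> ab; rewrite -(subrK a b) expfzDr ?gt_eqF// ler_piMl ?exprz_ge0 ?(ltW g0)//.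
have : 0 <= b - a by rewrite subr_ge0.
by case: (b - a) => // n _; rewrite exprn_ile1 ?ltW.
Qed.

(** ln gamma1 is negative, so dividing by it reverses inequalities. The entry 1 / gamma2 <= 1 of the
    minimum makes tau nonnegative, so that the initial exponent 0 satisfies the upper bound of the
    invariant. *)
Lemma tau_alpha_spec : 0 <= tau_alpha pr LH /\
  alpha0 pr * gamma1 pr ^ tau_alpha pr LH <= alpha_low pr LH.
Proof.
have al0 : 0 < alpha_low pr LH.
  by rewrite divr_gt0// mulr_gt0// subr_gt0; case/andP: (theta_itv pr).
have lg : ln (gamma1 pr) < 0 by rewrite ln_lt0// g0.
set m := Num.min (alpha_low pr LH / alpha0 pr) (gamma2 pr)^-1.
have m0 : 0 < m.
  by rewrite lt_min divr_gt0 ?alpha0_gt0//= invr_gt0 invr_gt0 exprn_gt0.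
have m1 : m <= 1.
  by rewrite ge_min invrK exprn_ile1 ?orbT// ltW.
have r0 : 0 <= ln m / ln (gamma1 pr).
  by rewrite ler_ndivlMr// mul0r ln_le0.
have t0 : 0 <= tau_alpha pr LH by rewrite /tau_alpha -/m -(ceil0 R) ceil_le.
split=> //; rewrite mulrC -ler_pdivlMr ?alpha0_gt0//.
have : ln m / ln (gamma1 pr) <= (tau_alpha pr LH)%:~R by exact: ceil_ge.
rewrite ler_ndivrMr//.
case: (tau_alpha pr LH) t0 => // n _ h.
suff : gamma1 pr ^+ n <= m by rewrite le_min => /andP[].
rewrite -ler_ln ?posrE ?exprn_gt0// lnXn// (le_trans _ h)//.
by rewrite mulr_natl.
Qed.

Variables (alpha : nat -> R) (su : nat -> bool) (N : nat).
Hypotheses (alpha_init : alpha 0%N = alpha0 pr)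
  (alpha_update : forall k, (k < N)%N ->
     alpha k.+1 = if su k then Num.min (alpha_max pr) (gamma2 pr * alpha k)
                  else gamma1 pr * alpha k)
  (alpha_small : forall k, (k < N)%N -> 0 < alpha k -> alpha k <= alpha_low pr LH -> su k).

Lemma step_size_invariant n : (n <= N)%N -> exists a : int,
  [/\ alpha n = alpha0 pr * gamma1 pr ^ a, - (pexp pr)%:Z <= a, a <= tau_alpha pr LH &
     (\sum_(k < n) ~~ su k)%N%:Z - (cexp pr)%:Z * (\sum_(k < n) su k)%N%:Z <= a].
Proof.
have [t0 tl] := tau_alpha_spec.
elim: n => [_|n IH nN].
  by exists 0; split; rewrite ?expr0z ?mulr1// ?big_ord0 ?mulr0 ?subrr//; lia.
have [a [aE pa aT cnt]] := IH (ltnW nN).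
rewrite !big_ord_recr/= alpha_update// aE; case: ifP => su_n /=.
  (* The maximum records the cap at [alpha_max]: a success may lower the exponent by less than c, so
     the last clause of the invariant is only an inequality. *)
  exists (Num.max (- (pexp pr)%:Z) (a - (cexp pr)%:Z)).
  have gE : gamma2 pr * (alpha0 pr * gamma1 pr ^ a) = alpha0 pr * gamma1 pr ^ (a - (cexp pr)%:Z).
    by rewrite expfzDr ?gt_eqF// -exprnN mulrCA (mulrC (gamma2 pr)).
  split.
  - rewrite gE alpha_max_alpha0.
    have [ac|/ltW ac] := leP (- (pexp pr)%:Z) (a - (cexp pr)%:Z).
      by apply/min_idPr; rewrite ler_pM2l ?alpha0_gt0// gamma1_exprz_anti.
    by apply/min_idPl; rewrite ler_pM2l ?alpha0_gt0// gamma1_exprz_anti.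
  - by rewrite le_max lexx.
  - by rewrite ge_max; apply/andP; split; lia.
  - rewrite le_max; apply/orP; right; move: cnt.
    move: (\sum_(k < n) ~~ su k)%N (\sum_(k < n) su k)%N => u v.
    by rewrite addn0 PoszD mulrDr mulr1; move: (Posz (cexp pr) * v) => cv; lia.
exists (a + 1); split.
- by rewrite expfzDr ?gt_eqF// expr1z mulrCA (mulrC (gamma1 pr)).
- by lia.
- rewrite -ltzD1 ltrD2r lt_neqAle aT andbT; apply/eqP => aTE.
  move: su_n; rewrite alpha_small// aE aTE//.
  by rewrite mulr_gt0 ?alpha0_gt0// exprz_gt0.
- move: cnt; move: (\sum_(k < n) ~~ su k)%N (\sum_(k < n) su k)%N => u v.
  by rewrite addn0 PoszD; move: (Posz (cexp pr) * v) => cv; lia.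
Qed.

Lemma step_size_bounds n : (n <= N)%N ->
  alpha0 pr * gamma1 pr ^ tau_alpha pr LH <= alpha n <= alpha_max pr.
Proof.
move=> nN; have [a [-> pa aT _]] := step_size_invariant nN.
by rewrite alpha_max_alpha0 !ler_pM2l ?alpha0_gt0// !gamma1_exprz_anti.
Qed.

Lemma successful_count :
  (N%:R - (tau_alpha pr LH)%:~R) / (1 + (cexp pr)%:R) <= (\sum_(k < N) su k)%N%:R :> R.
Proof.
have [a [_ _ aT cnt]] := step_size_invariant (leqnn N).
have E : (N = \sum_(k < N) ~~ su k + \sum_(k < N) su k)%N.
  rewrite -big_split/= -{1}(card_ord N) -sum1_card; apply: eq_bigr => k _.
  by case: (su k).
rewrite ler_pdivrMr ?ltr_wpDr//.
have : N%:Z - tau_alpha pr LH <= (\sum_(k < N) su k)%N%:Z * (1 + (cexp pr)%:Z) by lia.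
by rewrite -(ler_int R) rmorphB rmorphM rmorphD.
Qed.

Lemma good_iterations_decrease (tr : nat -> bool) (F : nat -> R) (h : R) :
  (forall k, (k < N)%N -> F k.+1 <= F k) ->
  (forall k, (k < N)%N -> su k -> tr k -> h <= F k - F k.+1) ->
  (\sum_(k < N) (su k && tr k))%N%:R * h <= F 0%N - F N.
Proof.
move=> Fd Fh.
have : forall n, (n <= N)%N -> (\sum_(k < n) (su k && tr k))%N%:R * h <= F 0%N - F n.
  elim=> [_|n IH nN]; first by rewrite big_ord0 mul0r subrr.
  have := IH (ltnW nN); rewrite big_ord_recr/= natrD mulrDl.
  case: (boolP (su n && tr n)) => [/andP[s t]|_].
    by have := Fh n nN s t; rewrite mul1r; lra.
  by have := Fd n nN; rewrite mul0r; lra.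
by apply.
Qed.

(** Among N iterations, the true ones and the successful ones overlap in at least the sum of their
    counts minus N. *)
Lemma good_count_ge (tr : nat -> bool) :
  (\sum_(k < N) tr k)%N%:R - (1 - (cexp pr)%:R / ((cexp pr)%:R + 1) ^+ 2) * N%:R
    - (tau_alpha pr LH)%:~R / (1 + (cexp pr)%:R) <=
  (\sum_(k < N) (su k && tr k))%N%:R :> R.
Proof.
have := successful_count.
have : (\sum_(k < N) tr k + \sum_(k < N) su k <= N + \sum_(k < N) (su k && tr k))%N.
  have -> : (N + \sum_(k < N) (su k && tr k) = \sum_(k < N) (1 + (su k && tr k)))%N.
    by rewrite big_split/= sum1_card card_ord.
  rewrite -big_split/=; apply: leq_sum => k _.
  by case: (su k); case: (tr k).
rewrite -(ler_nat R) !natrD.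
have c0 : 0 <= (cexp pr)%:R :> R by [].
move: (cexp pr)%:R c0 => c c0.
(* Counting gives the rate 1 / (1 + c), which dominates the rate appearing in [gfactor]. *)
have : c / (c + 1) ^+ 2 <= (1 + c)^-1.
  rewrite ler_pdivrMr ?exprn_gt0 ?ltr_wpDl// expr2 mulrA addrC mulVf ?mul1r ?lerDl//.
  by rewrite gt_eqF// ltr_wpDl.
rewrite mulrBl.
have : 0 <= N%:R :> R by [].
move: (N%:R : R) (_%:R) (_%:R) (_%:R) (_%:~R) ((1 + c)^-1) (c / _) => n t s g ta c1 c2.
by nra.
Qed.

End step_size_counting.

(** * Chernoff bound for adapted events *)

Section chernoff.
Context {R : realType} {dT : measure_display} {T : measurableType dT}.
Variables (P : probability T R) (F : nat -> set (set T)) (E : nat -> set T) (N : nat) (p : R).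
Hypotheses (p_ge0 : 0 <= p) (p_le1 : p <= 1) (F_filtration : is_filtration F)
  (E_adapted : forall k, (k < N)%N -> F k.+1 (E k))
  (E_prob : forall k, (k < N)%N -> forall A, F k A -> (p%:E * P A <= P (A `&` E k))%E).

Definition hits n (w : T) : nat := (\sum_(k < n) (w \in E k))%N.

Lemma expRN_le_quadratic (x : R) : 0 <= x -> expR (- x) <= 1 - x + x ^+ 2 / 2.
Proof.
move=> x0.
have d (t : R) : is_derive t (1 : R) (fun t => expR (- x * t)) (- x * expR (- x * t)).
  by apply: is_derive_eq; rewrite /GRing.scale/=; ring.
have := increment_le_quadratic (a := - x) (b := x ^+ 2) (c := 0) d.
rewrite mulr1 mulr0 expR0 => H.
suff /H : forall t : R, 0 <= t <= 1 -> - x * expR (- x * t) <= - x + x ^+ 2 * t + 0 * t ^+ 2 by lra.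
move=> t _; rewrite mul0r addr0.
have -> : - x + x ^+ 2 * t = - x * (1 + (- x * t)) by ring.
by rewrite !mulNr lerN2 ler_wpM2l// expR_ge1Dx.
Qed.

Lemma hits_le n w : (hits n w <= n)%N.
Proof. by rewrite -{2}(card_ord n) -sum1_card leq_sum// => k _; case: (_ \in _). Qed.

Lemma hits_adapted n j : (n <= N)%N -> F n [set w | hits n w = j].
Proof.
have [sF _ mF] := F_filtration.
elim: n j => [|n IH] j nN.
  apply/(measurable_sub_space (sF 0%N)).
  have [->|j0] := eqVneq j 0%N.
    by rewrite (_ : [set _ | _] = setT)//; apply/seteqP; split => w //= _; rewrite /hits big_ord0.
  rewrite (_ : [set _ | _] = set0)//; apply/seteqP; split => w //=; rewrite /hits big_ord0.
  by move=> j00; rewrite -j00 eqxx in j0.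
have mE : measurable (E n : set (sub_space (F n.+1))).
  by apply/(measurable_sub_space (sF _)); exact: E_adapted.
have mH i : measurable ([set w | hits n w = i] : set (sub_space (F n.+1))).
  by apply/(measurable_sub_space (sF _)); apply: mF; apply: IH; exact: ltnW.
apply/(measurable_sub_space (sF _)).
rewrite (_ : [set _ | _] = ([set w | hits n w = j] `\` E n) `|`
   ((if j is j'.+1 then [set w | hits n w = j'] else set0) `&` E n)).
  apply: measurableU; first exact: measurableD.
  by apply: measurableI => //; case: j => [|j].
apply/seteqP; split => w /=; rewrite /hits big_ord_recr/=.
  have [wE|wE] := boolP (w \in E n).
    rewrite addn1 => <-; right; split => //; exact: set_mem.
  by rewrite addn0 => ->; left; split => //; move: wE; rewrite notin_setE.
case=> -[]; first by move=> <- nE; rewrite memNset// addn0.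
by case: j => // j <- wE; rewrite mem_set// addn1.
Qed.

Lemma measurable_hits n j : (n <= N)%N -> measurable [set w | hits n w = j].
Proof. by case: F_filtration => _ mF _ nN; apply: (mF n); exact: hits_adapted. Qed.

Lemma measurable_hit k : (k < N)%N -> measurable (E k).
Proof. by case: F_filtration => _ mF _ kN; apply: (mF k.+1); exact: E_adapted. Qed.

Lemma expr_hitsS (x : R) m w :
  x ^+ hits m.+1 w = x ^+ hits m w - (1 - x) * (x ^+ hits m w * \1_(E m) w).
Proof.
rewrite /hits big_ord_recr/= exprD indicE.
by case: (w \in E m) => /=; rewrite ?expr1 ?expr0; set y := _ ^+ _; ring.
Qed.

Lemma measurable_expr_hits (x : R) m : (m <= N)%N -> measurable_fun setT (fun w => x ^+ hits m w).
Proof.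
elim: m => [_|m IHm mN].
  by under eq_fun do rewrite /hits big_ord0 expr0; exact: measurable_cst.
under eq_fun do rewrite expr_hitsS.
have h := IHm (ltnW mN).
apply: measurable_funB => //; apply: measurable_funM; first exact: measurable_cst.
by apply: measurable_funM => //; exact: (measurable_indic (measurable_hit mN)).
Qed.

(** Splitting by the value of the count reduces the integral to events of the past, the form in
    which the conditional lower bound is available. *)
Lemma integral_expr_hits (x : R) n (B : set T) : 0 <= x -> (n <= N)%N -> measurable B ->
  (\int[P]_w (x ^+ hits n w * \1_B w)%:E =
   \sum_(j < n.+1) (x ^+ j)%:E * P ([set w | hits n w = j] `&` B))%E.
Proof.
move=> x0 nN mB; pose H (j : 'I_n.+1) := [set w | hits n w = j] `&` B.
have mH j : measurable (H j) by apply: measurableI => //; exact: measurable_hits.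
have m1 j : measurable_fun setT (fun w => (\1_(H j) w)%:E : \bar R).
  by apply/measurable_EFinP; exact: measurable_indic.
rewrite (_ : (fun w => _) = (fun w => (\sum_(j < n.+1) (x ^+ j)%:E * (\1_(H j) w)%:E)%E)); last first.
  apply/funext => w; have hw : (hits n w < n.+1)%N by rewrite ltnS hits_le.
  rewrite (bigD1 (Ordinal hw))//= big1 ?adde0 => [|j jn].
    by rewrite -EFinM /H !indicE in_setI (mem_set (A := [set w | hits n w = _]))//.
  rewrite -EFinM /H indicE in_setI memNset ?andFb ?mulr0// => /= hj.
  by move: jn; rewrite -val_eqE/= hj eqxx.
rewrite ge0_integral_sum//; last first.
- by move=> j w _; rewrite -EFinM lee_fin mulr_ge0// exprn_ge0.
- by move=> j; exact: measurable_funeM.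
apply: eq_bigr => j _; rewrite ge0_integralZl_EFin ?exprn_ge0//.
by rewrite integral_indic// setIT.
Qed.

(** A new hit multiplies the power by x and a miss leaves it unchanged; since a hit has conditional
    probability at least p, each iteration gains the factor 1 - (1 - x) p. *)
Lemma integral_expr_hits_le (x : R) n : 0 <= x <= 1 -> (n <= N)%N ->
  (\int[P]_w (x ^+ hits n w)%:E <= ((1 - (1 - x) * p) ^+ n)%:E)%E.
Proof.
move=> /andP[x0 x1].
have c0 : 0 <= 1 - (1 - x) * p.
  by rewrite subr_ge0 mulr_ile1// ?subr_ge0// gerBl.
have E1 m : (\int[P]_w (x ^+ hits m w)%:E = \int[P]_w (x ^+ hits m w * \1_setT w)%:E)%E.
  by apply: eq_integral => w _; rewrite indicT mulr1.
elim: n => [_|n IH nN].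
  rewrite expr0 (eq_integral (fun=> 1%:E)); last by move=> w _; rewrite /hits big_ord0 expr0.
  have h := integral_cst P measurableT 1%:E.
  by apply: le_trans (_ : _ <= 1%:E * P setT)%E _; [rewrite -h|rewrite probability_setT mule1].
pose Psi := (\int[P]_w (x ^+ hits n w * \1_(E n) w)%:E)%E.
have Psi_ge : (p%:E * \int[P]_w (x ^+ hits n w)%:E <= Psi)%E.
  rewrite E1 /Psi !integral_expr_hits ?(ltnW nN)//; last exact: measurable_hit.
  rewrite ge0_sume_distrr; last by move=> j _; rewrite mule_ge0// lee_fin exprn_ge0.
  apply: lee_sum => j _; rewrite muleCA lee_wpmul2l ?lee_fin ?exprn_ge0// setIT.
  by apply: E_prob => //; apply: hits_adapted; exact: ltnW.
have mYE : measurable_fun setT (fun w => x ^+ hits n w * \1_(E n) w).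
  by apply: measurable_funM; [exact: measurable_expr_hits (ltnW nN)|exact: (measurable_indic (measurable_hit nN))].
have Y0 m w : 0 <= x ^+ hits m w by rewrite exprn_ge0.
have YE0 w : 0 <= x ^+ hits n w * \1_(E n) w by rewrite mulr_ge0.
have x10 : 0 <= 1 - x by rewrite subr_ge0.
have rec : (\int[P]_w (x ^+ hits n w)%:E = \int[P]_w (x ^+ hits n.+1 w)%:E + (1 - x)%:E * Psi)%E.
  rewrite /Psi -ge0_integralZl_EFin//; [|by move=> w _; rewrite lee_fin|exact/measurable_EFinP].
  rewrite -ge0_integralD//; first last.
  - by apply/measurable_EFinP; apply: measurable_funM => //; exact: measurable_cst.
  - by move=> w _; rewrite -EFinM lee_fin mulr_ge0.
  - by apply/measurable_EFinP; exact: measurable_expr_hits.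
  - by move=> w _; rewrite lee_fin.
  by apply: eq_integral => w _; rewrite -EFinM -EFinD expr_hitsS subrK.
have Psi_le : (Psi <= \int[P]_w (x ^+ hits n w)%:E)%E.
  apply: ge0_le_integral => //.
  - by move=> w _; rewrite lee_fin.
  - exact/measurable_EFinP.
  - by apply/measurable_EFinP; exact: measurable_expr_hits (ltnW nN).
  - by move=> w _; rewrite lee_fin ler_piMr// indicE; case: (_ \in _).
have IH' := IH (ltnW nN).
have Psi0 : (0 <= Psi)%E by apply: integral_ge0 => w _; rewrite lee_fin.
have a0 : (0 <= \int[P]_w (x ^+ hits n.+1 w)%:E)%E by apply: integral_ge0 => w _; rewrite lee_fin.
have b0 : (0 <= \int[P]_w (x ^+ hits n w)%:E)%E by apply: integral_ge0 => w _; rewrite lee_fin.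
have ab : (\int[P]_w (x ^+ hits n.+1 w)%:E <= \int[P]_w (x ^+ hits n w)%:E)%E.
  by rewrite [leRHS]rec leeDl// mule_ge0.
have fin (a : \bar R) (b : R) : (0 <= a)%E -> (a <= b%:E)%E -> a = (fine a)%:E.
  by move=> a0' ab'; rewrite fineK// ge0_fin_numE// (le_lt_trans ab') ?ltry.
move: rec Psi_ge (IH').
rewrite (fin _ _ b0 IH') (fin _ _ a0 (le_trans ab IH')) (fin _ _ Psi0 (le_trans Psi_le IH')).
rewrite -!EFinM -EFinD !lee_fin => -[] -> h1 h2.
rewrite exprS (le_trans _ (ler_wpM2l c0 h2))//.
move: (fine _) (fine _) h1 => a b h1; nra.
Qed.

Lemma measurable_hits_le (m : R) : measurable [set w | (hits N w)%:R <= m :> R].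
Proof.
rewrite (_ : [set w | _] = \bigcup_(j in [set j : nat | j%:R <= m]) [set w | hits N w = j]).
  by apply: bigcup_measurable => j _; exact: measurable_hits.
by apply/seteqP; split => w /=; [move=> h; exists (hits N w)|move=> [j h E1]; rewrite E1].
Qed.

(** Markov's inequality at x = exp(-de). With 1 - x >= de - de^2/2 the exponent is at most p N (de
    (1 - de) - de + de^2/2) = - p N de^2/2. *)
Lemma hits_lower_tail (de : R) : 0 <= de ->
  (P [set w | ((hits N w)%:R <= (1 - de) * p * N%:R :> R)%R] <=
   (expR (- (p * de ^+ 2 / 2 * N%:R)))%:E)%E.
Proof.
move=> de0; set m := (1 - de) * p * N%:R.
pose x := expR (- de).
have x01 : 0 <= x <= 1 by rewrite expR_ge0 -expR0 ler_expR oppr_le0 de0.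
have x0 : 0 < x by exact: expR_gt0.
have mY : measurable_fun setT (fun w => x ^+ hits N w) by exact: measurable_expr_hits.
set A := [set w | _].
have mA : measurable A by exact: measurable_hits_le.
have hA : (P A <= \int[P]_w (expR (de * m) * x ^+ hits N w)%:E)%E.
  rewrite -[X in P X]setIT -integral_indic//; apply: ge0_le_integral => //.
  - by apply/measurable_EFinP; exact: measurable_indic.
  - by apply/measurable_EFinP; apply: measurable_funM => //; exact: measurable_cst.
  move=> w _; rewrite lee_fin indicE; have [|_] := boolP (w \in A); last first.
    by rewrite mulr_ge0 ?expR_ge0 ?exprn_ge0 ?(ltW x0).
  rewrite inE /A/= => h; rewrite -expRM_natl -expRD -[leLHS]expR0 ler_expR.
  by rewrite mulrN mulrC -mulrBl mulr_ge0 ?subr_ge0.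
apply: (le_trans hA).
under eq_integral do rewrite EFinM.
rewrite ge0_integralZl_EFin ?expR_ge0//; last first.
- exact/measurable_EFinP.
- by move=> w _; rewrite lee_fin exprn_ge0// ltW.
apply: (le_trans (lee_wpmul2l _ (integral_expr_hits_le x01 (leqnn N)))).
  by rewrite lee_fin expR_ge0.
rewrite -EFinM lee_fin.
have c1 : 1 - (1 - x) * p <= expR (- ((1 - x) * p)) by exact: expR_ge1Dx.
have c0 : 0 <= 1 - (1 - x) * p.
  move/andP: x01 => [x0' x1].
  by rewrite subr_ge0 mulr_ile1// ?subr_ge0// gerBl.
apply: (@le_trans _ _ (expR (de * m) * expR (- ((1 - x) * p)) ^+ N)).
  by rewrite ler_wpM2l ?expR_ge0// lerXn2r ?nnegrE ?expR_ge0.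
rewrite -expRM_natl -expRD ler_expR /m.
have := expRN_le_quadratic de0; rewrite -/x => hx.
have N0 : 0 <= N%:R :> R by [].
have : 0 <= p * N%:R * (1 - de + de ^+ 2 / 2 - x) by rewrite mulr_ge0 ?mulr_ge0// subr_ge0.
nra.
Qed.

End chernoff.

Lemma continuous_compose (U V W : topologicalType) (g : U -> V) (f : V -> W) :
  continuous f -> continuous g -> continuous (fun x => f (g x)).
Proof. by move=> cf cg x; apply: continuous_comp; [exact: cg|exact: cf]. Qed.

(** * The run *)

Section run_measurability.
Context {R : realType} (l d : nat) (f : 'cV[R]_d -> R) (pr : rarc_params R).
Hypothesis f_C2 : twice_continuously_differentiable f.

Lemma continuous_C2 : continuous f.
Proof. by case: f_C2 => df _ _ x; exact: differentiable_continuous. Qed.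

Lemma continuous_grad : continuous (grad f).
Proof. by case: f_C2 => _ dg _ x; exact: differentiable_continuous. Qed.

(* The blocks of a [pack] hold x, S^T, an unused zero and s^T. *)
Let pack := 'M[R]_(d + 1, 1 + l).
Let px (B : pack) : 'cV[R]_d := ulsubmx B.
Let ps (B : pack) : 'cV[R]_d := ursubmx B *m (drsubmx B)^T.

Let continuous_px : continuous px.
Proof.
apply: continuous_coords => i j; under eq_fun do rewrite /px !mxE.
exact: (continuous_entry (@continuous_id_fun _)).
Qed.

Let continuous_ps : continuous ps.
Proof.
apply: continuous_mulmx; apply: continuous_coords => i j;
  under eq_fun do rewrite !mxE; exact: (continuous_entry (@continuous_id_fun _)).
Qed.

Let success_gap (B : pack) : R :=
  theta pr * (f (px B) - (f (px B) + dot (grad f (px B)) (ps B) +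
    2^-1 * dot (ps B) (hess f (px B) *m ps B))) - (f (px B) - f (px B + ps B)).

Let continuous_success_gap : continuous success_gap.
Proof.
have cf : continuous (fun B => f (px B)) by exact: (continuous_compose continuous_C2 continuous_px).
have [_ _ ch] := f_C2.
have chp : continuous (fun B => hess f (px B)) by exact: (continuous_compose ch continuous_px).
have cs : continuous (fun B => f (px B + ps B)).
  apply: (continuous_compose continuous_C2); apply: continuous_coords => i j.
  under eq_fun do rewrite mxE.
  exact: (continuous_addr (continuous_entry (i := i) (j := j) continuous_px)
                          (continuous_entry (i := i) (j := j) continuous_ps)).
have cg : continuous (fun B => grad f (px B)) by exact: (continuous_compose continuous_grad continuous_px).
have cgs : continuous (fun B => dot (grad f (px B)) (ps B)) by exact: (continuous_dot cg continuous_ps).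
have chs : continuous (fun B => hess f (px B) *m ps B) by exact: (continuous_mulmx chp continuous_ps).
have csh : continuous (fun B => dot (ps B) (hess f (px B) *m ps B)) by exact: (continuous_dot continuous_ps chs).
have h1 := continuous_addr (continuous_addr cf cgs) (@continuous_scaler R _ 2^-1 _ csh).
have h2 := @continuous_scaler R _ (theta pr) _ (continuous_subr cf h1).
have h3 := continuous_subr h2 (continuous_subr cf cs).
exact: h3.
Qed.

Lemma measurable_successful d1 (T : measurableType d1) (x : T -> 'cV[R]_d)
    (S : T -> 'M[R]_(l, d)) (sh : T -> 'cV[R]_l) :
  (forall i j, measurable_fun setT (entry x i j)) ->
  (forall i j, measurable_fun setT (entry S i j)) ->
  (forall i j, measurable_fun setT (entry sh i j)) ->
  measurable_fun setT (fun w => successful pr f (x w) (S w) (sh w)) /\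
  forall i j, measurable_fun setT (entry (fun w => x w + (S w)^T *m sh w) i j).
Proof.
move=> mx mS msh.
pose B w : pack := block_mx (x w) (S w)^T 0 (sh w)^T.
have mB i j : measurable_fun setT (entry B i j).
  rewrite -(splitK i) -(splitK j).
  case: (fintype.split i) => k; case: (fintype.split j) => k' /=.
  - rewrite (_ : entry _ _ _ = entry x k k')//.
    by apply/funext => w; rewrite /entry block_mxEul.
  - rewrite (_ : entry _ _ _ = entry S k' k)//.
    by apply/funext => w; rewrite /entry block_mxEur mxE.
  - rewrite (_ : entry _ _ _ = cst 0)//.
    by apply/funext => w; rewrite /entry block_mxEdl mxE.
  - rewrite (_ : entry _ _ _ = entry sh k' k)//.
    by apply/funext => w; rewrite /entry block_mxEdr mxE.
have pxE w : px (B w) = x w by rewrite /px block_mxKul.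
have psE w : ps (B w) = (S w)^T *m sh w by rewrite /ps block_mxKur block_mxKdr trmxK.
split.
  have := measurable_continuous_mx mB continuous_success_gap => mg.
  rewrite (_ : (fun _ => _) = (fun w => success_gap (B w) <= 0)).
    by apply: measurable_fun_ler => //; exact: measurable_cst.
  apply/funext => w; rewrite /success_gap pxE psE subr_le0 /successful qhat0.
  by rewrite qhatE.
move=> i j; rewrite (_ : entry _ i j = (fun w => (px (B w) + ps (B w)) i j)).
  apply: (measurable_continuous_mx (g := fun B => (px B + ps B) i j) mB).
  under eq_fun do rewrite mxE.
  exact: (continuous_addr (continuous_entry (i := i) (j := j) continuous_px)
                          (continuous_entry (i := i) (j := j) continuous_ps)).
by apply/funext => w; rewrite pxE psE.
Qed.

(** The update selects between two adapted points according to an adapted test. Independence of S_k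
    from the past is useful only once x_k is known to belong to that past. *)
Lemma run_iterate_adapted d1 (T : measurableType d1) (P : probability T R) (x0 : 'cV[R]_d)
    n (F : nat -> set (set T)) (S : nat -> T -> 'M[R]_(l, d)) (shat : nat -> T -> 'cV[R]_l)
    (x : nat -> T -> 'cV[R]_d) (alpha : nat -> T -> R) :
  rarc_run pr P f x0 n F S shat x alpha ->
  forall k, (k <= n)%N -> mx_measurable_wrt (F k) (x k).
Proof.
move=> run; have [sF _ mF] := run_filtration run.
elim=> [_|k IH kn] i j B mB.
  apply/(measurable_sub_space (sF 0%N)).
  rewrite (_ : entry _ i j = cst (x0 i j)); last first.
    by apply/funext => w; rewrite /entry (run_x_init run).
  have := @measurable_cst _ _ (sub_space (F 0%N)) R setT (x0 i j) measurableT B mB.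
  by rewrite setTI.
have mxk : forall i j, measurable_fun setT (entry (x k) i j : sub_space (F k.+1) -> R).
  apply: mx_measurable_wrtP => // i' j' B' mB'; apply: mF.
  by apply: IH => //; exact: ltnW.
have mS := mx_measurable_wrtP (sF k.+1) (run_sketch_adapted run kn).
have msh := mx_measurable_wrtP (sF k.+1) (run_step_adapted run kn).
have [msu mst] := measurable_successful mxk mS msh.
apply/(measurable_sub_space (sF k.+1)).
rewrite (_ : entry (x k.+1) i j = (fun w =>
    if successful pr f (x k w) (S k w) (shat k w)
    then entry (fun w => x k w + (S k w)^T *m shat k w) i j w else entry (x k) i j w)).
  have := measurable_fun_ifT msu (mst i j) (mxk i j) measurableT mB.
  by rewrite setTI.
apply/funext => w; have := run_update run w kn; rewrite /entry.
by case: ifP => _ [-> _].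
Qed.

Lemma run_taylor_adapted d1 (T : measurableType d1) (P : probability T R) (x0 : 'cV[R]_d)
    n (F : nat -> set (set T)) (S : nat -> T -> 'M[R]_(l, d)) (shat : nat -> T -> 'cV[R]_l)
    (x : nat -> T -> 'cV[R]_d) (alpha : nat -> T -> R) :
  rarc_run pr P f x0 n F S shat x alpha -> forall k, (k <= n)%N ->
  mx_measurable_wrt (F k) (fun w => row_mx (grad f (x k w)) (hess f (x k w)) : 'M[R]_(d, 1 + d)).
Proof.
move=> run k kn i j B mB; have [sF _ mF] := run_filtration run.
have mx := mx_measurable_wrtP (sF k) (run_iterate_adapted run kn).
have [_ _ ch] := f_C2.
apply/(measurable_sub_space (sF k)).
have cr : continuous (fun y => (row_mx (grad f y) (hess f y) : 'M[R]_(d, 1 + d)) i j).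
  rewrite -(splitK j); case: (fintype.split j) => k' /=.
    under eq_fun do rewrite row_mxEl.
    exact: (continuous_entry continuous_grad).
  under eq_fun do rewrite row_mxEr.
  exact: (continuous_entry ch).
have := measurable_continuous_mx mx cr measurableT mB.
by rewrite setTI.
Qed.

Lemma measurable_grad_norm2 d1 (T : measurableType d1) (x : T -> 'cV[R]_d) :
  (forall i j, measurable_fun setT (entry x i j)) ->
  measurable_fun setT (fun w => norm2 (grad f (x w))).
Proof.
move=> mx; apply: (measurable_continuous_mx (g := fun y => norm2 (grad f y)) mx).
by apply: continuous_norm2; exact: continuous_grad.
Qed.

End run_measurability.

Lemma measurable_bigminr {R : realType} d (T : measurableType d) (I : Type) (r : seq I)
    (f0 : T -> R) (f : I -> T -> R) :
  measurable_fun setT f0 -> (forall i, measurable_fun setT (f i)) ->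
  measurable_fun setT (fun w => \big[Num.min/f0 w]_(i <- r) f i w).
Proof.
move=> m0 mf; elim: r => [|i r IH]; first by under eq_fun do rewrite big_nil.
by under eq_fun do rewrite big_cons; exact: measurable_minr.
Qed.

Lemma rank_row_mx_le (F : fieldType) m n p (A : 'M[F]_(m, n)) (B : 'M[F]_(m, p)) :
  (\rank (row_mx A B) <= \rank A + \rank B)%N.
Proof.
rewrite -mxrank_tr tr_row_mx -addsmxE -(mxrank_tr A) -(mxrank_tr B).
by case: (mxrank_adds_leqif A^T B^T).
Qed.

(** * The deterministic argument along one path *)

Section bound_monotonicity.
Context {R : realType} (pr : rarc_params R) (LH e Sm eps : R).
Hypotheses (LH_gt0 : 0 < LH) (e_lt1 : e < 1) (Sm_gt0 : 0 < Sm) (eps_gt0 : 0 < eps).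

Let gap_gt0 a : 0 < a -> 0 < a^-1 * Sm + kappaT pr.
Proof. by move=> a0; rewrite ltr_pwDl ?kappaT_ge0// mulr_gt0// invr_gt0. Qed.

Let sqrt_gt0 : 0 < Num.sqrt (1 - e).
Proof. by rewrite sqrtr_gt0 subr_gt0. Qed.

Lemma hbound_gt0 a : 0 < a -> 0 < hbound pr LH e Sm eps a.
Proof.
move=> a0; have /andP[t0 _] := theta_itv pr.
rewrite /hbound; apply: mulr_gt0; first apply: mulr_gt0.
- by rewrite divr_gt0// mulr_gt0// alpha_max_gt0.
- by rewrite powR_gt0// divr_gt0.
rewrite lt_min; apply/andP; split; first by rewrite divr_gt0// powR_gt0.
by rewrite powR_gt0// divr_gt0// gap_gt0.
Qed.

(** Lets every true successful iteration be charged one common decrease, taken at a step size below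
    all those that occur. *)
Lemma hbound_homo a b : 0 < a -> a <= b -> hbound pr LH e Sm eps a <= hbound pr LH e Sm eps b.
Proof.
move=> a0 ab; have /andP[t0 _] := theta_itv pr; have b0 := lt_le_trans a0 ab.
rewrite /hbound ler_wpM2l//.
  by rewrite mulr_ge0 ?powR_ge0// divr_ge0 ?(ltW t0)// mulr_ge0// ltW// alpha_max_gt0.
rewrite le_min !ge_min lexx/=; apply/orP; right.
apply: ge0_ler_powR; rewrite ?nnegrE ?divr_ge0 ?(ltW sqrt_gt0) ?(ltW (gap_gt0 _))//.
rewrite ler_wpM2l ?(ltW sqrt_gt0)// lef_pV2 ?posrE ?gap_gt0// lerD2r.
by rewrite ler_wpM2r ?(ltW Sm_gt0)// lef_pV2 ?posrE.
Qed.

End bound_monotonicity.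

Lemma S_max_gt0 {R : realType} (Cl : R) d r : 0 < S_max Cl d r.
Proof.
by rewrite /S_max ltr_pwDl// divr_ge0 ?sqrtr_ge0// addr_ge0 ?sqrtr_ge0.
Qed.

Lemma half_itv (R : realType) : 0 < (1 / 2 : R) < 1.
Proof. by apply/andP; split; lra. Qed.

(** Here t counts the true iterations, n those also successful, k is c / (c + 1)^2, ta is the term
    with tau, and D is the number of decreases of size h that fit above [fstar]. *)
Lemma good_count_exceeds (R : realType) (n t k N ta D de : R) :
  t - (1 - k) * N - ta <= n -> D + ta <= N * (7 / 8 * (1 - de) - 1 + k) ->
  (1 - de) * (7 / 8) * N < t -> D < n.
Proof. by lra. Qed.

Section one_path.
Context {R : realType} (l d : nat) (f : 'cV[R]_d -> R) (fstar LH eps Sm : R) (pr : rarc_params R).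
Hypotheses (f_lb : forall x, fstar <= f x) (f_C2 : twice_continuously_differentiable f)
  (LH_gt0 : 0 < LH) (f_LH : lipschitz_hessian LH f) (eps_gt0 : 0 < eps) (Sm_gt0 : 0 < Sm).
Variables (disp : measure_display) (T : measurableType disp) (P : probability T R)
  (x0 : 'cV[R]_d) (N : nat) (F : nat -> set (set T)) (S : nat -> T -> 'M[R]_(l, d))
  (shat : nat -> T -> 'cV[R]_l) (x : nat -> T -> 'cV[R]_d) (alpha : nat -> T -> R).
Hypothesis run : rarc_run pr P f x0 N.+1 F S shat x alpha.
Variables (w : T) (tr : nat -> bool).
Hypotheses (tr_norm : forall k v, (k < N)%N -> tr k -> norm2 (S k w *m v) <= Sm * norm2 v)
  (tr_emb : forall k s, (k < N)%N -> tr k ->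
    (1 - 1 / 2) * norm2 (grad f (x k w) + hess f (x k w) *m s) ^+ 2 <=
    norm2 (S k w *m (grad f (x k w) + hess f (x k w) *m s)) ^+ 2).

Let h := hbound pr LH (1 / 2) Sm eps (alpha0 pr * gamma1 pr ^ ((cexp pr)%:Z + tau_alpha pr LH)).

(** The sketches enter only through the two inequalities assumed at true iterations, so all
    randomness is confined to the number of true iterations. *)
Lemma many_true_sketches_reach_tolerance (delta1 : R) :
  0 < gfactor pr delta1 ->
  gfactor pr delta1 * ((f x0 - fstar) / h + (tau_alpha pr LH)%:~R / (1 + (cexp pr)%:R)) <= N%:R ->
  (1 - delta1) * (7 / 8) * N%:R < (\sum_(k < N) tr k)%N%:R ->
  exists2 k, (k < N)%N & norm2 (grad f (x k.+1 w)) <= eps.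
Proof.
have e12 := half_itv R.
have e1 : (1 / 2 : R) < 1 by case/andP: e12.
move=> g_gt0 N_large many.
apply: contrapT => none.
have big k : (k < N)%N -> eps < norm2 (grad f (x k.+1 w)).
  by move=> kN; rewrite ltNge; apply/negP => le; apply: none; exists k.
pose su k := successful pr f (x k w) (S k w) (shat k w).
have kN1 k : (k < N)%N -> (k < N.+1)%N by move/ltnW.
have upd k : (k < N)%N -> alpha k.+1 w =
    if su k then Num.min (alpha_max pr) (gamma2 pr * alpha k w) else gamma1 pr * alpha k w.
  by move=> kN; have := run_update run w (kN1 _ kN); rewrite /su; case: ifP => _ [_ ->].
have small k : (k < N)%N -> 0 < alpha k w -> alpha k w <= alpha_low pr LH -> su k.
  move=> kN a0 al; apply: (small_alpha_successful f_C2 f_LH LH_gt0 a0 al).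
  exact: (run_model_decrease run w (kN1 _ kN)).
have a_init := run_alpha_init run w.
have bounds := step_size_bounds LH_gt0 a_init upd small.
have g0 : 0 < gamma1 pr by case/andP: (gamma1_itv pr).
have base z : 0 < alpha0 pr * gamma1 pr ^ z by rewrite mulr_gt0 ?alpha0_gt0// exprz_gt0.
have apos k : (k < N)%N -> 0 < alpha k w.
  by move=> kN; have /andP[+ _] := bounds _ (ltnW kN); exact: lt_le_trans.
have xS k : (k < N)%N -> su k -> x k.+1 w = x k w + (S k w)^T *m shat k w.
  by move=> kN sk; have := run_update run w (kN1 _ kN); rewrite -/(su k) sk => -[].
have xU k : (k < N)%N -> ~~ su k -> x k.+1 w = x k w.
  by move=> kN /negPf sk; have := run_update run w (kN1 _ kN); rewrite -/(su k) sk => -[].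
have md k (kN : (k < N)%N) := run_model_decrease run w (kN1 _ kN).
have h0 : 0 < h by exact: hbound_gt0.
have dec : (\sum_(k < N) (su k && tr k))%N%:R * h <= f (x 0%N w) - f (x N w).
  apply: (@good_iterations_decrease _ su N tr (fun k => f (x k w))) => k kN.
    have [sk|sk] := boolP (su k); last by rewrite (xU _ kN sk).
    have /andP[_ amax] := bounds _ (ltnW kN).
    have := successful_decrease (apos _ kN) amax (md _ kN) sk.
    rewrite -(xS _ kN sk) => le; rewrite -subr_ge0; apply: le_trans le.
    have /andP[t0 _] := theta_itv pr.
    by rewrite mulr_ge0 ?exprn_ge0 ?norm2_ge0// divr_ge0 ?(ltW t0)// mulr_ge0// ltW// alpha_max_gt0.
  move=> sk tk; have /andP[amin amax] := bounds _ (ltnW kN).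
  have bk : eps < norm2 (grad f (x k w + (S k w)^T *m shat k w)) by rewrite -xS// big.
  rewrite (xS _ kN sk).
  apply: (le_trans _ (true_successful_decrease (ltW LH_gt0) f_C2 f_LH LH_gt0 (apos _ kN) amax Sm_gt0 e12
    eps_gt0 (md _ kN) (run_model_grad run w (kN1 _ kN)) (fun v => tr_norm v kN tk)
    (tr_emb _ kN tk) sk bk)).
  (* Step sizes stay above alpha0 gamma1^tau, hence above alpha0 gamma1^(c + tau), where h is
     evaluated. *)
  apply: hbound_homo => //.
  apply: le_trans amin; rewrite ler_pM2l ?alpha0_gt0//.
  by apply: gamma1_exprz_anti; rewrite lerDr.
have cnt := good_count_ge LH_gt0 a_init upd small tr.
have lb := f_lb (x N w); rewrite (run_x_init run) in dec.
move: N_large; rewrite mulrC -ler_pdivlMr// /gfactor invrK.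
move: g_gt0; rewrite invr_gt0 => G0.
have Dh : (f x0 - fstar) / h * h = f x0 - fstar by rewrite divfK// gt_eqF.
move=> N_large.
have := good_count_exceeds cnt N_large many.
rewrite -(ltr_pM2r h0) Dh => lt.
by have := lt_le_trans lt dec; rewrite ltrD2l ltrN2 ltNge lb.
Qed.

End one_path.

Theorem theorem4p1 (R : realType)
    (d l r : nat) (f : 'cV[R]_d -> R) (fstar LH eps Cl : R)
    (pr : rarc_params R) (x0 : 'cV[R]_d)
    (f_lb : forall x, fstar <= f x)
    (f_C2 : twice_continuously_differentiable f)
    (LH_gt0 : 0 < LH) (f_LH : lipschitz_hessian LH f)
    (eps_gt0 : 0 < eps)
    (Cl_emb : embedding_constant Cl)
    (r_le_d : (r <= d)%N)
    (l_def : l%:R = 4 * Cl * (ln 16 + r%:R + 1))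
    (c_cond : 1 / 8 < (cexp pr)%:R / ((cexp pr)%:R + 1) ^+ 2 :> R)
    (disp : measure_display) (T : measurableType disp) (P : probability T R)
    (N : nat) (F : nat -> set (set T))
    (S : nat -> T -> 'M[R]_(l, d)) (shat : nat -> T -> 'cV[R]_l)
    (x : nat -> T -> 'cV[R]_d) (alpha : nat -> T -> R)
    (S_gauss : forall k, (k <= N)%N -> scaled_gaussian P (S k))
    (run : rarc_run pr P f x0 N.+1 F S shat x alpha)
    (hess_rank : forall k w, (k <= N)%N -> (\rank (hess f (x k w)) <= r)%N)
    (delta1 : R) (delta1_itv : 0 < delta1 < 1)
    (g_gt0 : 0 < gfactor pr delta1)
    (N_large :
       gfactor pr delta1 *
         ((f x0 - fstar) /
            hbound pr LH (1 / 2) (S_max Cl d r) eps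
              (alpha0 pr * gamma1 pr ^ ((cexp pr)%:Z + tau_alpha pr LH)) +
          (tau_alpha pr LH)%:~R / (1 + (cexp pr)%:R)) <= N%:R) :
  ((1 - expR (- (7 * delta1 ^+ 2 / 16 * N%:R)))%:E <=
   P [set w | (\big[Num.min/norm2 (grad f (x 1%N w))]_(k < N.+1)
                 norm2 (grad f (x k.+1 w)) <= eps)%R])%E.
Proof.
have F_filtration := run_filtration run; have [sF mF _] := F_filtration.
pose M k w : 'M[R]_(d, d.+1) := row_mx (grad f (x k w)) (hess f (x k w)) : 'M[R]_(d, 1 + d).
have /choice[E HE] : forall k, exists E : set T, (k < N)%N -> [/\
    forall G', sigma_algebra setT G' -> F k `<=` G' -> mx_measurable_wrt G' (S k) -> G' E,
    forall w v, E w -> norm2 (S k w *m v) <= S_max Cl d r * norm2 v,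
    forall w z, E w -> (1 - 1 / 2) * norm2 (M k w *m z) ^+ 2 <= norm2 (S k w *m M k w *m z) ^+ 2 &
    forall A, F k A -> ((7 / 8)%:E * P A <= P (A `&` E))%E].
  (* The run has N + 1 iterations, but only those with k < N are counted; beyond them the event is a
     placeholder. *)
  move=> k; have [kN|kN] := ltnP k N; last by exists set0.
  have rk w : (\rank (M k w) <= r.+1)%N.
    apply: (leq_trans (rank_row_mx_le (grad f (x k w)) (hess f (x k w)))).
    rewrite -(add1n r).
    by rewrite leq_add ?rank_leq_col ?hess_rank// ltnW.
  have [E HE] := sketch_event_exists Cl_emb l_def (sF k) (mF k) (S_gauss _ (ltnW kN))
    (run_sketch_indep run (leqW kN)) (run_taylor_adapted f_C2 run (ltnW (leqW kN))) rk.
  by exists E.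
have p78 : 0 <= 7 / 8 :> R by lra.
have p78' : 7 / 8 <= 1 :> R by lra.
have E_adapted k : (k < N)%N -> F k.+1 (E k).
  move=> kN; have [h _ _ _] := HE k kN.
  by apply: h; [exact: sF|case: F_filtration => _ _; exact|exact: (run_sketch_adapted run (leqW kN))].
have E_prob k : (k < N)%N -> forall A, F k A -> ((7 / 8)%:E * P A <= P (A `&` E k))%E.
  by move=> kN; have [] := HE k kN.
have /andP[de0 _] := delta1_itv.
have tail := hits_lower_tail p78 p78' F_filtration E_adapted E_prob (ltW de0).
have mA := measurable_hits_le F_filtration E_adapted ((1 - delta1) * (7 / 8) * N%:R).
set A := [set w | _] in tail mA.
(* A is the event of too few true iterations. Off A the path argument provides an iterate within
   tolerance. *)
apply: (@le_trans _ _ (P (~` A))).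
  rewrite probability_setC// EFinB; apply: leeB => //; apply: (le_trans tail).
  by rewrite lee_fin (_ : 7 / 8 * delta1 ^+ 2 / 2 * N%:R = 7 * delta1 ^+ 2 / 16 * N%:R)//; field.
apply: le_measure; rewrite ?inE//.
- exact: measurableC.
- have mx k : (k <= N.+1)%N -> measurable_fun setT (fun w => norm2 (grad f (x k w))).
    move=> kN; apply: (measurable_grad_norm2 f_C2) => i j _ B mB; rewrite setTI.
    by apply: (mF k); exact: (run_iterate_adapted f_C2 run kN).
  rewrite -[X in measurable X]setTI.
  have := @measurable_bigminr R _ T _ (index_enum 'I_N.+1)
    (fun w => norm2 (grad f (x 1%N w))) (fun k w => norm2 (grad f (x k.+1 w)))
    (mx 1%N isT) (fun k => mx k.+1 (ltn_ord k)) measurableT `]-oo, eps]%classic (measurable_itv _).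
  by congr measurable; apply/seteqP; split => w /=; rewrite in_itv.
- move=> w /= /negP; rewrite -ltNge => many.
  have [||k kN le] := @many_true_sketches_reach_tolerance R l d f fstar LH eps (S_max Cl d r) pr
    f_lb f_C2 LH_gt0 f_LH eps_gt0 (S_max_gt0 _ _ _) _ T P x0 N F S shat x alpha run w
    (fun k => w \in E k) _ _ delta1 g_gt0 N_large many.
  + by move=> k v kN; rewrite inE => Ew; have [_ h _ _] := HE k kN; exact: h.
  + move=> k s kN; rewrite inE => Ew; have [_ _ h _] := HE k kN.
    (* At z = (1, s) the vector M z is grad f + hess f s, the one needed in the path argument. *)
    have := h w (col_mx (1%:M : 'M[R]_1) s : 'cV[R]_(1 + d)) Ew.
    rewrite -mulmxA.
    have -> : M k w *m (col_mx (1%:M : 'M[R]_1) s : 'cV[R]_(1 + d)) = grad f (x k w) + hess f (x k w) *m s.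
      by rewrite /M (mul_row_col (grad f (x k w)) (hess f (x k w)) 1%:M s) mulmx1.
    exact.
  apply: le_trans le.
  exact: (bigmin_le _ (Ordinal (ltnW kN : (k < N.+1)%N))).
Qed.
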